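(* Let $\theta\in\mathbb{N}$, $\mathbb{I}=\{1,\dots,\theta\}$ and $M\in\mathcal{M}_\theta$. Assume that $N$ is $\mathbb{I}$-finite for all $N\in\mathcal{M}_\theta(M)$. Then $$\mathcal{C}(M)=(\mathbb{I},\mathcal{M}_\theta(M),(r_i)_{i\in\mathbb{I}},(A^N)_{N\in\mathcal{M}_\theta(M)})$$ is a Cartan scheme.
   Context: $\Bbbk$ is a field and $H$ is a Hopf algebra over $\Bbbk$ with bijective antipode $S$. ${}^H_H\mathcal{YD}$ is the category of left Yetter-Drinfeld modules over $H$: left $H$-modules $V$ with a left $H$-comodule structure $\delta(v)=v_{(-1)}\otimes v_{(0)}$ such that $\delta(h\cdot v)=h_{(1)}v_{(-1)}S(h_{(3)})\otimes h_{(2)}\cdot v_{(0)}$. It is braided with braiding $c(x\otimes y)=x_{(-1)}\cdot y\otimes x_{(0)}$. For $V\in{}^H_H\mathcal{YD}$ the tensor algebra $T(V)$ is a braided Hopf algebra in which the elements of $V$ are primitive, and the Nichols algebra of $V$ is $\mathfrak{B}(V)=T(V)/I_V$, where $I_V$ is the largest coideal of $T(V)$ contained in $\bigoplus_{n\ge 2}V^{\otimes n}$. For $x\in V$ and $y\in\mathfrak{B}(V)$ put $(\mathrm{ad}_c x)(y)=xy-(x_{(-1)}\cdot y)x_{(0)}$; for subspaces $X\subset V$, $Y\subset\mathfrak{B}(V)$, $(\mathrm{ad}_c X)(Y)$ is the span of all $(\mathrm{ad}_c x)(y)$, and $(\mathrm{ad}_c X)^h(Y)$ is its $h$-fold iterate.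 $X^*$ denotes the (left) dual of a finite-dimensional object $X$ of ${}^H_H\mathcal{YD}$. $\mathcal{M}_\theta$ is the set of $\theta$-tuples $N=([N_1],\dots,[N_\theta])$ of isomorphism classes of finite-dimensional irreducible objects of ${}^H_H\mathcal{YD}$, and $V(N)=N_1\oplus\cdots\oplus N_\theta$. Let $i\in\mathbb{I}$. $N$ is $i$-finite if for all $j\in\mathbb{I}\setminus\{i\}$ there is $h\in\mathbb{N}$ with $(\mathrm{ad}_cN_i)^h(N_j)=0$ in $\mathfrak{B}(V(N))$; $N$ is $\mathbb{I}$-finite if it is $i$-finite for all $i\in\mathbb{I}$. If $N$ is not $i$-finite, $r_i(N)=N$. If $N$ is $i$-finite, put $a^N_{ii}=2$ and, for $j\ne i$, $-a^N_{ij}=\sup\{h\in\mathbb{N}_0\mid(\mathrm{ad}_cN_i)^h(N_j)\ne0\text{ in }\mathfrak{B}(V(N))\}$, and $r_i(N)=([N'_1],\dots,[N'_\theta])\in\mathcal{M}_\theta$ with $N'_i=N_i^*$ and $N'_j=(\mathrm{ad}_cN_i)^{-a^N_{ij}}(N_j)$ for $j\ne i$ (it is known that these $N'_j$ are again finite-dimensional irreducible). If $N$ is $\mathbb{I}$-finite, $A^N=(a^N_{ij})_{i,j\in\mathbb{I}}$. For $M\in\mathcal{M}_\theta$, $\mathcal{M}_\theta(M)=\{r_{i_1}\cdots r_{i_n}(M)\mid n\in\mathbb{N}_0,\ i_1,\dots,i_n\in\mathbb{I}\}$. A generalized Cartan matrix is $A=(a_{ij})_{i,j\in I}\in\mathbb{Z}^{I\times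 I}$ such that $a_{ii}=2$, $a_{jk}\le0$ for $j\ne k$, and $a_{ij}=0$ implies $a_{ji}=0$. A Cartan scheme is a quadruple $\mathcal{C}(I,\mathcal{M},(r_i)_{i\in I},(A^N)_{N\in\mathcal{M}})$ with $I$ a non-empty finite set, $\mathcal{M}$ a non-empty set, maps $r_i:\mathcal{M}\to\mathcal{M}$, and generalized Cartan matrices $A^N=(a^N_{jk})_{j,k\in I}$, such that (C1) $r_i^2=\mathrm{id}$ for all $i\in I$; (C2) $a^N_{ij}=a^{r_i(N)}_{ij}$ for all $N\in\mathcal{M}$, $i,j\in I$. *)

(* Defs.v *)
From HB Require Import structures.
From mathcomp Require Import all_boot all_order all_algebra.
From mathcomp Require Import boolp classical_sets.

Set Implicit Arguments.
Unset Strict Implicit.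
Unset Printing Implicit Defensive.

Import GRing.Theory.
Local Open Scope classical_set_scope.
Local Open Scope ring_scope.
Local Open Scope quotient_scope.

Lemma linear_at0 (k : fieldType) (V W : lmodType k) (f : V -> W) :
  linear f -> f 0 = 0.
Proof. by move=> lf; have := lf (- 1) 0 0; rewrite !scaleN1r oppr0 addr0 addNr. Qed.

(* The vector space generated by X and universal for the maps X -> W that    *)
(* satisfy adm: formal linear combinations of elements of X, two of them     *)
(* being identified when no map satisfying adm tells them apart. Tensor      *)
(* products and tensor algebras are instances.                               *)
Section Universal.
Variables (k : fieldType) (X : choiceType).
Variable adm : forall W : lmodType k, (X -> W) -> Prop.

Definition ueval (W : lmodType k) (f : X -> W) (s : seq (k * X)) : W :=
  \sum_(c <- s) c.1 *: f c.2.

Definition ueq (s t : seq (k * X)) : bool :=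
  `[< forall (W : lmodType k) (f : X -> W), adm f -> ueval f s = ueval f t >].

Lemma ueq_equiv : equiv_class_of ueq.
Proof.
split=> [s|s t|t s u].
- exact/asboolP.
- by apply/asboolP/asboolP => e W f fa; rewrite e.
- by move=> /asboolP st /asboolP tu; apply/asboolP => W f fa; rewrite st// tu.
Qed.

Canonical ueq_equivRel := EquivRelPack ueq_equiv.

Definition univ := {eq_quot ueq}.
HB.instance Definition _ := Choice.on univ.
HB.instance Definition _ := EqQuotient.on univ.

Definition ulift (W : lmodType k) (f : X -> W) (x : univ) : W :=
  ueval f (repr x).

Lemma ulift_pi (W : lmodType k) (f : X -> W) s : adm f -> ulift f (\pi_univ s) = ueval f s.
Proof.
move=> fa; have : repr (\pi_univ s) = s %[mod univ] by rewrite reprK.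
by move=> /eqmodP/asboolP; apply.
Qed.

Lemma univ_ext (x y : univ) :
  (forall (W : lmodType k) (f : X -> W), adm f -> ulift f x = ulift f y) ->
  x = y.
Proof.
by move=> e; rewrite -[x]reprK -[y]reprK; apply/eqmodP/asboolP => W f /e.
Qed.

Definition uzero : univ := \pi_univ [::].
Definition uadd (x y : univ) : univ := \pi_univ (repr x ++ repr y).
Definition uscale (a : k) (x : univ) : univ :=
  \pi_univ [seq (a * c.1, c.2) | c <- repr x].

Lemma ulift0_subproof (W : lmodType k) (f : X -> W) : adm f -> ulift f uzero = 0.
Proof. by move=> fa; rewrite ulift_pi// /ueval big_nil. Qed.

Lemma uliftD_subproof (W : lmodType k) (f : X -> W) x y :
  adm f -> ulift f (uadd x y) = ulift f x + ulift f y.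
Proof. by move=> fa; rewrite ulift_pi// /ueval big_cat. Qed.

Lemma uliftZ_subproof (W : lmodType k) (f : X -> W) a x :
  adm f -> ulift f (uscale a x) = a *: ulift f x.
Proof.
move=> fa; rewrite ulift_pi// /ueval big_map scaler_sumr.
by apply: eq_bigr => c _; rewrite scalerA.
Qed.

Let uliftE := (ulift0_subproof, uliftD_subproof, uliftZ_subproof).

Lemma uaddA : associative uadd.
Proof. by move=> x y z; apply: univ_ext => W f fa; rewrite !uliftE// addrA. Qed.
Lemma uaddC : commutative uadd.
Proof. by move=> x y; apply: univ_ext => W f fa; rewrite !uliftE// addrC. Qed.
Lemma uadd0 : left_id uzero uadd.
Proof. by move=> x; apply: univ_ext => W f fa; rewrite !uliftE// add0r. Qed.
Lemma uaddN : left_inverse uzero (uscale (- 1)) uadd.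
Proof.
by move=> x; apply: univ_ext => W f fa; rewrite !uliftE// scaleN1r addNr.
Qed.
HB.instance Definition _ :=
  GRing.isZmodule.Build univ uaddA uaddC uadd0 uaddN.

Lemma uscaleA a b x : uscale a (uscale b x) = uscale (a * b) x.
Proof. by apply: univ_ext => W f fa; rewrite !uliftE// scalerA. Qed.
Lemma uscale1 : left_id 1 uscale.
Proof. by move=> x; apply: univ_ext => W f fa; rewrite !uliftE// scale1r. Qed.
Lemma uscaleDr : right_distributive uscale +%R.
Proof.
by move=> a x y; apply: univ_ext => W f fa; rewrite !uliftE// scalerDr.
Qed.
Lemma uscaleDl x : {morph uscale^~ x : a b / a + b}.
Proof.
by move=> a b; apply: univ_ext => W f fa; rewrite !uliftE// scalerDl.
Qed.
HB.instance Definition _ :=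
  GRing.Zmodule_isLmodule.Build k univ uscaleA uscale1 uscaleDr uscaleDl.

Definition uinj (x : X) : univ := \pi_univ [:: (1, x)].

Lemma ulift_inj (W : lmodType k) (f : X -> W) x : adm f -> ulift f (uinj x) = f x.
Proof. by move=> fa; rewrite ulift_pi// /ueval big_seq1 scale1r. Qed.

Lemma ulift_linear (W : lmodType k) (f : X -> W) : adm f -> linear (ulift f).
Proof. by move=> fa a x y; rewrite uliftD_subproof// uliftZ_subproof. Qed.

Lemma univ_repr (x : univ) : x = \sum_(c <- repr x) c.1 *: uinj c.2.
Proof.
apply: univ_ext => W f fa; rewrite {1}/ulift /ueval.
have lf := ulift_linear fa.
pose F : {linear univ -> W} :=
  HB.pack (ulift f) (GRing.isLinear.Build k univ W *:%R (ulift f) lf).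
rewrite -[RHS]/(F _) linear_sum; apply: eq_bigr => c _.
by rewrite linearZ /= ulift_inj.
Qed.

Lemma univ_ind (P : univ -> Prop) :
  P 0 -> (forall a x y, P y -> P (a *: uinj x + y)) -> forall z, P z.
Proof.
move=> P0 PD z; rewrite (univ_repr z).
elim: (repr z) => [|c s ih]; first by rewrite big_nil.
by rewrite big_cons; apply: PD.
Qed.

Lemma linear_eq (W : lmodType k) (f g : univ -> W) :
  linear f -> linear g -> (forall x, f (uinj x) = g (uinj x)) -> f =1 g.
Proof.
move=> lf lg e; apply: univ_ind => [|a x y ih]; last by rewrite lf lg e ih.
by rewrite (linear_at0 lf) (linear_at0 lg).
Qed.

End Universal.

Definition bilin (k : fieldType) (U V W : lmodType k) (b : U -> V -> W) :=
  (forall v, linear (b^~ v)) /\ (forall u, linear (b u)).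

Section Tensor.
Variables (k : fieldType) (U V : lmodType k).

Definition tensor := univ (fun (W : lmodType k) (f : U * V -> W) =>
  bilin (fun u v => f (u, v))).
HB.instance Definition _ := GRing.Lmodule.on tensor.

Definition ten (u : U) (v : V) : tensor := uinj _ (u, v).

Definition tsum (W : lmodType k) (t : tensor) (b : U -> V -> W) : W :=
  ulift (fun p => b p.1 p.2) t.

End Tensor.

Reserved Notation "U ⊗ V" (at level 40, left associativity).
Notation "U ⊗ V" := (tensor U V) : type_scope.
Notation "u ⊗ v" := (ten u v) : ring_scope.

(* Sweedler notation: \tsum_(x, y <- t) E is the sum of the E(x_i, y_i) over *)
(* a decomposition t = \sum_i x_i ⊗ y_i; when E is bilinear it is the image *)
(* of t under the linear map induced by E (lemmas tsum_ten, tsum_linear).    *)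
Reserved Notation "\tsum_ ( x , y <- t ) E"
  (at level 41, E at level 41, x name, y name, t at level 50,
   format "'[' \tsum_ ( x ,  y  <-  t ) '/  '  E ']'").
Notation "\tsum_ ( x , y <- t ) E" := (tsum t (fun x y => E)) : ring_scope.

Section TensorTheory.
Variables (k : fieldType) (U V : lmodType k).
Implicit Types (W : lmodType k) (t : (U ⊗ V)%type).

Lemma tsum_ten W (b : U -> V -> W) u v :
  bilin b -> \tsum_(x, y <- u ⊗ v) b x y = b u v.
Proof. by move=> bb; rewrite /tsum /ten ulift_inj. Qed.

Lemma tsum_linear W (b : U -> V -> W) :
  bilin b -> linear (fun t => \tsum_(x, y <- t) b x y).
Proof. by move=> bb; apply: ulift_linear. Qed.

Lemma tsumE W (b : U -> V -> W) t :
  \tsum_(x, y <- t) b x y = \sum_(c <- repr t) c.1 *: b c.2.1 c.2.2.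
Proof. by []. Qed.

Lemma ten_bilin : bilin (@ten k U V).
Proof.
by split=> [v|u] a x y; apply: univ_ext => W f [fl fr];
  have [fa fb] : bilin (fun u v => f (u, v)) by [];
  rewrite (ulift_linear (f := f))// !ulift_inj// (fl, fr).
Qed.

Lemma tsum_id t : \tsum_(x, y <- t) x ⊗ y = t.
Proof.
by rewrite [RHS]univ_repr tsumE; apply: eq_bigr => -[a [u v]].
Qed.

Lemma tsum_param W W' (b : W' -> U -> V -> W) t :
  (forall u v, linear (fun w => b w u v)) ->
  linear (fun w => \tsum_(x, y <- t) b w x y).
Proof.
move=> lb a x y; rewrite !tsumE scaler_sumr -big_split; apply: eq_bigr => c _.
by rewrite lb scalerDr !scalerA (mulrC a).
Qed.

Lemma tsum_comp W W' (F : W -> W') (b : U -> V -> W) t :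
  linear F -> F (\tsum_(x, y <- t) b x y) = \tsum_(x, y <- t) F (b x y).
Proof.
move=> lF; rewrite !tsumE.
elim: (repr t) => [|c s ih]; first by rewrite !big_nil (linear_at0 lF).
by rewrite !big_cons lF ih.
Qed.

Lemma ten_ind (P : (U ⊗ V)%type -> Prop) :
  P 0 -> (forall x y, P x -> P y -> P (x + y)) -> (forall u v, P (u ⊗ v)) ->
  forall t, P t.
Proof.
move=> P0 PD Pt; apply: univ_ind => // a [u v] y Py; apply: PD => //.
have -> : a *: uinj _ (u, v) = (a *: u) ⊗ v; last exact: Pt.
by have [+ _] := ten_bilin => /(_ v a u 0); rewrite (linear_at0 (ten_bilin.1 v)) !addr0.
Qed.

Lemma tensor_eq W (f g : (U ⊗ V)%type -> W) :
  linear f -> linear g -> (forall u v, f (u ⊗ v) = g (u ⊗ v)) -> f =1 g.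
Proof. by move=> lf lg e; apply: linear_eq => // -[u v]; apply: e. Qed.

End TensorTheory.

Record hopfAlgebra (k : fieldType) := HopfAlgebra {
  hopf_alg :> algType k;
  comul : {linear hopf_alg -> (hopf_alg ⊗ hopf_alg)%type};
  counit : {linear hopf_alg -> k^o};
  antipode : {linear hopf_alg -> hopf_alg};
  comul_coassoc : forall h,
    \tsum_(x, h3 <- comul h) \tsum_(h1, h2 <- comul x) h1 ⊗ (h2 ⊗ h3) =
    \tsum_(h1, y <- comul h) h1 ⊗ comul y;
  counit_l : forall h, \tsum_(h1, h2 <- comul h) counit h1 *: h2 = h;
  counit_r : forall h, \tsum_(h1, h2 <- comul h) counit h2 *: h1 = h;
  comul1 : comul 1 = 1 ⊗ 1;
  comulM : forall g h, comul (g * h) =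
    \tsum_(g1, g2 <- comul g) \tsum_(h1, h2 <- comul h) (g1 * h1) ⊗ (g2 * h2);
  counit1 : counit 1 = 1;
  counitM : forall g h, counit (g * h) = (counit g : k) * counit h;
  antipode_l : forall h,
    \tsum_(h1, h2 <- comul h) antipode h1 * h2 = (counit h : k) *: 1;
  antipode_r : forall h,
    \tsum_(h1, h2 <- comul h) h1 * antipode h2 = (counit h : k) *: 1
} as H.

Arguments comul {k H}.
Arguments counit {k H}.
Arguments antipode {k H}.

Section YetterDrinfeld.
Variables (k : fieldType) (H : hopfAlgebra k).
Local Notation Δ := (@comul k H).
Local Notation ε := (@counit k H).
Local Notation S := (@antipode k H).

Record ydModule := YDModule {
  yd_space :> lmodType k;
  act : H -> yd_space -> yd_space;
  coact : {linear yd_space -> (H ⊗ yd_space)%type};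
  act_bilin : bilin act;
  act1 : forall v, act 1 v = v;
  actM : forall g h v, act (g * h) v = act g (act h v);
  coact_coassoc : forall v,
    \tsum_(h, v0 <- coact v) \tsum_(h1, h2 <- Δ h) h1 ⊗ (h2 ⊗ v0) =
    \tsum_(h, v0 <- coact v) h ⊗ coact v0;
  coact_counit : forall v, \tsum_(h, v0 <- coact v) ε h *: v0 = v;
  yd_compat : forall h v, coact (act h v) =
    \tsum_(h1, h23 <- Δ h) \tsum_(h2, h3 <- Δ h23) \tsum_(v1, v0 <- coact v)
      (h1 * v1 * S h3) ⊗ act h2 v0
} as V.

End YetterDrinfeld.
Arguments coact {k H V}.
Arguments act {k H V}.

Section TensorAlgebra.
Variables (k : fieldType) (V : lmodType k).

Definition multilin (W : lmodType k) (f : seq V -> W) :=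
  forall p q, linear (fun v => f (p ++ v :: q)).

Definition tensalg := univ multilin.
HB.instance Definition _ := GRing.Lmodule.on tensalg.

Definition word (w : seq V) : tensalg := uinj _ w.

Definition wlift (W : lmodType k) (f : seq V -> W) (t : tensalg) : W :=
  ulift f t.

Lemma wlift_word (W : lmodType k) (f : seq V -> W) w :
  multilin f -> wlift f (word w) = f w.
Proof. exact: ulift_inj. Qed.

Lemma wlift_linear (W : lmodType k) (f : seq V -> W) :
  multilin f -> linear (wlift f).
Proof. exact: ulift_linear. Qed.

Lemma wlift_param (W W' : lmodType k) (f : W' -> seq V -> W) t :
  (forall w, linear (fun a => f a w)) -> linear (fun a => wlift (f a) t).
Proof.
move=> lf a x y; rewrite /wlift /ulift /ueval scaler_sumr -big_split.
by apply: eq_bigr => c _; rewrite lf scalerDr !scalerA (mulrC a).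
Qed.

Lemma word_multilin : multilin word.
Proof.
move=> p q a x y; apply: univ_ext => W f fa.
by rewrite (ulift_linear fa) !ulift_inj// fa.
Qed.

Lemma tensalg_eq (W : lmodType k) (f g : tensalg -> W) :
  linear f -> linear g -> (forall w, f (word w) = g (word w)) -> f =1 g.
Proof. exact: linear_eq. Qed.

Lemma word_ind (P : tensalg -> Prop) :
  P 0 -> (forall a w y, P y -> P (a *: word w + y)) -> forall t, P t.
Proof. exact: univ_ind. Qed.

Definition tamul (x y : tensalg) : tensalg :=
  wlift (fun p => wlift (fun q => word (p ++ q)) y) x.

Let word_catr p : multilin (fun q => word (p ++ q)).
Proof. by move=> p' q a x y; rewrite !catA word_multilin. Qed.

Let word_catl y : multilin (fun p => wlift (fun q => word (p ++ q)) y).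
Proof.
move=> p q a u v; rewrite /= .
elim/word_ind: y => [|b w y ih].
  by rewrite !(linear_at0 (wlift_linear (@word_catr _))) scaler0 addr0.
rewrite !(wlift_linear (@word_catr _)) ih !wlift_word//.
rewrite -!catA !cat_cons word_multilin !scalerDr !scalerA (mulrC a).
by rewrite addrACA.
Qed.

Lemma tamul_bilin : bilin tamul.
Proof.
split=> [y|x]; first exact/wlift_linear/word_catl.
by apply: wlift_param => w; apply: wlift_linear.
Qed.

Lemma tamul_word p q : tamul (word p) (word q) = word (p ++ q).
Proof. by rewrite /tamul !wlift_word. Qed.

Let tamull y := tamul_bilin.1 y.
Let tamulr x := tamul_bilin.2 x.

Lemma tamulA : associative tamul.
Proof.
move=> x y z.
apply: (tensalg_eq (f := fun x => tamul x (tamul y z))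
  (g := fun x => tamul (tamul x y) z)) => {x} [|a u v|p]; first exact: tamull.
  by rewrite !tamull.
apply: (tensalg_eq (f := fun y => tamul (word p) (tamul y z))
  (g := fun y => tamul (tamul (word p) y) z)) => {y} [a u v|a u v|q].
- by rewrite tamull tamulr.
- by rewrite tamulr tamull.
apply: (tensalg_eq (f := fun z => tamul (word p) (tamul (word q) z))
  (g := tamul (tamul (word p) (word q)))) => {z} [a u v|a u v|r].
- by rewrite !tamulr.
- by rewrite tamulr.
by rewrite !tamul_word catA.
Qed.

Lemma tamul1l : left_id (word [::]) tamul.
Proof.
apply: tensalg_eq => [||p]; [exact: tamulr|by []|by rewrite tamul_word].
Qed.
Lemma tamul1r : right_id (word [::]) tamul.
Proof.
apply: (tensalg_eq (f := tamul^~ _)) => [||p]; [exact: tamull|by []|].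
by rewrite tamul_word cats0.
Qed.

Let add1 (W W' : lmodType k) (f : W -> W') : linear f -> {morph f : x y / x + y}.
Proof. by move=> lf x y; rewrite -[x]scale1r lf !scale1r. Qed.
Let scale0 (W W' : lmodType k) (f : W -> W') : linear f ->
  forall a x, f (a *: x) = a *: f x.
Proof. by move=> lf a x; rewrite -[a *: x]addr0 lf (linear_at0 lf) addr0. Qed.

Lemma tamulDl : left_distributive tamul +%R.
Proof. by move=> x y z; apply: (add1 (tamull z)). Qed.
Lemma tamulDr : right_distributive tamul +%R.
Proof. by move=> x y z; apply: (add1 (tamulr x)). Qed.

(* The counit of T(V): the component of degree 0. *)
Definition tcounit (t : tensalg) : k^o :=
  wlift (fun w => if w is [::] then 1 else 0 : k^o) t.

Lemma tcounit_multilin : multilin (fun w : seq V => if w is [::] then 1 else 0 : k^o).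
Proof. by move=> [|? p] q a x y /=; rewrite scaler0 addr0. Qed.

Lemma tcounit_linear : linear tcounit.
Proof. exact: wlift_linear tcounit_multilin. Qed.

Lemma tensalg1_neq0 : word [::] != 0.
Proof.
apply/eqP => /(congr1 tcounit); rewrite /tcounit.
rewrite wlift_word; last exact: tcounit_multilin.
have /= -> := linear_at0 (wlift_linear tcounit_multilin).
by move/eqP; rewrite oner_eq0.
Qed.

HB.instance Definition _ := GRing.Zmodule_isNzRing.Build tensalg
  tamulA tamul1l tamul1r tamulDl tamulDr tensalg1_neq0.

Lemma tensalg_scalerAl a (x y : tensalg) : a *: (x * y) = (a *: x) * y.
Proof. exact/esym/(scale0 (tamull y)). Qed.
HB.instance Definition _ :=
  GRing.Lmodule_isLalgebra.Build k tensalg tensalg_scalerAl.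

Lemma tensalg_scalerAr a (x y : tensalg) : a *: (x * y) = x * (a *: y).
Proof. exact/esym/(scale0 (tamulr x)). Qed.
HB.instance Definition _ :=
  GRing.Lalgebra_isAlgebra.Build k tensalg tensalg_scalerAr.

Definition tin (v : V) : tensalg := word [:: v].

Lemma tin_linear : linear tin.
Proof. exact: (word_multilin [::] [::]). Qed.

Lemma word_nil : word [::] = 1. Proof. by []. Qed.
Lemma word_cat p q : word (p ++ q) = word p * word q.
Proof. exact/esym/tamul_word. Qed.
Lemma word_cons v w : word (v :: w) = tin v * word w.
Proof. exact: (word_cat [:: v]). Qed.

End TensorAlgebra.

Section LinearMaps.
Variable k : fieldType.
Implicit Types (U V W Z : lmodType k) (A : algType k).

Lemma lin_comp U V W (f : V -> W) (g : U -> V) :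
  linear f -> linear g -> linear (fun x => f (g x)).
Proof. by move=> lf lg a x y; rewrite lg lf. Qed.

Lemma lin_tsum U V W Z (F : Z -> (U ⊗ V)%type) (b : U -> V -> W) :
  linear F -> bilin b -> linear (fun z => \tsum_(x, y <- F z) b x y).
Proof. by move=> lF bb; apply: lin_comp (tsum_linear bb) lF. Qed.

Lemma lin_mull U A (f : U -> A) c : linear f -> linear (fun x => f x * c).
Proof. by move=> lf a x y; rewrite lf mulrDl scalerAl. Qed.

Lemma lin_mulr U A (f : U -> A) c : linear f -> linear (fun x => c * f x).
Proof. by move=> lf a x y; rewrite lf mulrDr scalerAr. Qed.

Lemma lin_tenl U V W (f : W -> U) (v : V) : linear f -> linear (fun x => f x ⊗ v).
Proof. by move=> lf; apply: lin_comp ((ten_bilin U V).1 v) lf. Qed.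

Lemma lin_tenr U V W (f : W -> V) (u : U) : linear f -> linear (fun x => u ⊗ f x).
Proof. by move=> lf; apply: lin_comp ((ten_bilin U V).2 u) lf. Qed.

Lemma lin_scalel U V (f : U -> k^o) (v : V) :
  linear f -> linear (fun x => (f x : k) *: v).
Proof. by move=> lf a x y; rewrite lf scalerDl scalerA. Qed.

Lemma lin_scaler U V (f : U -> V) (c : k) :
  linear f -> linear (fun x => c *: f x).
Proof. by move=> lf a x y; rewrite lf scalerDr !scalerA mulrC. Qed.

Lemma lin_id V : linear (fun x : V => x).
Proof. by []. Qed.

Lemma lin_pack U V (f : {linear U -> V}) : linear f.
Proof. exact: linearP. Qed.

End LinearMaps.

Ltac lin :=
  intros; solve [repeat first
  [ assumption | exact: lin_id | exact: lin_pack | exact: tin_linear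
  | match goal with h : forall _, linear _ |- _ => exact: h end
  | match goal with h : bilin _ |- _ => exact: (proj1 h) end
  | match goal with h : bilin _ |- _ => exact: (proj2 h) end
  | match goal with h : forall _, bilin _ |- _ => exact: (proj1 (h _)) end
  | match goal with h : forall _, bilin _ |- _ => exact: (proj2 (h _)) end
  | match goal with |- linear (fun x => tsum _ _) => apply: tsum_param; intros end
  | match goal with |- linear (fun x => tsum _ _) => apply: lin_tsum; [|split; intros] end
  | apply: lin_tenl | apply: lin_tenr | apply: lin_mull | apply: lin_mulr
  | apply: lin_scalel | apply: lin_scaler
  | apply: (lin_comp (@lin_pack _ _ _ _)) | apply: (lin_comp (@tin_linear _ _)) ]].

Section BraidedTensorAlgebra.
Variables (k : fieldType) (H : hopfAlgebra k) (V : ydModule H).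
Local Notation Δ := (@comul k H).
Local Notation ε := (@counit k H).
Local Notation T := (tensalg V).

(* h . (v_1 ... v_n) = (h_(1) . v_1) ... (h_(n) . v_n) *)
Fixpoint act_word (h : H) (w : seq V) : T :=
  if w is v :: w' then \tsum_(h1, h2 <- Δ h) tin (act h1 v) * act_word h2 w'
  else (ε h : k) *: 1.

Definition tact (h : H) (t : T) : T := wlift (act_word h) t.

(* The coaction of T(V), multiplicative on words. *)
Fixpoint coact_word (w : seq V) : (H ⊗ T)%type :=
  if w is v :: w' then
    \tsum_(g, v0 <- coact v) \tsum_(h, y <- coact_word w') (g * h) ⊗ (tin v0 * y)
  else 1 ⊗ 1.

Definition tcoact (t : T) : (H ⊗ T)%type := wlift coact_word t.

(* The product of T(V) ⊗ T(V) twisted by the braiding:                      *)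
(*   (a ⊗ b) (c ⊗ d) = a (b_(-1) . c) ⊗ b_(0) d.                            *)
Definition bmul (z z' : (T ⊗ T)%type) : (T ⊗ T)%type :=
  \tsum_(a, b <- z) \tsum_(c, d <- z') \tsum_(h, b0 <- tcoact b)
    (a * tact h c) ⊗ (b0 * d).

(* The coproduct of the braided Hopf algebra T(V): the algebra map for bmul  *)
(* that sends v in V to v ⊗ 1 + 1 ⊗ v.                                       *)
Definition tcomul (t : T) : (T ⊗ T)%type :=
  wlift (foldr (fun v z => bmul (tin v ⊗ 1 + 1 ⊗ tin v) z) (1 ⊗ 1)) t.

Lemma act_word_linl w : linear (act_word^~ w).
Proof.
elim: w => [|v w ih] /=; first lin.
have ab := @act_bilin _ _ V.
apply: lin_tsum => //; first lin.
by split=> *; lin.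
Qed.

Lemma act_word_multilin h : multilin (act_word h).
Proof.
move=> p q; elim: p h => [|u p ih] h /=; last by lin.
have ab := @act_bilin _ _ V; lin.
Qed.

Lemma tact_bilin : bilin tact.
Proof.
split=> [t|h]; last exact/wlift_linear/act_word_multilin.
by apply: wlift_param => w; apply: act_word_linl.
Qed.

Lemma tact_word h w : tact h (word w) = act_word h w.
Proof. exact/wlift_word/act_word_multilin. Qed.

Lemma coact_word_multilin : multilin coact_word.
Proof.
move=> p q; elim: p => [|u p ih] /=.
  by apply: lin_tsum; [lin|split=> *; lin].
apply: tsum_param => g v; apply: lin_tsum => //.
by split=> *; lin.
Qed.

Lemma tcoact_linear : linear tcoact.
Proof. exact/wlift_linear/coact_word_multilin. Qed.

Lemma tcoact_word w : tcoact (word w) = coact_word w.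
Proof. exact/wlift_word/coact_word_multilin. Qed.

Lemma bmul_bilin : bilin bmul.
Proof.
have tb := tact_bilin; have tl := tcoact_linear.
have bd (a c : T) : bilin (fun (h : H) (b0 : T) => (a * tact h c) ⊗ b0 ).
  by split=> *; lin.
split=> z.
  apply: lin_tsum => //; split=> *; last first.
    by apply: tsum_param => c d; apply: lin_tsum => //; split=> *; lin.
  by lin.
by apply: tsum_param => a b; apply: lin_tsum => //; split=> *; lin.
Qed.

Lemma comul_word_multilin :
  multilin (foldr (fun v z => bmul (tin v ⊗ 1 + 1 ⊗ tin v) z) (1 ⊗ 1)).
Proof.
have [bl br] := bmul_bilin.
move=> p q; elim: p => [|u p ih] /=; last exact: (lin_comp (br _)) ih.
apply: (lin_comp (bl _)) => a x y.
rewrite tin_linear (ten_bilin _ _).1 (ten_bilin _ _).2 scalerDr.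
by rewrite addrACA.
Qed.

Lemma tcomul_linear : linear tcomul.
Proof. exact/wlift_linear/comul_word_multilin. Qed.

Lemma tcomul_word v w :
  tcomul (word (v :: w)) = bmul (tin v ⊗ 1 + 1 ⊗ tin v) (tcomul (word w)).
Proof. by rewrite /tcomul !wlift_word//; apply: comul_word_multilin. Qed.

End BraidedTensorAlgebra.

Section DirectSum.
Variables (k : fieldType) (I : finType).

Section Space.
Variable N : I -> lmodType k.

Definition dsum := forall i, N i.
HB.instance Definition _ := Choice.on dsum.

Definition dsum_add (u v : dsum) : dsum := fun i => u i + v i.
Definition dsum_opp (u : dsum) : dsum := fun i => - u i.
Definition dsum_scale (a : k) (u : dsum) : dsum := fun i => a *: u i.

Lemma dsum_addA : associative dsum_add.
Proof. by move=> u v w; apply: functional_extensionality_dep => i; apply: addrA. Qed.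
Lemma dsum_addC : commutative dsum_add.
Proof. by move=> u v; apply: functional_extensionality_dep => i; apply: addrC. Qed.
Lemma dsum_add0 : left_id (fun i => 0) dsum_add.
Proof. by move=> u; apply: functional_extensionality_dep => i; apply: add0r. Qed.
Lemma dsum_addN : left_inverse (fun i => 0) dsum_opp dsum_add.
Proof. by move=> u; apply: functional_extensionality_dep => i; apply: addNr. Qed.
HB.instance Definition _ :=
  GRing.isZmodule.Build dsum dsum_addA dsum_addC dsum_add0 dsum_addN.

Lemma dsum_scaleA a b u : dsum_scale a (dsum_scale b u) = dsum_scale (a * b) u.
Proof. by apply: functional_extensionality_dep => i; apply: scalerA. Qed.
Lemma dsum_scale1 : left_id 1 dsum_scale.
Proof. by move=> u; apply: functional_extensionality_dep => i; apply: scale1r. Qed.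
Lemma dsum_scaleDr : right_distributive dsum_scale +%R.
Proof. by move=> a u v; apply: functional_extensionality_dep => i; apply: scalerDr. Qed.
Lemma dsum_scaleDl u : {morph dsum_scale^~ u : a b / a + b}.
Proof. by move=> a b; apply: functional_extensionality_dep => i; apply: scalerDl. Qed.
HB.instance Definition _ := GRing.Zmodule_isLmodule.Build k dsum
  dsum_scaleA dsum_scale1 dsum_scaleDr dsum_scaleDl.

Definition dinj (i : I) (x : N i) : dsum :=
  @dfwith I N (fun j => 0 : N j) i x.

Lemma dinj_linear i : linear (@dinj i).
Proof.
move=> a x y; apply: functional_extensionality_dep => j.
rewrite /dinj -[RHS]/(a *: dfwith _ x j + dfwith _ y j).
have [e|ne] := eqVneq i j; first by case: _ / e; rewrite !dfwith_in.
by rewrite !dfwith_out// scaler0 addr0.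
Qed.
HB.instance Definition _ i := GRing.isLinear.Build k (N i) dsum *:%R
  (@dinj i) (@dinj_linear i).

Lemma dsum_sumE (J : Type) (r : seq J) (F : J -> dsum) i :
  (\sum_(j <- r) F j) i = \sum_(j <- r) F j i.
Proof. by elim/big_rec2: _ => // j _ y _ <-. Qed.

Lemma dsum_inj (u : dsum) : u = \sum_i dinj (u i).
Proof.
apply: functional_extensionality_dep => j; rewrite dsum_sumE (bigD1 j)//=.
by rewrite /dinj dfwith_in big1 ?addr0// => i ij; rewrite dfwith_out.
Qed.

Lemma dsum_ext (u v : dsum) : (forall i, u i = v i) -> u = v.
Proof. exact: functional_extensionality_dep. Qed.

End Space.
Arguments dinj N i x.

Variables (H : hopfAlgebra k) (N : I -> ydModule H).
Local Notation V := (dsum (fun i => N i)).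
Local Notation inj i := (@dinj (fun j => yd_space (N j)) i).
Local Notation Δ := (@comul k H).

Definition dact (h : H) (u : V) : V := fun i => act h (u i).
Definition dcoact (u : V) : (H ⊗ V)%type :=
  \sum_i \tsum_(h, x <- coact (u i)) h ⊗ inj i x.

Lemma dcoact_linear : linear dcoact.
Proof.
move=> a u v; rewrite /dcoact scaler_sumr -big_split; apply: eq_bigr => i _.
rewrite linearP.
have l : linear (fun z : (H ⊗ N i)%type => \tsum_(h, x <- z) h ⊗ inj i x)
  by apply: lin_tsum; [lin|split=> *; lin].
exact: l.
Qed.
HB.instance Definition _ :=
  GRing.isLinear.Build k V (H ⊗ V)%type *:%R dcoact dcoact_linear.

Lemma dcoact_inj i (x : N i) :
  dcoact (inj i x) = \tsum_(h, y <- coact x) h ⊗ inj i y.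
Proof.
rewrite /dcoact (bigD1 i)//= big1 ?addr0 => [|j ji].
  by rewrite /dinj dfwith_in.
rewrite {1}/dinj dfwith_out 1?eq_sym// linear0.
have l : linear (fun z : (H ⊗ N j)%type => \tsum_(h, x <- z) h ⊗ inj j x)
  by apply: lin_tsum; [lin|split=> *; lin].
exact: linear_at0 l.
Qed.

Lemma dact_inj i h (x : N i) : dact h (inj i x) = inj i (act h x).
Proof.
apply: functional_extensionality_dep => j; rewrite /dact /dinj.
have [e|ne] := eqVneq i j; first by case: _ / e; rewrite !dfwith_in.
by rewrite !dfwith_out//; exact: linear_at0 ((act_bilin _).2 h).
Qed.

Lemma dact_bilin : bilin dact.
Proof.
by split=> [u h|h u] a b; apply: functional_extensionality_dep => i;
  rewrite /dact (act_bilin _).1 || rewrite /dact (act_bilin _).2.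
Qed.

Lemma dact1 u : dact 1 u = u.
Proof. by apply: functional_extensionality_dep => i; apply: act1. Qed.
Lemma dactM g h u : dact (g * h) u = dact g (dact h u).
Proof. by apply: functional_extensionality_dep => i; apply: actM. Qed.

Lemma dsum_eq (W : lmodType k) (f g : V -> W) :
  linear f -> linear g -> (forall i (x : N i), f (inj i x) = g (inj i x)) ->
  f =1 g.
Proof.
move=> lf lg e u; rewrite (dsum_inj u).
elim/big_ind: _ => [|x y ex ey|i _]; last exact: e.
  by rewrite (linear_at0 lf) (linear_at0 lg).
by rewrite -[x]scale1r lf lg ex ey.
Qed.

Lemma tsum_dcoact (W : lmodType k) i (x : N i) (b : H -> V -> W) :
  bilin b ->
  \tsum_(h, y <- dcoact (inj i x)) b h y = \tsum_(h, y <- coact x) b h (inj i y).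
Proof.
move=> bb; rewrite dcoact_inj.
rewrite (tsum_comp _ _ (F := fun z => tsum z b)); last exact: tsum_linear.
by congr tsum; do 2!apply/funext => ?; rewrite tsum_ten.
Qed.

Let dl := dcoact_linear.

Lemma dcoact_coassoc u :
  \tsum_(h, u0 <- dcoact u) \tsum_(h1, h2 <- Δ h) h1 ⊗ (h2 ⊗ u0) =
  \tsum_(h, u0 <- dcoact u) h ⊗ dcoact u0.
Proof.
have bl : bilin (fun (h : H) (u0 : V) => \tsum_(h1, h2 <- Δ h) h1 ⊗ (h2 ⊗ u0)).
  split=> w; last by lin.
  by apply: lin_tsum; [lin|split=> *; lin].
have br : bilin (fun (h : H) (u0 : V) => h ⊗ dcoact u0) by split=> w; lin.
move: u; apply: dsum_eq; [exact: lin_tsum|exact: lin_tsum|move=> i x].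
rewrite !tsum_dcoact//.
pose J (z : (H ⊗ N i)%type) := \tsum_(c, y <- z) c ⊗ inj i y.
have Jl : linear J by apply: lin_tsum; [lin|split=> *; lin].
pose G (z : (H ⊗ (H ⊗ N i))%type) := \tsum_(a, b <- z) a ⊗ J b.
have Gb : bilin (fun (a : H) b => a ⊗ J b) by split=> *; lin.
have Gl : linear G by apply: lin_tsum; [lin|].
transitivity (G (\tsum_(h, y <- coact x) \tsum_(h1, h2 <- Δ h) h1 ⊗ (h2 ⊗ y))).
  rewrite (tsum_comp _ _ Gl); congr tsum; do 2!apply/funext => ?.
  rewrite (tsum_comp _ _ Gl); congr tsum; do 2!apply/funext => ?.
  by rewrite /G tsum_ten// /J tsum_ten//; split=> *; lin.
rewrite coact_coassoc (tsum_comp _ _ Gl); congr tsum; do 2!apply/funext => ?.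
by rewrite /G tsum_ten// /J dcoact_inj.
Qed.

Lemma dcoact_counit u : \tsum_(h, u0 <- dcoact u) (counit h : k) *: u0 = u.
Proof.
have b (W : lmodType k) : bilin (fun (h : H) (w : W) => (counit h : k) *: w).
  by split=> *; lin.
move: u; apply: dsum_eq => [||i x]; [exact: lin_tsum|exact: lin_id|].
rewrite tsum_dcoact// -[in RHS](coact_counit x).
rewrite (tsum_comp _ _ (F := inj i)); last lin.
by congr tsum; do 2!apply/funext => ?; rewrite linearZ.
Qed.

Lemma dsum_compat h u : dcoact (dact h u) =
  \tsum_(h1, h23 <- Δ h) \tsum_(h2, h3 <- Δ h23) \tsum_(g, u0 <- dcoact u)
    (h1 * g * antipode h3) ⊗ dact h2 u0.
Proof.
have [al ar] := dact_bilin.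
have b h1 h2 h3 :
  bilin (fun (g : H) (u0 : V) => (h1 * g * antipode h3) ⊗ dact h2 u0).
  by split=> *; lin.
move: u; apply: dsum_eq => [||i x]; first exact: lin_comp dl (ar h).
  by apply: tsum_param => *; apply: tsum_param => *; apply: lin_tsum.
rewrite dact_inj dcoact_inj yd_compat.
pose J (z : (H ⊗ N i)%type) := \tsum_(c, y <- z) c ⊗ inj i y.
have Jl : linear J by apply: lin_tsum; [lin|split=> *; lin].
rewrite -[LHS]/(J _) (tsum_comp _ _ Jl); congr tsum; do 2!apply/funext => ?.
rewrite (tsum_comp _ _ Jl); congr tsum; do 2!apply/funext => ?.
rewrite tsum_dcoact// (tsum_comp _ _ Jl); congr tsum; do 2!apply/funext => ?.
by rewrite /J tsum_ten ?dact_inj//; split=> *; lin.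
Qed.

Definition ydsum : ydModule H := YDModule dact_bilin dact1 dactM
  dcoact_coassoc dcoact_counit dsum_compat.

Definition ydinj i (x : N i) : ydsum := inj i x.

End DirectSum.

Section Subspaces.
Variables (k : fieldType) (V : lmodType k).

Definition submod (A : set V) :=
  A 0 /\ forall a x y, A x -> A y -> A (a *: x + y).

Definition lspan (A : set V) : set V := smallest submod A.

Lemma submod_lspan A : submod (lspan A).
Proof.
split=> [B [[]]//|a x y Ax Ay B AB].
by have [[_ BD] _] := AB; apply: BD; [exact: Ax|exact: Ay].
Qed.

End Subspaces.

Section NicholsAlgebra.
Variables (k : fieldType) (H : hopfAlgebra k) (V : ydModule H).
Local Notation T := (tensalg V).

(* C ⊗ T(V) + T(V) ⊗ C *)
Definition coideal_tensors (C : set T) : set (T ⊗ T)%type :=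
  lspan [set z | exists x y, z = x ⊗ y /\ (C x \/ C y)].

Definition coideal (C : set T) :=
  [/\ submod C, forall x, C x -> tcounit x = 0 &
      forall x, C x -> coideal_tensors C (tcomul x)].

Definition degree_ge2 : set T := lspan [set word w | w in [set w | 1 < size w]%N].

Definition nichols_ideal : set T :=
  \bigcup_(C in [set C | coideal C /\ C `<=` degree_ge2]) C.

Lemma coideal_tensorsS (C D : set T) :
  C `<=` D -> coideal_tensors C `<=` coideal_tensors D.
Proof.
move=> CD; apply: smallest_sub; first exact: submod_lspan.
move=> z [x [y [-> xy]]]; apply: sub_gen_smallest; exists x, y; split=> //.
by case: xy => /CD; [left|right].
Qed.

Lemma coideal_add (C D : set T) : coideal C -> coideal D ->
  coideal [set z | exists x y, [/\ C x, D y & z = x + y]].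
Proof.
move=> [[C0 CD] Ce Cc] [[D0 DD] De Dc]; split.
- split; first by exists 0, 0; rewrite addr0.
  move=> a _ _ [x [y [Cx Dy ->]]] [x' [y' [Cx' Dy' ->]]].
  exists (a *: x + x'), (a *: y + y'); split; [exact: CD|exact: DD|].
  by rewrite scalerDr addrACA.
- move=> _ [x [y [Cx Dy ->]]].
  by rewrite -[x]scale1r tcounit_linear Ce// De// scaler0 addr0.
- move=> _ [x [y [Cx Dy ->]]].
  rewrite -[x]scale1r tcomul_linear; apply: (submod_lspan _).2.
    by apply: coideal_tensorsS (Cc _ Cx) => z Cz; exists z, 0; rewrite addr0.
  by apply: coideal_tensorsS (Dc _ Dy) => z Dz; exists 0, z; rewrite add0r.
Qed.

Lemma nichols_ideal_sub : nichols_ideal `<=` degree_ge2.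
Proof. by move=> x [C [_ CT] Cx]; apply: CT. Qed.

Lemma nichols_ideal_submod : submod nichols_ideal.
Proof.
split.
  exists [set 0]; rewrite //=; split; last by move=> _ ->; apply: (submod_lspan _).1.
  split=> [|_ ->|_ ->]; first by split=> // a _ _ -> ->; rewrite scaler0 addr0.
    exact: linear_at0 (@tcounit_linear _ _).
  by rewrite (linear_at0 (@tcomul_linear _ _ _)); apply: (submod_lspan _).1.
move=> a x y [C [cC CT] Cx] [D [cD DT] Dy].
exists [set z | exists x y, [/\ C x, D y & z = x + y]] => /=.
  split; first exact: coideal_add.
  move=> _ [u [v [/CT u2 /DT v2 ->]]].
  by rewrite -[u]scale1r; apply: (submod_lspan _).2.
exists (a *: x), y; split=> //.
by case: cC => -[C0 CD] _ _; rewrite -[_ *: x]addr0; apply: CD.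
Qed.

Lemma nichols_ideal_coideal : coideal nichols_ideal.
Proof.
split; first exact: nichols_ideal_submod.
  by move=> x [C [[_ Ce _] _]]; apply: Ce.
move=> x [C [cC CT] Cx]; have [_ _ Cc] := cC.
by apply: coideal_tensorsS (Cc x Cx) => z Cz; exists C.
Qed.

Lemma nichols_ideal_largest (C : set T) :
  coideal C -> C `<=` degree_ge2 -> C `<=` nichols_ideal.
Proof. by move=> cC CT x Cx; exists C. Qed.

Definition nichols_pred : {pred T} := fun x => `[< nichols_ideal x >].

Lemma nichols_pred_zmod_closed : zmod_closed nichols_pred.
Proof.
have [I0 ID] := nichols_ideal_submod.
split=> [|x y /asboolP Ix /asboolP Iy]; first exact/asboolP.
by apply/asboolP; rewrite addrC -scaleN1r; apply: ID.
Qed.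
HB.instance Definition _ :=
  GRing.isZmodClosed.Build T nichols_pred nichols_pred_zmod_closed.

Definition nichols := Quotient.quot nichols_pred.
HB.instance Definition _ := GRing.Zmodule.on nichols.
HB.instance Definition _ := EqQuotient.on nichols.

Definition nproj (t : T) : nichols := \pi_nichols t.

Definition nscale (a : k) (x : nichols) : nichols := nproj (a *: repr x).

Lemma nprojD x y : nproj (x + y) = nproj x + nproj y.
Proof. exact: Quotient.pi_add. Qed.

Lemma nproj_eq x y : nproj x = nproj y <-> nichols_ideal (x - y).
Proof.
split=> [/eqP|xy]; last (apply/eqP; move: xy).
  by rewrite /nproj -[_ == _]/(x == y %[mod Quotient.quot nichols_pred]) -Quotient.idealrBE => /asboolP.
by move=> xy; rewrite /nproj -[_ == _]/(x == y %[mod Quotient.quot nichols_pred]) -Quotient.idealrBE; apply/asboolP.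
Qed.

Lemma nprojK x : nproj (repr x) = x. Proof. exact: reprK. Qed.

Lemma nscaleE a t : nscale a (nproj t) = nproj (a *: t).
Proof.
apply/nproj_eq; rewrite -scalerBr -[_ *: _]addr0.
have [I0 ID] := nichols_ideal_submod.
by apply: ID => //; apply/nproj_eq; rewrite nprojK.
Qed.

Lemma nscaleA a b x : nscale a (nscale b x) = nscale (a * b) x.
Proof. by rewrite -[x]nprojK !nscaleE scalerA. Qed.
Lemma nscale1 : left_id 1 nscale.
Proof. by move=> x; rewrite -[x]nprojK nscaleE scale1r. Qed.
Lemma nscaleDr : right_distributive nscale +%R.
Proof.
move=> a x y; rewrite -[x]nprojK -[y]nprojK -nprojD !nscaleE -nprojD.
by rewrite scalerDr.
Qed.
Lemma nscaleDl x : {morph nscale^~ x : a b / a + b}.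
Proof. by move=> a b; rewrite -[x]nprojK !nscaleE -nprojD scalerDl. Qed.
HB.instance Definition _ :=
  GRing.Zmodule_isLmodule.Build k nichols nscaleA nscale1 nscaleDr nscaleDl.

End NicholsAlgebra.

(* The operations which nichols V inherits from T(V), computed on            *)
(* representatives (nichols_ideal is a two-sided ideal and a Yetter-Drinfeld *)
(* submodule of T(V)).                                                       *)
Section NicholsOperations.
Variables (k : fieldType) (H : hopfAlgebra k) (V : ydModule H).
Local Notation B := (nichols V).

Definition nmul (x y : B) : B := nproj (repr x * repr y).

Definition nact (h : H) (x : B) : B := nproj (tact h (repr x)).

Definition ncoact (x : B) : (H ⊗ B)%type :=
  \tsum_(h, t <- tcoact (repr x)) h ⊗ nproj t.

Definition nin (v : V) : B := nproj (tin v).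

Definition ad_c (x : V) (y : B) : B :=
  nmul (nin x) y - \tsum_(h, x0 <- coact x) nmul (nact h y) (nin x0).

Definition ad_set (X : set V) (Y : set B) : set B :=
  lspan [set ad_c x y | x in X & y in Y].

End NicholsOperations.

Section YDObjects.
Variables (k : fieldType) (H : hopfAlgebra k).
Implicit Types V W D : ydModule H.

Definition yd_iso V W := exists f : V -> W,
  [/\ linear f, bijective f, forall h v, f (act h v) = act h (f v) &
      forall v, coact (f v) = \tsum_(h, v0 <- coact v) h ⊗ f v0].

Definition fin_dim V := exists s : seq V, lspan [set` s] = setT.

Definition yd_submod V (A : set V) :=
  [/\ submod A, forall h v, A v -> A (act h v) &
      forall v, A v -> lspan [set h ⊗ x | h in setT & x in A] (coact v)].

Definition yd_irreducible V :=
  (exists v : V, v != 0) /\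
  forall A : set V, yd_submod A -> A = [set 0] \/ A = setT.

(* D is the left dual V^*: the space of all linear forms on V, with          *)
(*   (h . f)(v) = f(S(h) v)   and   f_(-1) f_(0)(v) = S^-1(v_(-1)) f(v_(0)), *)
(* S being applied to both sides of the second rule; ev f v stands for f(v). *)
Definition yd_left_dual V D := exists ev : D -> V -> k^o,
  [/\ bilin ev,
      forall phi : {linear V -> k^o}, exists! f, ev f = phi,
      forall h f v, ev (act h f) v = ev f (act (antipode h) v) &
      forall f v, \tsum_(g, f0 <- coact f) (ev f0 v : k) *: antipode g =
                  \tsum_(g, v0 <- coact v) (ev f v0 : k) *: g].

(* The subspace Y of nichols V is a Yetter-Drinfeld submodule isomorphic to W. *)
Definition nichols_sub_iso V W (Y : set (nichols V)) :=
  exists f : W -> nichols V,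
  [/\ linear f, injective f, range f = Y,
      forall h w, f (act h w) = nact h (f w) &
      forall w, ncoact (f w) = \tsum_(h, w0 <- coact w) h ⊗ f w0].

Definition isoclass := {C : ydModule H -> Prop |
  exists V, [/\ fin_dim V, yd_irreducible V & C = yd_iso V]}.

Definition rep (C : isoclass) : ydModule H := sval (cid (svalP C)).

End YDObjects.

Section Reflections.
Variables (k : fieldType) (H : hopfAlgebra k) (theta : nat).

Definition irrtuple := 'I_theta -> isoclass H.
Implicit Types (M N : irrtuple) (i j : 'I_theta).

(* V(N), for a choice of representatives of the classes N_i. *)
Definition vsum N : ydModule H := ydsum (fun i => rep (N i)).

Definition summand N i : set (vsum N) := range (@ydinj _ _ _ (fun i => rep (N i)) i).

Arguments summand N i : clear implicits.

(* (ad_c N_i)^h (N_j) in the Nichols algebra of V(N) *)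
Definition ad_iter N i j (h : nat) : set (nichols (vsum N)) :=
  iter h (ad_set (summand N i)) (@nin _ _ (vsum N) @` summand N j).

Arguments ad_iter N i j h : clear implicits.

Definition i_finite N i :=
  forall j, j != i -> exists h, (0 < h)%N /\ ad_iter N i j h = [set 0].

Definition all_finite N := forall i, i_finite N i.

(* ad_sup N i j is - a_ij; the value 0 for an unbounded set is never used    *)
(* when N is i-finite.                                                       *)
Definition ad_sup N i j : nat :=
  supremum 0%N [set h | ad_iter N i j h <> [set 0]].

Definition cartan_entry N i j : int := if i == j then 2 else - (ad_sup N i j)%:Z.

(* N' is r_i(N) for an i-finite N: N'_i is the class of N_i^* and N'_j the   *)
(* class of (ad_c N_i)^(- a_ij) (N_j). Such an N' always exists and is       *)
(* unique, so that the default value N of reflection is only taken when N is *)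
(* not i-finite.                                                             *)
Definition is_reflection i N N' :=
  yd_left_dual (rep (N i)) (rep (N' i)) /\
  forall j, j != i -> nichols_sub_iso (rep (N' j)) (ad_iter N i j (ad_sup N i j)).

Definition reflection i N : irrtuple :=
  if pselect (i_finite N i /\ exists N', is_reflection i N N') is left p
  then sval (cid p.2) else N.

Definition refl_orbit M N : Prop :=
  exists s : seq 'I_theta, N = foldr reflection M s.

Definition orbit_tuple M := {N | refl_orbit M N}.

Lemma reflection_orbit M i N : refl_orbit M N -> refl_orbit M (reflection i N).
Proof. by move=> [s ->]; exists (i :: s). Qed.

Definition orbit_reflection M i (N : orbit_tuple M) : orbit_tuple M :=
  exist _ (reflection i (sval N)) (reflection_orbit i (svalP N)).

End Reflections.
Arguments orbit_reflection {k H theta} M i N.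

Definition gen_cartan_matrix (I : finType) (A : I -> I -> int) :=
  [/\ forall i, A i i = 2,
      forall j l, j != l -> A j l <= 0 &
      forall i j, A i j = 0 -> A j i = 0].

Definition cartan_scheme (I : finType) (X : Type) (r : I -> X -> X)
    (A : X -> I -> I -> int) :=
  [/\ inhabited I, inhabited X, forall N, gen_cartan_matrix (A N),
      forall i N, r i (r i N) = N &
      forall N i j, A N i j = A (r i N) i j].

(* Main.v *)
(* In the Nichols algebra E of V(N), let a be the braided adjoint action of
   V = N_i and d the skew derivations along the dual D of V. They satisfy
     (id ⊗ d) a = id - c^2 + (id ⊗ a) (c ⊗ id) (id ⊗ d)       (adsys),
   and the sequence X_0 = N_j, X_(n+1) = a(V ⊗ X_n) is determined by this
   relation together with d(X_0) = 0 and the fact that no nonzero submodule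
   of X_(n+1) is killed by d. Replacing a by a c^-2 and exchanging the roles
   of a and d gives the same relation for the pair (D, V) (dual_adsys). When
   X_m is the last nonzero term, irreducibility of X_0 forces the sequence of
   the exchanged system starting at X_m to be X_m, X_(m-1), ..., X_0. By
   uniqueness it is also the sequence of (ad D)^n (X_m) in the Nichols
   algebra of r_i(N). This yields both r_i^2 = id and the invariance of a_ij.
   Finally a_ij = 0 means that the double braiding of N_i ⊗ N_j is trivial,
   which is symmetric in i and j. *)
Require Import Defs.
From HB Require Import structures.
From mathcomp Require Import all_boot all_order all_algebra.
From mathcomp Require Import boolp classical_sets functions.

Set Implicit Arguments.
Unset Strict Implicit.
Unset Printing Implicit Defensive.

Import GRing.Theory.
Local Open Scope classical_set_scope.
Local Open Scope ring_scope.

(** * Linear algebra *)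

(** The sequences for N and for r_i(N) live in two different Nichols algebras, and no map between
    these algebras is constructed. This is why the argument is about abstract systems [adsys]: such
    a system knows only the commutation relation, so the Nichols algebra of V(N) with the roles of
    N_i and its dual exchanged, and that of r_i(N), are both instances. They are compared by a graph
    in the direct sum of the two systems.

    Exchanging the roles costs a square of the antipode: swapping the arguments of the evaluation of
    D on V does not make V the left dual of D. The pairing [dual_ev] corrects this with S^-1 of the
    coaction.

    That no nonzero submodule of X_(n+1) is killed by d rests on the maximality of the Nichols
    ideal: it is the common zero set of all iterated skew derivations followed by the counit. Forms
    on V(N) vanishing on N_i kill X_(n+1) anyway, so the derivations along N_i suffice.

    Neither H nor the Nichols algebra need have finite dimension. Hence complements come from Zorn's
    lemma, and identities between tensors are checked by contracting one factor with linear
    forms. *)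

Section LinearAlgebra.
Variable k : fieldType.
Implicit Types U V W : lmodType k.

Lemma linD U V (f : U -> V) : linear f -> {morph f : x y / x + y}.
Proof. by move=> lf x y; rewrite -[x]scale1r lf !scale1r. Qed.

Lemma linZ U V (f : U -> V) : linear f -> forall a x, f (a *: x) = a *: f x.
Proof. by move=> lf a x; rewrite -[a *: x]addr0 lf (linear_at0 lf) addr0. Qed.

Lemma linN U V (f : U -> V) : linear f -> {morph f : x / - x}.
Proof. by move=> lf x; rewrite -scaleN1r linZ// scaleN1r. Qed.

Lemma linB U V (f : U -> V) : linear f -> {morph f : x y / x - y}.
Proof. by move=> lf x y; rewrite linD// linN. Qed.

Lemma lin_sum U V (f : U -> V) (I : Type) (r : seq I) (P : pred I) (F : I -> U) :
  linear f -> f (\sum_(i <- r | P i) F i) = \sum_(i <- r | P i) f (F i).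
Proof. by move=> lf; apply: big_morph; [exact: linD|exact: linear_at0]. Qed.

Lemma submodD U (A : set U) : submod A -> forall x y, A x -> A y -> A (x + y).
Proof. by move=> [_ AD] x y Ax Ay; rewrite -[x]scale1r; apply: AD. Qed.

Lemma submodZ U (A : set U) : submod A -> forall a x, A x -> A (a *: x).
Proof. by move=> [A0 AD] a x Ax; rewrite -[_ *: _]addr0; apply: AD. Qed.

Lemma submodN U (A : set U) : submod A -> forall x, A x -> A (- x).
Proof. by move=> sA x Ax; rewrite -scaleN1r; apply: submodZ. Qed.

Lemma submodB U (A : set U) : submod A -> forall x y, A x -> A y -> A (x - y).
Proof. by move=> sA x y Ax Ay; apply: submodD => //; apply: submodN. Qed.

Lemma submod_sum U (A : set U) (I : Type) (r : seq I) (P : pred I) (F : I -> U) :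
  submod A -> (forall i, P i -> A (F i)) -> A (\sum_(i <- r | P i) F i).
Proof.
move=> sA AF; elim/big_ind: _ => //; first by case: sA.
exact: submodD.
Qed.

Lemma lspan_gen U (A : set U) : A `<=` lspan A.
Proof. exact: sub_gen_smallest. Qed.

Lemma lspan_sub U (A B : set U) : submod B -> A `<=` B -> lspan A `<=` B.
Proof. exact: smallest_sub. Qed.

Lemma submod0 U : submod [set 0 : U].
Proof. by split=> // a _ _ -> ->; rewrite scaler0 addr0. Qed.

Lemma submodT U : submod [set: U].
Proof. by []. Qed.

Lemma submod_preimage U V (f : U -> V) (A : set V) :
  linear f -> submod A -> submod (f @^-1` A).
Proof.
move=> lf [A0 AD]; split; first by rewrite /preimage /= linear_at0.
by move=> a x y Ax Ay; rewrite /preimage /= lf; apply: AD.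
Qed.

Lemma submod_image U V (f : U -> V) (A : set U) :
  linear f -> submod A -> submod (f @` A).
Proof.
move=> lf [A0 AD]; split; first by exists 0 => //; rewrite linear_at0.
by move=> a _ _ [x Ax <-] [y Ay <-]; exists (a *: x + y); [exact: AD|exact: lf].
Qed.

(** Zorn's lemma for the subspaces that meet A only in 0: a maximal one C is a complement, since a
    vector u outside A + C could be adjoined to C. *)
Lemma complement U (A : set U) : submod A ->
  exists C, [/\ submod C, A `&` C `<=` [set 0] & forall u, exists2 a, A a & C (u - a)].
Proof.
move=> sA.
pose P (C : set U) := (C = set0 \/ submod C) /\ A `&` C `<=` [set 0].
have [F FP Ftot|C [[CP AC] Cmax]] := @Zorn_bigcup U P.
  split; last by move=> x [Ax [C /FP [_ CA] Cx]]; apply: CA.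
  have [[C0 [FC0 [x0 Cx0]]]|ne] := pselect (exists C, F C /\ C !=set0); last first.
    left; apply/seteqP; split=> // x [C FC Cx]; apply: ne; exists C; split=> //.
    by exists x.
  have subF C x : F C -> C x -> submod C.
    by move=> FC Cx; case: (FP _ FC) => -[C0'|//] _; rewrite C0' in Cx.
  right; split; first by exists C0 => //; case: (subF _ _ FC0 Cx0).
  move=> a x y [C1 F1 C1x] [C2 F2 C2y]; have [s12|s21] := Ftot _ _ F1 F2.
    by exists C2 => //; apply: (subF _ _ F2 C2y).2 => //; apply: s12.
  by exists C1 => //; apply: (subF _ _ F1 C1x).2 => //; apply: s21.
have sC : submod C.
  case: CP => // C0; suff : False by [].
  apply: (Cmax [set 0]); last by split; [right; exact: submod0|move=> x []].
  by rewrite C0; split=> //; apply/existsPNP; exists 0.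
exists C; split=> // u.
apply: contrapT => nu.
have Cu : ~ C u by move=> Cu; apply: nu; exists 0; rewrite ?subr0//; case: sA.
pose D := [set x | exists a : k, C (x - a *: u)].
have sD : submod D.
  split; first by exists 0; rewrite scale0r subr0; case: sC.
  move=> a x y [b Cx] [c Cy]; exists (a * b + c).
  rewrite scalerDl opprD addrACA -scalerA -scalerBr.
  by apply: submodD => //; apply: submodZ.
apply: (Cmax D).
  split; first by move=> x Cx; exists 0; rewrite scale0r subr0.
  move=> /(_ u) DC; apply/Cu/DC.
  by exists 1; rewrite scale1r subrr; case: sC.
split; first by right.
move=> x [Ax [a Cx]]; have [a0|a0] := eqVneq a 0.
  by apply: AC; split=> //; rewrite a0 scale0r subr0 in Cx.
case: nu; exists (a^-1 *: x); first exact: submodZ.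
have -> : u - a^-1 *: x = (- a^-1) *: (x - a *: u); last exact: submodZ.
by rewrite scalerBr !scaleNr opprK scalerA mulVf// scale1r addrC.
Qed.

(** Choose complements D of the kernel and C of the range: [g v] is the one u in D with v - f u in
    C. Coordinates and left inverses are obtained from it in spaces without a chosen basis. *)
Lemma lin_ginv U V (f : U -> V) : linear f ->
  exists g : V -> U, linear g /\ forall u, f (g (f u)) = f u.
Proof.
move=> lf.
have [D [sD KD DT]] := complement (submod_preimage lf (submod0 V)).
have [C [sC RC CT]] := complement (submod_image lf (submodT U)).
have ex v : exists u, D u /\ C (v - f u).
  have [_ [u _ <-] Cu] := CT v; have [a fa Dua] := DT u.
  by exists (u - a); split=> //; rewrite linB// fa subr0.
have uni u v w : D u -> D v -> C (w - f u) -> C (w - f v) -> u = v.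
  move=> Du Dv Cu Cv; apply/eqP; rewrite -subr_eq0; apply/eqP.
  apply: KD; split; last exact: submodB.
  apply: RC; split; first by exists (u - v).
  rewrite linB//; have -> : f u - f v = (w - f v) - (w - f u); last exact: submodB.
  by rewrite opprB [RHS]addrC subrKA.
have [g gP] := choice ex.
exists g; split=> [a x y|u]; last first.
  have [Du Cu] := gP (f u); apply/esym/eqP; rewrite -subr_eq0; apply/eqP.
  by apply: RC; split=> //; exists (u - g (f u)) => //; rewrite linB.
apply: (uni _ _ (a *: x + y)) => //; try exact: (gP _).1; try exact: (gP _).2.
  by apply: sD.2; exact: (gP _).1.
rewrite lf opprD addrACA -scalerBr.
by apply: sC.2; exact: (gP _).2.
Qed.

Lemma lin_retract U V (f : U -> V) : linear f -> injective f ->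
  exists g : V -> U, linear g /\ cancel f g.
Proof.
by move=> lf fI; have [g [lg fg]] := lin_ginv lf; exists g; split=> // u; apply: fI.
Qed.

(** The projection onto a complement, with kernel A. It turns membership in A into the equation
    [e u = 0], which can be tensored and tested against linear forms. *)
Lemma projector U (A : set U) : submod A ->
  exists e : U -> U, [/\ linear e, forall u, A u <-> e u = 0 & forall u, A (u - e u)].
Proof.
move=> sA; have [C [sC AC CT]] := complement sA.
have ex u : exists c, C c /\ A (u - c).
  by have [a Aa Ca] := CT u; exists (u - a); rewrite subKr.
have [e eP] := choice ex.
have eA u : A (u - e u) by case: (eP u).
have eC u : C (e u) by case: (eP u).
have uni u c : C c -> A (u - c) -> e u = c.
  move=> Cc Ac; apply/eqP; rewrite -subr_eq0; apply/eqP; apply: AC.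
  split; last exact: submodB.
  have -> : e u - c = (u - c) - (u - e u) by rewrite opprB [RHS]addrC subrKA.
  exact: submodB.
exists e; split=> // [a x y|u].
  apply: uni; first exact: sC.2.
  by rewrite opprD addrACA -scalerBr; apply: sA.2.
split=> [Au|eu]; last by have := eA u; rewrite eu subr0.
by apply: uni; [case: sC|rewrite subr0].
Qed.

End LinearAlgebra.

(** * Tensor products and Sweedler sums *)

Section LinearClosure.
Variable k : fieldType.
Implicit Types U V W : lmodType k.

Lemma lin_add U V (f g : U -> V) : linear f -> linear g -> linear (fun x => f x + g x).
Proof. by move=> lf lg a x y; rewrite lf lg scalerDr addrACA. Qed.

Lemma lin_opp U V (f : U -> V) : linear f -> linear (fun x => - f x).
Proof. by move=> lf a x y; rewrite lf opprD scalerN. Qed.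

Lemma lin_bigsum U V (I : Type) (r : seq I) (P : pred I) (F : I -> U -> V) :
  (forall i, linear (F i)) -> linear (fun x => \sum_(i <- r | P i) F i x).
Proof.
move=> lF a x y; rewrite scaler_sumr -big_split.
by apply: eq_bigr => i _; apply: lF.
Qed.

Lemma lin_zero U V : linear (fun _ : U => 0 : V).
Proof. by move=> a x y; rewrite scaler0 addr0. Qed.

End LinearClosure.

Create HintDb lin.
#[export] Hint Resolve act_bilin tact_bilin bmul_bilin : lin.

(* Proves that a map is linear, by recursion on its syntax: Defs.lin does not *)
(* know the operations introduced below.                                      *)
Ltac lin_atom :=
  first
  [ assumption
  | exact: lin_pack
  | match goal with h : bilin _ |- _ => first [exact: (proj1 h _)|exact: (proj2 h _)] end
  | match goal with h : forall _, bilin _ |- _ =>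
      first [exact: (proj1 (h _) _)|exact: (proj2 (h _) _)] end
  | match goal with h : forall _, linear _ |- _ => exact: h end
  | match goal with h : forall _ _, linear _ |- _ => exact: h end
  | solve [auto 2 with lin nocore]
  | match goal with
    | |- linear (fun x => ?b x ?v) =>
      refine (proj1 (_ : bilin b) v); solve [auto 2 with lin nocore]
    | |- linear (?b ?u) =>
      refine (proj2 (_ : bilin b) u); solve [auto 2 with lin nocore]
    | |- linear (fun x => ?b ?u x) =>
      refine (proj2 (_ : bilin b) u); solve [auto 2 with lin nocore]
    end ].

Ltac lin_go :=
  match goal with
  | |- linear ?f =>
    match f with
    | fun x => x => exact: lin_id
    | fun x => ten (@?g x) ?v => apply: (@lin_tenl _ _ _ _ g v); lin_go
    | fun x => ten ?v (@?g x) => apply: (@lin_tenr _ _ _ _ g v); lin_go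
    | fun x => tsum (@?t x) ?b =>
      apply: (@lin_tsum _ _ _ _ _ t b); [lin_go|split; intros; lin_go]
    | fun x => tsum ?t (@?b x) =>
      apply: (@tsum_param _ _ _ _ _ b t); intros; lin_go
    | fun x => GRing.mul (@?g x) ?c => apply: (@lin_mull _ _ _ g c); lin_go
    | fun x => GRing.mul ?c (@?g x) => apply: (@lin_mulr _ _ _ g c); lin_go
    | fun x => GRing.scale (@?g x) ?v => apply: (@lin_scalel _ _ _ g v); lin_go
    | fun x => GRing.scale ?c (@?g x) => apply: (@lin_scaler _ _ _ g c); lin_go
    | fun x => GRing.add (@?g x) (@?h x) => apply: (@lin_add _ _ _ g h); lin_go
    | fun x => GRing.opp (@?g x) => apply: (@lin_opp _ _ _ g); lin_go
    | fun x => GRing.zero => exact: lin_zero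
    | GRing.mul ?c => apply: (@lin_mulr _ _ _ (fun x => x) c); lin_go
    | GRing.scale ?c => apply: (@lin_scaler _ _ _ (fun x => x) c); lin_go
    | ten ?v => apply: (@lin_tenr _ _ _ _ (fun x => x) v); lin_go
    | _ => lin_atom
    | fun x => ?F (@?g x) =>
      refine (@lin_comp _ _ _ _ F g _ _); [lin_atom|lin_go]
    | fun x => ?b (@?g x) ?v =>
      refine (@lin_comp _ _ _ _ (fun y => b y v) g _ _); [lin_atom|lin_go]
    end
  end.

Ltac linr := intros; lin_go.
Ltac blin := split; linr.

(** * Linear forms separate vectors and tensors *)

Section Functionals.
Variable k : fieldType.
Implicit Types U V W : lmodType k.

(** For u nonzero, a retraction of the injective map a -> a u from k is a linear form with value 1
    at u. *)
Lemma functional_sep U (u : U) :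
  (forall phi : U -> k^o, linear phi -> phi u = 0) -> u = 0.
Proof.
move=> u0; apply/eqP/negP => /negP nu.
have li : linear (fun a : k^o => (a : k) *: u) by linr.
have iI : injective (fun a : k^o => (a : k) *: u).
  move=> a b /eqP; rewrite -subr_eq0 -scalerBl scaler_eq0 (negPf nu) orbF.
  by rewrite subr_eq0 => /eqP.
have [g [lg gK]] := lin_retract li iI.
by have := gK 1; rewrite /= scale1r u0// => /esym/eqP; rewrite oner_eq0.
Qed.

(** The family [e] may be dependent: the coordinates come from a generalized inverse of the map
    sending a row vector to a combination of [e]. *)
Lemma span_coord U n (e : 'I_n -> U) : exists e' : 'I_n -> U -> k^o,
  (forall i, linear (e' i)) /\
  forall u, lspan (range e) u -> u = \sum_i (e' i u : k) *: e i.
Proof.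
pose p (c : 'rV[k]_n) : U := \sum_i c 0 i *: e i.
have lp : linear p.
  move=> a x y; rewrite /p scaler_sumr -big_split; apply: eq_bigr => i _.
  by rewrite !mxE scalerDl scalerA.
have [g [lg gp]] := lin_ginv lp.
exists (fun i u => g u 0 i); split=> [i a x y|u us]; first by rewrite lg !mxE.
have [c _ <-] : range p u.
  apply: lspan_sub us; first exact: submod_image (submodT _).
  move=> _ [i _ <-]; exists (delta_mx 0 i) => //.
  rewrite /p (bigD1 i)//= mxE !eqxx scale1r big1 ?addr0// => j ji.
  by rewrite mxE (negPf ji) andbF scale0r.
by rewrite -[LHS]gp.
Qed.

Lemma tensor_repr U V (z : (U ⊗ V)%type) :
  exists n (c : 'I_n -> U) (d : 'I_n -> V), z = \sum_i c i ⊗ d i.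
Proof.
have [lt rt] := ten_bilin U V.
elim/ten_ind: z => [|x y [m [c [d ->]]] [n [c' [d' ->]]]|u v].
- by exists 0, (fun=> 0), (fun=> 0); rewrite big_ord0.
- exists (m + n)%N, (fun i : 'I_(m + n) => match fintype.split i with inl j => c j | inr j => c' j end),
    (fun i : 'I_(m + n) => match fintype.split i with inl j => d j | inr j => d' j end).
  rewrite big_split_ord; congr (_ + _); apply: eq_bigr => i _ /=.
    by have := unsplitK (inl i : 'I_m + 'I_n) => /= ->.
  by have := unsplitK (inr i : 'I_m + 'I_n) => /= ->.
- by exists 1%N, (fun=> u), (fun=> v); rewrite big_ord1.
Qed.

(** Expanding each [c i] in coordinates on the family [c] itself gives a sum of [c j ⊗ w j], where
    [w j] is the contraction of z with the form [e' j], hence 0. *)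
Lemma tensor_sep U W (z : (U ⊗ W)%type) :
  (forall phi : U -> k^o, linear phi -> \tsum_(x, y <- z) (phi x : k) *: y = 0) ->
  z = 0.
Proof.
have [n [c [d ->]]] := tensor_repr z => {z} z0.
have [e' [le' ce']] := span_coord c.
have cE i : c i = \sum_j (e' j (c i) : k) *: c j.
  by apply: ce'; apply: lspan_gen; exists i.
have lt (w : W) : linear (fun u : U => u ⊗ w) by linr.
have lr (u : U) : linear (fun w : W => u ⊗ w) by linr.
under eq_bigr => i _.
  rewrite cE (lin_sum _ _ _ (lt _)).
  under eq_bigr => j _ do rewrite (linZ (lt _)) -(linZ (lr _)).
  over.
rewrite exchange_big /= big1// => j _.
rewrite -(lin_sum _ _ _ (lr _)).
have b : bilin (fun (x : U) (y : W) => (e' j x : k) *: y) by blin.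
suff -> : \sum_i (e' j (c i) : k) *: d i = 0 by rewrite (linear_at0 (lr _)).
rewrite -[RHS](z0 (e' j) (le' j)) (lin_sum _ _ _ (tsum_linear b)).
by apply: eq_bigr => i _; rewrite tsum_ten.
Qed.

Lemma tensor_ext U W (z z' : (U ⊗ W)%type) :
  (forall phi : U -> k^o, linear phi ->
    \tsum_(x, y <- z) (phi x : k) *: y = \tsum_(x, y <- z') (phi x : k) *: y) ->
  z = z'.
Proof.
move=> zz; apply/eqP; rewrite -subr_eq0; apply/eqP; apply: tensor_sep => phi lphi.
have b : bilin (fun (x : U) (y : W) => (phi x : k) *: y) by blin.
by have /= -> := linB (tsum_linear b) z z'; rewrite zz// subrr.
Qed.

Lemma eq_tsum U V W (t : (U ⊗ V)%type) (b b' : U -> V -> W) :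
  (forall x y, b x y = b' x y) -> \tsum_(x, y <- t) b x y = \tsum_(x, y <- t) b' x y.
Proof. by move=> e; congr tsum; apply/funext => x; apply/funext. Qed.

Lemma tsum_exch U V U' V' W (t : (U ⊗ V)%type) (t' : (U' ⊗ V')%type)
    (F : U -> V -> U' -> V' -> W) :
  \tsum_(a, b <- t) \tsum_(c, d <- t') F a b c d =
  \tsum_(c, d <- t') \tsum_(a, b <- t) F a b c d.
Proof.
rewrite !tsumE; under eq_bigr => i _ do rewrite tsumE scaler_sumr.
rewrite exchange_big; apply: eq_bigr => j _; rewrite tsumE scaler_sumr.
by apply: eq_bigr => i _; rewrite !scalerA mulrC.
Qed.

Lemma tsum_tsum U V U' V' W (t : (U ⊗ V)%type) (F : U -> V -> (U' ⊗ V')%type)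
    (b : U' -> V' -> W) : bilin b ->
  \tsum_(x, y <- \tsum_(a, b <- t) F a b) b x y =
  \tsum_(a, c <- t) \tsum_(x, y <- F a c) b x y.
Proof. by move=> bb; rewrite (tsum_comp _ _ (tsum_linear bb)). Qed.

Lemma tsumD U V W (t : (U ⊗ V)%type) (b b' : U -> V -> W) :
  \tsum_(x, y <- t) (b x y + b' x y) =
  \tsum_(x, y <- t) b x y + \tsum_(x, y <- t) b' x y.
Proof. by rewrite !tsumE -big_split; apply: eq_bigr => i _; rewrite scalerDr. Qed.

Lemma tsumN U V W (t : (U ⊗ V)%type) (b : U -> V -> W) :
  \tsum_(x, y <- t) - b x y = - \tsum_(x, y <- t) b x y.
Proof. by rewrite !tsumE -sumrN; apply: eq_bigr => i _; rewrite scalerN. Qed.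

Lemma tsumZ U V W (t : (U ⊗ V)%type) (b : U -> V -> W) (a : k) :
  \tsum_(x, y <- t) a *: b x y = a *: \tsum_(x, y <- t) b x y.
Proof. by apply/esym; apply: tsum_comp => c x y; rewrite scalerDr !scalerA mulrC. Qed.

Lemma tsum0 U V W (t : (U ⊗ V)%type) : \tsum_(x, y <- t) (0 : W) = 0.
Proof. by rewrite tsumE big1// => i _; rewrite scaler0. Qed.

Lemma tsum_bigsum U V W (t : (U ⊗ V)%type) (I : finType) (F : I -> U -> V -> W) :
  \tsum_(x, y <- t) \sum_i F i x y = \sum_i \tsum_(x, y <- t) F i x y.
Proof.
rewrite tsumE; under eq_bigr => c _ do rewrite scaler_sumr.
by rewrite exchange_big; apply: eq_bigr => i _; rewrite tsumE.
Qed.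

Lemma tsum_eq0 U V W (t : (U ⊗ V)%type) (b : U -> V -> W) :
  (forall x y, b x y = 0) -> \tsum_(x, y <- t) b x y = 0.
Proof. by move=> b0; rewrite -[RHS](tsum0 W t); apply: eq_tsum. Qed.

Lemma tsum0l U V W (b : U -> V -> W) : bilin b -> \tsum_(x, y <- 0) b x y = 0.
Proof. by move=> bb; apply: linear_at0 (tsum_linear bb). Qed.

Lemma tsumDl U V W (b : U -> V -> W) (s t : (U ⊗ V)%type) : bilin b ->
  \tsum_(x, y <- s + t) b x y = \tsum_(x, y <- s) b x y + \tsum_(x, y <- t) b x y.
Proof. by move=> bb; apply: linD (tsum_linear bb) _ _. Qed.

Definition tens_in U W (A : set W) : set (U ⊗ W)%type :=
  lspan [set h ⊗ x | h in setT & x in A].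

Lemma tens_in_ten U W (A : set W) (u : U) x : A x -> tens_in A (u ⊗ x).
Proof. by move=> Ax; apply: lspan_gen; exists u => //; exists x. Qed.

Lemma tens_in_submod U W (A : set W) : submod (@tens_in U W A).
Proof. exact: submod_lspan. Qed.

Lemma tsum_in U V W (A : set V) (C : set W) (b : U -> V -> W) (z : (U ⊗ V)%type) :
  submod C -> bilin b -> tens_in A z -> (forall u x, A x -> C (b u x)) ->
  C (\tsum_(u, x <- z) b u x).
Proof.
move=> sC bb Az CA; move: z Az; apply: lspan_sub.
  exact: submod_preimage (tsum_linear bb) sC.
by move=> _ [u _ [x Ax <-]]; rewrite /= tsum_ten//; apply: CA.
Qed.

Lemma tsum_in_sub U V W (C : set W) (b : U -> V -> W) (z : (U ⊗ V)%type) :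
  submod C -> (forall u x, C (b u x)) -> C (\tsum_(u, x <- z) b u x).
Proof.
by move=> sC Cb; rewrite tsumE; apply: submod_sum => // i _; apply: submodZ.
Qed.

(** If all contractions of z lie in A, then id ⊗ e kills z for a projection e with kernel A, so z is
    the sum of the x ⊗ (y - e y). Coaction stability of a subspace thereby becomes a condition on
    contractions, see [yd_submodP]. *)
Lemma tens_inP U W (A : set W) (z : (U ⊗ W)%type) : submod A ->
  tens_in A z <->
  forall phi : U -> k^o, linear phi -> A (\tsum_(x, y <- z) (phi x : k) *: y).
Proof.
move=> sA; split=> [Az phi lphi|zA].
  by apply: tsum_in Az _ => //; [blin|move=> u x Ax; apply: submodZ].
have [e [le Ae eA]] := projector sA.
have b0 : bilin (fun (x : U) (y : W) => x ⊗ e y) by blin.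
have : \tsum_(x, y <- z) x ⊗ e y = 0.
  apply: tensor_sep => phi lphi; have bp : bilin (fun (x : U) (y : W) => (phi x : k) *: y) by blin.
  rewrite tsum_tsum//; under eq_tsum => x y do rewrite tsum_ten// -(linZ le).
  by rewrite -(tsum_comp _ _ le); apply/Ae/zA.
move=> ze; have zE : z = \tsum_(x, y <- z) x ⊗ (y - e y) + \tsum_(x, y <- z) x ⊗ e y.
  rewrite -tsumD -[LHS]tsum_id; apply: eq_tsum => x y.
  by rewrite -(linD ((ten_bilin _ _).2 x)) subrK.
rewrite zE ze addr0; apply: tsum_in_sub; first exact: tens_in_submod.
by move=> u x; apply: tens_in_ten.
Qed.

Lemma linear_pack U V (f : U -> V) : linear f ->
  exists F : {linear U -> V}, f = F :> (U -> V).
Proof.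
move=> lf; pose F : {linear U -> V} :=
  HB.pack f (GRing.isLinear.Build k U V *:%R f lf).
by exists F.
Qed.

End Functionals.

(** * Hopf algebras *)

Section Trilinear.
Variable k : fieldType.
Implicit Types U V W X : lmodType k.

Definition trilin U V X W (F : U -> V -> X -> W) :=
  [/\ forall v x, linear (fun u => F u v x), forall u x, linear (fun v => F u v x) &
      forall u v, linear (F u v)].

Lemma trilin_tsum U V X W (F : U -> V -> X -> W) : trilin F ->
  linear (fun z : (U ⊗ (V ⊗ X))%type => \tsum_(u, y <- z) \tsum_(v, x <- y) F u v x).
Proof.
move=> [F1 F2 F3]; apply: tsum_linear; split=> [y|u].
  by apply: tsum_param => *; apply: F1.
by apply: tsum_linear; split=> *; [apply: F2|apply: F3].
Qed.

Lemma trilin_ten U V X W (F : U -> V -> X -> W) u y : trilin F ->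
  \tsum_(u, y <- u ⊗ y) \tsum_(v, x <- y) F u v x = \tsum_(v, x <- y) F u v x.
Proof.
move=> [F1 F2 F3]; rewrite tsum_ten//; split=> *.
  by apply: tsum_param => *; apply: F1.
by apply: tsum_linear; split=> *; [apply: F2|apply: F3].
Qed.

End Trilinear.

Ltac tlin := split; linr.

Section HopfSweedler.
Variables (k : fieldType) (H : hopfAlgebra k).
Local Notation Δ := (@comul k H).
Local Notation ε := (@counit k H).
Local Notation S := (@antipode k H).
Implicit Types (W : lmodType k) (h g : H).

(** Coassociativity in the form used throughout: Sweedler sums are regrouped under an arbitrary
    trilinear expression. Longer regroupings apply it, or [coactA], several times. *)
Lemma comulA W (F : H -> H -> H -> W) h : trilin F ->
  \tsum_(x, h3 <- Δ h) \tsum_(h1, h2 <- Δ x) F h1 h2 h3 =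
  \tsum_(h1, y <- Δ h) \tsum_(h2, h3 <- Δ y) F h1 h2 h3.
Proof.
move=> tF; have lF := trilin_tsum tF; have [F1 F2 F3] := tF.
have := comul_coassoc h => /(congr1 (fun z =>
  \tsum_(u, y <- z) \tsum_(v, x <- y) F u v x)).
rewrite !(tsum_comp _ _ lF) => e; transitivity
  (\tsum_(x, y <- Δ h) \tsum_(u, y0 <- \tsum_(h1, h2 <- Δ x) h1 ⊗ (h2 ⊗ y))
    \tsum_(v, x0 <- y0) F u v x0).
  apply: eq_tsum => x h3; rewrite (tsum_comp _ _ lF); apply: eq_tsum => h1 h2.
  by rewrite trilin_ten// tsum_ten.
by rewrite e; apply: eq_tsum => h1 y; rewrite trilin_ten.
Qed.

Lemma coactA (V : ydModule H) W (F : H -> H -> V -> W) (v : V) : trilin F ->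
  \tsum_(h, v0 <- coact v) \tsum_(h1, h2 <- Δ h) F h1 h2 v0 =
  \tsum_(h1, v1 <- coact v) \tsum_(h2, v0 <- coact v1) F h1 h2 v0.
Proof.
move=> tF; have lF := trilin_tsum tF; have [F1 F2 F3] := tF.
have := coact_coassoc v => /(congr1 (fun z =>
  \tsum_(u, y <- z) \tsum_(v, x <- y) F u v x)).
rewrite !(tsum_comp _ _ lF) => e; transitivity
  (\tsum_(x, y <- coact v) \tsum_(u, y0 <- \tsum_(h1, h2 <- Δ x) h1 ⊗ (h2 ⊗ y))
    \tsum_(v, x0 <- y0) F u v x0).
  apply: eq_tsum => x h3; rewrite (tsum_comp _ _ lF); apply: eq_tsum => h1 h2.
  by rewrite trilin_ten// tsum_ten.
by rewrite e; apply: eq_tsum => h1 y; rewrite trilin_ten.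
Qed.

Lemma counit_lE W (G : H -> W) h : linear G ->
  \tsum_(h1, h2 <- Δ h) (ε h1 : k) *: G h2 = G h.
Proof.
move=> lG; rewrite -[in RHS](counit_l h) (tsum_comp _ _ lG).
by apply: eq_tsum => x y; rewrite linZ.
Qed.

Lemma counit_rE W (G : H -> W) h : linear G ->
  \tsum_(h1, h2 <- Δ h) (ε h2 : k) *: G h1 = G h.
Proof.
move=> lG; rewrite -[in RHS](counit_r h) (tsum_comp _ _ lG).
by apply: eq_tsum => x y; rewrite linZ.
Qed.

Lemma coact_counitE (V : ydModule H) W (G : V -> W) v : linear G ->
  \tsum_(h, v0 <- coact v) (ε h : k) *: G v0 = G v.
Proof.
move=> lG; rewrite -[in RHS](coact_counit v) (tsum_comp _ _ lG).
by apply: eq_tsum => x y; rewrite linZ.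
Qed.

Lemma antipode_lE W (G : H -> W) h : linear G ->
  \tsum_(h1, h2 <- Δ h) G (S h1 * h2) = (ε h : k) *: G 1.
Proof. by move=> lG; rewrite -(tsum_comp _ _ lG) antipode_l linZ. Qed.

Lemma antipode_rE W (G : H -> W) h : linear G ->
  \tsum_(h1, h2 <- Δ h) G (h1 * S h2) = (ε h : k) *: G 1.
Proof. by move=> lG; rewrite -(tsum_comp _ _ lG) antipode_r linZ. Qed.

Lemma antipode1 : S 1 = 1.
Proof.
have := antipode_l (1 : H); rewrite comul1 tsum_ten; last by blin.
by rewrite mulr1 counit1 scale1r.
Qed.

Lemma counitS h : ε (S h) = ε h.
Proof.
have /(congr1 ε) := antipode_l h.
have le : linear ε by linr.
rewrite (tsum_comp _ _ le) linZ// counit1.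
under eq_tsum => x y do rewrite counitM.
move=> e; transitivity (ε h *: (1 : k^o)); last by rewrite /GRing.scale /= mulr1.
rewrite -e -[in LHS](counit_r h) !(tsum_comp _ _ (lin_comp le _)); last by linr.
by apply: eq_tsum => x y; rewrite !linearZ /= mulrC.
Qed.

(** Uniqueness of convolution inverses: insert g2 S(g3) and h2 S(h3) behind S(g1 h1), regroup, and
    cancel S(g1 h1) against g2 h2. *)
Lemma antipodeM g h : S (g * h) = S h * S g.
Proof.
have lS : linear S by linr.
transitivity (\tsum_(g1, g23 <- Δ g) \tsum_(g2, g3 <- Δ g23)
  \tsum_(h1, h23 <- Δ h) \tsum_(h2, h3 <- Δ h23)
   (S (g1 * h1) * (g2 * (h2 * S h3) * S g3))).
  transitivity (\tsum_(g1, g23 <- Δ g) \tsum_(g2, g3 <- Δ g23)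
     (S (g1 * h) * (g2 * S g3))).
    rewrite -[LHS](counit_rE (G := fun g => S (g * h))); last by linr.
    apply: eq_tsum => x y; rewrite antipode_rE ?mulr1//.
    by linr.
  apply: eq_tsum => g1 g23; apply: eq_tsum => g2 g3.
  rewrite -[LHS](counit_rE (G := fun h => S (g1 * h) * (g2 * S g3))); last by linr.
  apply: eq_tsum => h1 h23.
  rewrite (antipode_rE (G := fun z => S (g1 * h1) * (g2 * z * S g3))) ?mulr1//.
  by linr.
rewrite -comulA; last by tlin.
transitivity (\tsum_(x, g3 <- Δ g) (ε x : k) *: (S h * S g3)); last first.
  by rewrite counit_lE//; linr.
apply: eq_tsum => x g3.
transitivity (\tsum_(g1, g2 <- Δ x) \tsum_(y, h3 <- Δ h) \tsum_(h1, h2 <- Δ y)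
     (S (g1 * h1) * (g2 * h2) * (S h3 * S g3))).
  apply: eq_tsum => g1 g2; rewrite -comulA; last by tlin.
  by do 2![apply: eq_tsum => ? ?]; rewrite !mulrA.
rewrite tsum_exch -(counit_lE (G := fun z => (ε x : k) *: (S z * S g3))); last by linr.
apply: eq_tsum => y h3.
transitivity (\tsum_(a, b <- Δ (x * y)) (S a * b * (S h3 * S g3))).
  rewrite comulM tsum_tsum; last by blin.
  apply: eq_tsum => g1 g2; rewrite tsum_tsum; last by blin.
  by apply: eq_tsum => h1 h2; rewrite tsum_ten; last by blin.
rewrite (antipode_lE (G := fun z => z * (S h3 * S g3))); last by linr.
by rewrite counitM scalerA mul1r mulrC.
Qed.

Definition mul2 (z w : (H ⊗ H)%type) : (H ⊗ H)%type :=
  \tsum_(a, b <- z) \tsum_(c, d <- w) (a * c) ⊗ (b * d).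

Lemma mul2_bilin : bilin mul2.
Proof. by rewrite /mul2; blin. Qed.
Hint Resolve mul2_bilin : lin.

Lemma mul2_ten a b c d : mul2 (a ⊗ b) (c ⊗ d) = (a * c) ⊗ (b * d).
Proof. by rewrite /mul2 !tsum_ten//; blin. Qed.

Lemma mul2A z w t : mul2 z (mul2 w t) = mul2 (mul2 z w) t.
Proof.
elim/ten_ind: z => [|x y ex ey|a b].
- by rewrite !(linear_at0 (mul2_bilin.1 _)).
- by rewrite !(linD (mul2_bilin.1 _)) ex ey.
elim/ten_ind: w => [|x y ex ey|c d].
- by rewrite !(linear_at0 (mul2_bilin.1 _), linear_at0 (mul2_bilin.2 _)).
- by rewrite !(linD (mul2_bilin.1 _), linD (mul2_bilin.2 _)) ex ey.
elim/ten_ind: t => [|x y ex ey|e f].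
- by rewrite !(linear_at0 (mul2_bilin.2 _)).
- by rewrite !(linD (mul2_bilin.2 _)) ex ey.
by rewrite !mul2_ten !mulrA.
Qed.

(** Both sides are convolution inverses of Δ in the maps from H to the algebra H ⊗ H with product
    [mul2]; [GR] is the inverse property of the right side. *)
Lemma comul_antipode h : Δ (S h) = \tsum_(h1, h2 <- Δ h) S h2 ⊗ S h1.
Proof.
pose G h := \tsum_(h1, h2 <- Δ h) S h2 ⊗ S h1.
have lG : linear G by rewrite /G; linr.
have mul21 z : mul2 z (1 ⊗ 1) = z.
  elim/ten_ind: z => [|x y ex ey|a b]; first exact: linear_at0 (mul2_bilin.1 _).
    by rewrite (linD (mul2_bilin.1 _)) ex ey.
  by rewrite mul2_ten !mulr1.
have mul12 z : mul2 (1 ⊗ 1) z = z.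
  elim/ten_ind: z => [|x y ex ey|a b]; first exact: linear_at0 (mul2_bilin.2 _).
    by rewrite (linD (mul2_bilin.2 _)) ex ey.
  by rewrite mul2_ten !mul1r.
have GR x : \tsum_(h1, h2 <- Δ x) mul2 (Δ h1) (G h2) = (ε x : k) *: (1 ⊗ 1).
  transitivity (\tsum_(h1, y <- Δ x) \tsum_(a, b <- Δ h1) \tsum_(c, d <- Δ y)
     (a * S d) ⊗ (b * S c)).
    apply: eq_tsum => h1 h2; rewrite /mul2 /G; apply: eq_tsum => a b.
    rewrite tsum_tsum; last by blin.
    by apply: eq_tsum => c d; rewrite tsum_ten//; blin.
  rewrite comulA; last by tlin.
  transitivity (\tsum_(a, y <- Δ x) (a * S y) ⊗ (1 : H)); last first.
    by rewrite (antipode_rE (G := fun z => z ⊗ (1 : H)))//; linr.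
  apply: eq_tsum => a y.
  rewrite -(comulA (F := fun b c d => (a * S d) ⊗ (b * S c))); last by tlin.
  rewrite -[RHS](counit_lE (G := fun d => (a * S d) ⊗ (1 : H))); last by linr.
  by apply: eq_tsum => z d; rewrite antipode_rE//; linr.
transitivity (\tsum_(h1, y <- Δ h) \tsum_(h2, h3 <- Δ y)
    mul2 (Δ (S h1)) (mul2 (Δ h2) (G h3))).
  rewrite -[LHS](counit_rE (G := fun z => Δ (S z))); last by linr.
  apply: eq_tsum => h1 y; rewrite -(tsum_comp _ _ (mul2_bilin.2 _)) GR.
  by rewrite (linZ (mul2_bilin.2 _)) mul21.
rewrite -comulA; last by tlin.
rewrite -[RHS](counit_lE _ lG).
apply: eq_tsum => x h3.
have mul2E g g' : mul2 (Δ g) (Δ g') = Δ (g * g') by rewrite comulM.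
under eq_tsum => h1 h2 do rewrite mul2A mul2E.
rewrite (antipode_lE (G := fun z => mul2 (Δ z) (G h3))); last by linr.
by rewrite comul1 mul12.
Qed.

Lemma comul_antipodeE W (b : H -> H -> W) h : bilin b ->
  \tsum_(x, y <- Δ (S h)) b x y = \tsum_(h1, h2 <- Δ h) b (S h2) (S h1).
Proof.
move=> bb; rewrite comul_antipode tsum_tsum//.
by apply: eq_tsum => x y; rewrite tsum_ten.
Qed.

End HopfSweedler.
#[export] Hint Resolve mul2_bilin : lin.

(** * The inverse of the antipode *)

Section InverseAntipode.
Variables (k : fieldType) (H : hopfAlgebra k).
Local Notation Δ := (@comul k H).
Local Notation ε := (@counit k H).
Local Notation S := (@antipode k H).
Variable Si : H -> H.
Hypotheses (SK : cancel S Si) (SiK : cancel Si S).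
Implicit Types (W : lmodType k) (h g : H).

Let SI : injective S := can_inj SK.

Lemma Si_linear : linear Si.
Proof. by move=> a x y; apply: SI; rewrite linearP !SiK. Qed.
Hint Resolve Si_linear : lin.

Lemma SiM g h : Si (g * h) = Si h * Si g.
Proof. by apply: SI; rewrite antipodeM !SiK. Qed.

Lemma Si1 : Si 1 = 1.
Proof. by apply: SI; rewrite SiK antipode1. Qed.

Lemma counitSi h : ε (Si h) = ε h.
Proof. by rewrite -[in RHS](SiK h) counitS. Qed.

Lemma comul_SiE W (b : H -> H -> W) h : bilin b ->
  \tsum_(x, y <- Δ (Si h)) b x y = \tsum_(h1, h2 <- Δ h) b (Si h2) (Si h1).
Proof.
move=> bb; rewrite -{2}(SiK h) comul_antipodeE; last by blin.
by apply: eq_tsum => x y; rewrite !SK.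
Qed.

(** S^-1 applied to the antipode axiom: it reverses products, so the two Sweedler factors occur in
    the opposite order. *)
Lemma Si_lE W (G : H -> W) h : linear G ->
  \tsum_(h1, h2 <- Δ h) G (Si h2 * h1) = (ε h : k) *: G 1.
Proof.
move=> lG; have lGS : linear (fun x => G (Si x)) by linr.
rewrite -[in RHS]Si1 -[RHS](antipode_lE (G := fun x => G (Si x)))//.
by apply: eq_tsum => x y; rewrite SiM SK.
Qed.

Lemma Si_rE W (G : H -> W) h : linear G ->
  \tsum_(h1, h2 <- Δ h) G (h2 * Si h1) = (ε h : k) *: G 1.
Proof.
move=> lG; have lGS : linear (fun x => G (Si x)) by linr.
rewrite -[in RHS]Si1 -[RHS](antipode_rE (G := fun x => G (Si x)))//.
by apply: eq_tsum => x y; rewrite SiM SK.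
Qed.

End InverseAntipode.

(** * The Yetter-Drinfeld structure of the tensor algebra *)

#[export] Hint Extern 0 => exact: tin_linear : lin.
#[export] Hint Extern 0 => exact: tcoact_linear : lin.
#[export] Hint Extern 0 => exact: tcomul_linear : lin.
#[export] Hint Extern 0 => exact: tcounit_linear : lin.

Section TensorAlgebraYD.
Variables (k : fieldType) (H : hopfAlgebra k) (V : ydModule H).
Local Notation Δ := (@comul k H).
Local Notation ε := (@counit k H).
Local Notation S := (@antipode k H).
Local Notation T := (tensalg V).
Implicit Types (W : lmodType k) (h g : H) (v : V) (s t : T).

Lemma tact1r h : tact h (1 : T) = (ε h : k) *: 1.
Proof. by rewrite -word_nil tact_word. Qed.

Lemma tact_cons h v t :
  tact h (tin v * t) = \tsum_(h1, h2 <- Δ h) tin (act h1 v) * tact h2 t.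
Proof.
move: t; apply: tensalg_eq; [linr|linr|move=> w].
rewrite -word_cons tact_word /=.
by apply: eq_tsum => x y; rewrite tact_word.
Qed.

Lemma tact_tin h v : tact h (tin v) = tin (act h v).
Proof.
rewrite -[X in tact h X]mulr1 tact_cons.
rewrite -[RHS](counit_rE (G := fun h => tin (act h v))); last by linr.
by apply: eq_tsum => x y; rewrite tact1r -scalerAr mulr1.
Qed.

Lemma tactM h s t : tact h (s * t) = \tsum_(h1, h2 <- Δ h) tact h1 s * tact h2 t.
Proof.
move: s; apply: tensalg_eq; [linr|linr|move=> w].
elim: w h => [|v w ih] h.
  rewrite word_nil mul1r -[LHS](counit_lE (G := fun h => tact h t)); last by linr.
  by apply: eq_tsum => x y; rewrite tact1r -scalerAl mul1r.
rewrite word_cons -mulrA tact_cons.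
transitivity (\tsum_(h1, y <- Δ h) \tsum_(h2, h3 <- Δ y)
   tin (act h1 v) * (tact h2 (word w) * tact h3 t)).
  apply: eq_tsum => h1 y.
  have lm : linear (fun z : T => tin (act h1 v) * z) by linr.
  by rewrite ih (tsum_comp _ _ lm).
rewrite -comulA; last by tlin.
apply: eq_tsum => x h3; rewrite tact_cons.
have lm : linear (fun z : T => z * tact h3 t) by linr.
by rewrite (tsum_comp _ _ lm); apply: eq_tsum => h1 h2; rewrite mulrA.
Qed.

Lemma tact_unit t : tact 1 t = t.
Proof.
move: t; apply: tensalg_eq; [linr|linr|elim=> [|v w ih]].
  by rewrite word_nil tact1r counit1 scale1r.
rewrite word_cons tact_cons comul1 tsum_ten; last by blin.
by rewrite act1 ih.
Qed.

Lemma tact_mul g h t : tact (g * h) t = tact g (tact h t).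
Proof.
move: t; apply: tensalg_eq; [linr|linr|move=> w].
elim: w g h => [|v w ih] g h.
  rewrite word_nil !tact1r (linZ ((tact_bilin V).2 g)) tact1r scalerA.
  by rewrite counitM mulrC.
rewrite word_cons !tact_cons comulM tsum_tsum; last by blin.
have lg : linear (@tact k H V g) by linr.
rewrite (tsum_comp _ _ lg).
transitivity (\tsum_(h1, h2 <- Δ h) \tsum_(g1, g2 <- Δ g)
   tin (act g1 (act h1 v)) * tact g2 (tact h2 (word w))).
  rewrite tsum_exch; apply: eq_tsum => g1 g2.
  rewrite tsum_tsum; last by blin.
  apply: eq_tsum => h1 h2; rewrite tsum_ten; last by blin.
  by rewrite actM ih.
by apply: eq_tsum => h1 h2; rewrite tact_cons.
Qed.

Lemma tcoact1 : tcoact (1 : T) = 1 ⊗ 1.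
Proof. by rewrite -word_nil tcoact_word. Qed.

Lemma tcoact_consE W (b : H -> T -> W) v t : bilin b ->
  \tsum_(h, y <- tcoact (tin v * t)) b h y =
  \tsum_(g, v0 <- coact v) \tsum_(h, y <- tcoact t) b (g * h) (tin v0 * y).
Proof.
move=> bb; move: t; apply: tensalg_eq; [linr|linr|move=> w].
rewrite -word_cons !tcoact_word /= tsum_tsum//.
apply: eq_tsum => g v0; rewrite tsum_tsum//.
by apply: eq_tsum => h y; rewrite tsum_ten.
Qed.

Lemma tcoact_tinE W (b : H -> T -> W) v : bilin b ->
  \tsum_(h, y <- tcoact (tin v)) b h y = \tsum_(g, v0 <- coact v) b g (tin v0).
Proof.
move=> bb; rewrite -[X in tcoact X]mulr1 tcoact_consE//.
apply: eq_tsum => g v0; rewrite tcoact1 tsum_ten; last by blin.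
by rewrite !mulr1.
Qed.

Lemma tcoactME W (b : H -> T -> W) s t : bilin b ->
  \tsum_(h, y <- tcoact (s * t)) b h y =
  \tsum_(g, s0 <- tcoact s) \tsum_(h, t0 <- tcoact t) b (g * h) (s0 * t0).
Proof.
move=> bb; move: s; apply: tensalg_eq; [linr|linr|move=> w].
elim: w b bb => [|v w ih] b bb.
  rewrite word_nil mul1r tcoact1 tsum_ten; last by blin.
  by apply: eq_tsum => x y; rewrite !mul1r.
rewrite word_cons -mulrA tcoact_consE// tcoact_consE; last by blin.
apply: eq_tsum => g v0.
rewrite (ih (fun x y => b (g * x) (tin v0 * y))); last by blin.
by do 2!apply: eq_tsum => ? ?; rewrite !mulrA.
Qed.

Lemma tcoact_assoc t :
  \tsum_(h, v0 <- tcoact t) \tsum_(h1, h2 <- Δ h) h1 ⊗ (h2 ⊗ v0) =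
  \tsum_(h, v0 <- tcoact t) h ⊗ tcoact v0.
Proof.
have tcoactE (z : T) : tcoact z = \tsum_(a, b <- tcoact z) a ⊗ b by rewrite tsum_id.
move: t; apply: tensalg_eq; [linr|linr|elim=> [|v w ih]].
  rewrite word_nil !tcoact1 !tsum_ten; try by blin.
  by rewrite comul1 tcoact1 tsum_ten; last by blin.
rewrite word_cons !tcoact_consE; try by blin.
pose G (g1 g2 : H) (v0 : V) (z : (H ⊗ (H ⊗ T))%type) :=
  \tsum_(a, b <- z) \tsum_(c, d <- b) (g1 * a) ⊗ ((g2 * c) ⊗ (tin v0 * d)).
have lG g1 g2 v0 : linear (G g1 g2 v0) by rewrite /G; linr.
transitivity (\tsum_(g, v0 <- coact v) \tsum_(g1, g2 <- Δ g)
   G g1 g2 v0 (\tsum_(h, y <- tcoact (word w)) \tsum_(h1, h2 <- Δ h) h1 ⊗ (h2 ⊗ y))).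
  apply: eq_tsum => g v0.
  transitivity (\tsum_(h, y <- tcoact (word w)) \tsum_(g1, g2 <- Δ g)
    \tsum_(h1, h2 <- Δ h) (g1 * h1) ⊗ ((g2 * h2) ⊗ (tin v0 * y))).
    apply: eq_tsum => h y; rewrite comulM tsum_tsum; last by blin.
    apply: eq_tsum => g1 g2; rewrite tsum_tsum; last by blin.
    by apply: eq_tsum => h1 h2; rewrite tsum_ten//; blin.
  rewrite tsum_exch; apply: eq_tsum => g1 g2.
  rewrite (tsum_comp _ _ (lG g1 g2 v0)); apply: eq_tsum => h y.
  rewrite (tsum_comp _ _ (lG g1 g2 v0)); apply: eq_tsum => h1 h2.
  by rewrite /G !tsum_ten//; blin.
rewrite (coactA (F := fun g1 g2 v0 => G g1 g2 v0 _)); last by rewrite /G; tlin.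
apply: eq_tsum => g v0; rewrite ih.
transitivity (\tsum_(h, y <- tcoact (word w)) \tsum_(g2, v1 <- coact v0)
    \tsum_(c, d <- tcoact y) (g * h) ⊗ ((g2 * c) ⊗ (tin v1 * d))).
  rewrite tsum_exch; apply: eq_tsum => g2 v1.
  rewrite (tsum_comp _ _ (lG g g2 v1)); apply: eq_tsum => h y.
  by rewrite /G tsum_ten//; blin.
apply: eq_tsum => h y; rewrite [in RHS]tcoactE tcoact_consE; last by blin.
have lt : linear (fun z : (H ⊗ T)%type => (g * h) ⊗ z) by linr.
by rewrite !(tsum_comp _ _ lt); apply: eq_tsum => g2 v1; rewrite (tsum_comp _ _ lt).
Qed.

Lemma tcoact_counit t : \tsum_(h, t0 <- tcoact t) (ε h : k) *: t0 = t.
Proof.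
move: t; apply: tensalg_eq; [linr|linr|elim=> [|v w ih]].
  rewrite word_nil tcoact1 tsum_ten; last by blin.
  by rewrite counit1 scale1r.
rewrite word_cons tcoact_consE; last by blin.
rewrite -[in RHS]ih -[RHS](coact_counitE (G := fun v => tin v * _)); last by linr.
apply: eq_tsum => g v0.
have lt : linear (fun z => (ε g : k) *: (tin v0 * z)) by linr.
rewrite (tsum_comp _ _ lt).
by apply: eq_tsum => h y; rewrite counitM -scalerAr scalerA.
Qed.

Lemma coact_actE (W : lmodType k) (U : ydModule H) (b : H -> U -> W) h (u : U) : bilin b ->
  \tsum_(g, x <- coact (act h u)) b g x =
  \tsum_(h1, y <- Δ h) \tsum_(h2, h3 <- Δ y) \tsum_(g, u0 <- coact u)
    b (h1 * g * S h3) (act h2 u0).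
Proof.
move=> bb; rewrite yd_compat tsum_tsum//; apply: eq_tsum => h1 y.
rewrite tsum_tsum//; apply: eq_tsum => h2 h3.
by rewrite tsum_tsum//; apply: eq_tsum => g u0; rewrite tsum_ten.
Qed.

(** On a product of a generator and a word, the two Yetter-Drinfeld twists meet in a factor
    [S g3 * g4], which the antipode axiom removes. [F] is the expression before this cancellation,
    [F'] after it. *)
Lemma tcoact_compat h t : tcoact (tact h t) =
  \tsum_(h1, h23 <- Δ h) \tsum_(h2, h3 <- Δ h23) \tsum_(g, t0 <- tcoact t)
    (h1 * g * S h3) ⊗ tact h2 t0.
Proof.
have tcoactE (z : T) : tcoact z = \tsum_(a, b <- tcoact z) a ⊗ b by rewrite tsum_id.
have lc : linear (@tcoact k H V) by linr.
move: t; apply: tensalg_eq; [linr|linr|move=> w].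
elim: w h => [|v w ih] h.
  rewrite word_nil tact1r linZ// !tcoact1.
  transitivity (\tsum_(h1, h3 <- Δ h) (h1 * S h3) ⊗ (1 : T)).
    by rewrite (antipode_rE (G := fun z => z ⊗ (1 : T)))//; linr.
  apply: eq_tsum => h1 y.
  rewrite -[LHS](counit_lE (G := fun y => (h1 * S y) ⊗ (1 : T))); last by linr.
  apply: eq_tsum => h2 h3; rewrite tsum_ten; last by blin.
  by rewrite mulr1 tact1r (linZ ((ten_bilin _ _).2 _)).
rewrite word_cons tact_cons (tsum_comp _ _ lc).
pose F g1 g2 g3 g4 g5 g6 := \tsum_(g, v0 <- coact v)
  \tsum_(g', y <- tcoact (word w))
    (g1 * g * S g3 * (g4 * g' * S g6)) ⊗ (tin (act g2 v0) * tact g5 y).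
transitivity (\tsum_(x, y <- Δ h) \tsum_(g1, z <- Δ x) \tsum_(g2, g3 <- Δ z)
   \tsum_(g4, z' <- Δ y) \tsum_(g5, g6 <- Δ z') F g1 g2 g3 g4 g5 g6).
  apply: eq_tsum => x y; rewrite tcoactE tcoactME; last by blin.
  rewrite tcoact_tinE; last by blin.
  rewrite coact_actE; last by blin.
  apply: eq_tsum => g1 z; apply: eq_tsum => g2 g3.
  rewrite /F; under [RHS]eq_tsum => g4 z' do rewrite tsum_exch.
  rewrite [RHS]tsum_exch; apply: eq_tsum => g v0.
  rewrite ih tsum_tsum; last by blin.
  apply: eq_tsum => g4 z'; rewrite tsum_tsum; last by blin.
  apply: eq_tsum => g5 g6; rewrite tsum_tsum; last by blin.
  by apply: eq_tsum => g' u; rewrite tsum_ten; last by blin.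
pose F' g1 g2 g5 g6 := \tsum_(g, v0 <- coact v)
  \tsum_(g', y <- tcoact (word w))
    (g1 * g * (g' * S g6)) ⊗ (tin (act g2 v0) * tact g5 y).
rewrite comulA; last by rewrite /F; tlin.
apply: eq_tsum => g1 u.
transitivity (\tsum_(g2, x <- Δ u) \tsum_(g5, g6 <- Δ x) F' g1 g2 g5 g6).
  rewrite comulA; last by rewrite /F; tlin.
  apply: eq_tsum => g2 x; rewrite -comulA; last by rewrite /F; tlin.
  rewrite -[RHS](counit_lE (G := fun x => \tsum_(g5, g6 <- Δ x) F' g1 g2 g5 g6));
    last by rewrite /F'; linr.
  apply: eq_tsum => q z; rewrite tsum_exch -tsumZ; apply: eq_tsum => g5 g6.
  pose G c := \tsum_(g, v0 <- coact v) \tsum_(g', y <- tcoact (word w))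
    (g1 * g * (c * (g' * S g6))) ⊗ (tin (act g2 v0) * tact g5 y).
  transitivity (\tsum_(g3, g4 <- Δ q) G (S g3 * g4)).
    apply: eq_tsum => g3 g4; rewrite /F /G.
    by do 2!apply: eq_tsum => ? ?; rewrite !mulrA.
  rewrite (antipode_lE (G := G)); last by rewrite /G; linr.
  by congr (_ *: _); rewrite /G /F'; do 2!apply: eq_tsum => ? ?; rewrite mul1r.
rewrite -comulA; last by rewrite /F'; tlin.
apply: eq_tsum => h2 h3; rewrite tcoact_consE; last by blin.
rewrite /F' tsum_exch; apply: eq_tsum => g v0.
rewrite tsum_exch; apply: eq_tsum => g' y.
rewrite tact_cons (tsum_comp (F := fun z => (g1 * (g * g') * S h3) ⊗ z)); last by linr.
by apply: eq_tsum => a b; rewrite !mulrA.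
Qed.

End TensorAlgebraYD.

(** * Skew derivations and the Nichols algebra *)

Section SkewDerivation.
Variables (k : fieldType) (H : hopfAlgebra k) (V : ydModule H).
Local Notation Δ := (@comul k H).
Local Notation ε := (@counit k H).
Local Notation S := (@antipode k H).
Local Notation T := (tensalg V).
Implicit Types (W : lmodType k) (h g : H) (v : V) (s t : T).

(* The component in V ⊗ T(V) of the coproduct of T(V), see tcomul_dl. *)
Fixpoint dl_word (w : seq V) : (V ⊗ T)%type :=
  if w is v :: w' then
    v ⊗ word w' +
    \tsum_(g, v0 <- coact v) \tsum_(x, y <- dl_word w') act g x ⊗ (tin v0 * y)
  else 0.

Definition dl (t : T) : (V ⊗ T)%type := wlift dl_word t.

Lemma dl_word_multilin : multilin dl_word.
Proof.
move=> p q; elim: p => [|u p ih] /=; first by linr.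
apply: lin_add; last by linr.
by apply: lin_tenr; apply: word_multilin.
Qed.

Lemma dl_linear : linear dl.
Proof. exact/wlift_linear/dl_word_multilin. Qed.
Hint Extern 0 => exact: dl_linear : lin.

Lemma dl1 : dl 1 = 0.
Proof. by rewrite -word_nil /dl wlift_word//; apply: dl_word_multilin. Qed.

Lemma dl_cons v t : dl (tin v * t) = v ⊗ t +
  \tsum_(g, v0 <- coact v) \tsum_(x, y <- dl t) act g x ⊗ (tin v0 * y).
Proof.
move: t; apply: tensalg_eq; [linr|linr|move=> w].
by rewrite -word_cons /dl !wlift_word//; apply: dl_word_multilin.
Qed.

Lemma dl_tin v : dl (tin v) = v ⊗ 1.
Proof.
rewrite -[X in dl X]mulr1 dl_cons dl1.
by rewrite tsum_eq0 ?addr0// => g v0; rewrite tsum0l//; blin.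
Qed.

Lemma dl_consE W (b : V -> T -> W) v t : bilin b ->
  \tsum_(x, y <- dl (tin v * t)) b x y = b v t +
  \tsum_(g, v0 <- coact v) \tsum_(x, y <- dl t) b (act g x) (tin v0 * y).
Proof.
move=> bb; rewrite dl_cons (linD (tsum_linear bb)) tsum_ten//; congr (_ + _).
rewrite tsum_tsum//; apply: eq_tsum => g v0; rewrite tsum_tsum//.
by apply: eq_tsum => x y; rewrite tsum_ten.
Qed.

(** The Leibniz rule for right multiplication. With [dl_cons] it differentiates both terms of
    ad_c(x)(y) = xy - (x_(-1).y) x_(0). *)
Lemma dlMr t x : dl (t * tin x) =
  \tsum_(a, b <- dl t) a ⊗ (b * tin x) + \tsum_(h, t0 <- tcoact t) act h x ⊗ t0.
Proof.
move: t; apply: tensalg_eq; [linr|linr|elim=> [|v w ih]].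
  rewrite word_nil mul1r dl_tin dl1 tcoact1 tsum0l; last by blin.
  by rewrite add0r tsum_ten ?act1//; blin.
rewrite word_cons -mulrA dl_cons dl_consE; last by blin.
rewrite -addrA; congr (_ + _).
rewrite ih tcoact_consE; last by blin.
rewrite -tsumD; apply: eq_tsum => g v0.
rewrite tsumDl; last by blin.
congr (_ + _).
  rewrite tsum_tsum; last by blin.
  by apply: eq_tsum => a b; rewrite tsum_ten ?mulrA//; blin.
rewrite tsum_tsum; last by blin.
by apply: eq_tsum => a b; rewrite tsum_ten ?actM//; blin.
Qed.

Lemma dlME W (b : V -> T -> W) t x : bilin b ->
  \tsum_(a, y <- dl (t * tin x)) b a y =
  \tsum_(a, y <- dl t) b a (y * tin x) + \tsum_(h, t0 <- tcoact t) b (act h x) t0.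
Proof.
move=> bb; rewrite dlMr tsumDl// !tsum_tsum//.
by congr (_ + _); apply: eq_tsum => *; rewrite tsum_ten.
Qed.

(** H-linearity of [dl], by induction on words. The coaction of [act h1 v] leaves an antipode next
    to the following Sweedler factor, and the two cancel. *)
Lemma dl_act h t : dl (tact h t) =
  \tsum_(h1, h2 <- Δ h) \tsum_(x, y <- dl t) act h1 x ⊗ tact h2 y.
Proof.
have ld : linear dl by linr.
move: t; apply: tensalg_eq; [linr|linr|move=> w].
elim: w h => [|v w ih] h.
  rewrite word_nil tact1r (linZ ld) dl1 scaler0.
  by rewrite tsum_eq0// => h1 h2; rewrite tsum0l//; blin.
rewrite word_cons tact_cons (tsum_comp _ _ ld).
under eq_tsum => h1 h2 do rewrite dl_cons.
transitivity (\tsum_(h1, h2 <- Δ h) (act h1 v ⊗ tact h2 (word w) +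
   \tsum_(g, v0 <- coact v) \tsum_(x, y <- dl (word w))
      act h1 (act g x) ⊗ tact h2 (tin v0 * y))); last first.
  by apply: eq_tsum => h1 h2; rewrite dl_consE//; blin.
rewrite !tsumD; congr (_ + _).
transitivity (\tsum_(x, h4 <- Δ h) \tsum_(h1, y <- Δ x) \tsum_(h2, h3 <- Δ y)
   \tsum_(h4', h5 <- Δ h4) \tsum_(g, v0 <- coact v) \tsum_(x, y <- dl (word w))
     act (h1 * g * (S h3 * h4')) x ⊗ (tin (act h2 v0) * tact h5 y)).
  apply: eq_tsum => x h4; rewrite coact_actE; last by blin.
  do 2![apply: eq_tsum => ? ?]; rewrite [RHS]tsum_exch; apply: eq_tsum => g v0.
  rewrite ih tsum_tsum; last by blin.
  apply: eq_tsum => ? ?; rewrite tsum_tsum; last by blin.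
  apply: eq_tsum => ? ?; rewrite tsum_ten; last by blin.
  by rewrite -actM !mulrA.
rewrite comulA; last by tlin.
apply: eq_tsum => h1 u.
rewrite comulA; last by tlin.
transitivity (\tsum_(h2, y <- Δ u) \tsum_(g, v0 <- coact v)
   \tsum_(a, b <- dl (word w)) act (h1 * g) a ⊗ (tin (act h2 v0) * tact y b)).
  apply: eq_tsum => h2 y.
  pose F z h5 := \tsum_(g, v0 <- coact v) \tsum_(a, b <- dl (word w))
    act (h1 * g * z) a ⊗ (tin (act h2 v0) * tact h5 b).
  rewrite -(comulA (F := fun h3 h4 h5 => F (S h3 * h4) h5)); last first.
    by rewrite /F; tlin.
  transitivity (\tsum_(z, h5 <- Δ y) (ε z : k) *: F 1 h5).
    by apply: eq_tsum => z h5; rewrite (antipode_lE (G := F^~ h5))//; rewrite /F; linr.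
  rewrite counit_lE; last by rewrite /F; linr.
  by rewrite /F; do 2!apply: eq_tsum => ? ?; rewrite mulr1.
rewrite tsum_exch; apply: eq_tsum => g v0; rewrite tsum_exch; apply: eq_tsum => a b.
rewrite tact_cons (tsum_comp (F := ten (act h1 (act g a)))); last by linr.
by apply: eq_tsum => *; rewrite actM.
Qed.

Lemma dl_actE W (b : V -> T -> W) h t : bilin b ->
  \tsum_(x, y <- dl (tact h t)) b x y =
  \tsum_(h1, h2 <- Δ h) \tsum_(x, y <- dl t) b (act h1 x) (tact h2 y).
Proof.
move=> bb; rewrite dl_act tsum_tsum//; apply: eq_tsum => *; rewrite tsum_tsum//.
by apply: eq_tsum => *; rewrite tsum_ten.
Qed.

(** Colinearity of [dl] for the diagonal coaction on V ⊗ T(V). *)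
Lemma dl_coact t : \tsum_(h, t0 <- tcoact t) h ⊗ dl t0 =
  \tsum_(x, y <- dl t) \tsum_(g, x0 <- coact x) \tsum_(h, y0 <- tcoact y)
    (g * h) ⊗ (x0 ⊗ y0).
Proof.
move: t; apply: tensalg_eq; [linr|linr|elim=> [|v w ih]].
  rewrite word_nil tcoact1 tsum_ten; last by blin.
  by rewrite dl1 (linear_at0 ((ten_bilin _ _).2 _)) tsum0l//; blin.
rewrite word_cons tcoact_consE; last by blin.
rewrite dl_consE; last by blin.
transitivity (\tsum_(g, v0 <- coact v) \tsum_(h, y <- tcoact (word w))
   ((g * h) ⊗ (v0 ⊗ y) + \tsum_(g2, v1 <- coact v0) \tsum_(x, z <- dl y)
     (g * h) ⊗ (act g2 x ⊗ (tin v1 * z)))).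
  do 2!apply: eq_tsum => ? ?; rewrite dl_cons (linD ((ten_bilin _ _).2 _)).
  congr (_ + _).
  rewrite (tsum_comp _ _ ((ten_bilin _ _).2 _)); apply: eq_tsum => ? ?.
  by rewrite (tsum_comp _ _ ((ten_bilin _ _).2 _)).
under eq_tsum => g v0 do rewrite tsumD.
rewrite tsumD; congr (_ + _).
pose G g1 g2 v0 (z : (H ⊗ (V ⊗ T))%type) := \tsum_(h, u <- z) \tsum_(x, y <- u)
  (g1 * h) ⊗ (act g2 x ⊗ (tin v0 * y)).
have lG g1 g2 v0 : linear (G g1 g2 v0) by rewrite /G; linr.
have GE g1 g2 v0 h u : G g1 g2 v0 (h ⊗ u) =
    \tsum_(x, y <- u) (g1 * h) ⊗ (act g2 x ⊗ (tin v0 * y)).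
  by rewrite /G tsum_ten//; blin.
transitivity (\tsum_(g, v1 <- coact v) \tsum_(g2, v0 <- coact v1)
    G g g2 v0 (\tsum_(h, t0 <- tcoact (word w)) h ⊗ dl t0)).
  apply: eq_tsum => g v1; rewrite tsum_exch; apply: eq_tsum => g2 v0.
  by rewrite (tsum_comp _ _ (lG _ _ _)); apply: eq_tsum => h y; rewrite GE.
transitivity (\tsum_(g, v1 <- coact v) \tsum_(g2, v0 <- coact v1)
  \tsum_(x, y <- dl (word w)) \tsum_(c, x0 <- coact x) \tsum_(h, y0 <- tcoact y)
    (g * (c * h)) ⊗ (act g2 x0 ⊗ (tin v0 * y0))).
  apply: eq_tsum => g v1; apply: eq_tsum => g2 v0; rewrite ih.
  do 3!(rewrite (tsum_comp _ _ (lG _ _ _)); apply: eq_tsum => ? ?).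
  by rewrite GE tsum_ten//; blin.
rewrite -coactA; last by tlin.
pose K g v0 := \tsum_(x, y <- dl (word w)) \tsum_(g1, z <- Δ g) \tsum_(g2, g3 <- Δ z)
    \tsum_(c, x0 <- coact x) \tsum_(g4, v1 <- coact v0) \tsum_(h, y0 <- tcoact y)
     (g1 * c * (S g3 * g4) * h) ⊗ (act g2 x0 ⊗ (tin v1 * y0)).
transitivity (\tsum_(g, v0 <- coact v) K g v0); last first.
  apply: eq_tsum => g v0; apply: eq_tsum => x y; rewrite coact_actE; last by blin.
  do 3!apply: eq_tsum => ? ?; rewrite tcoact_consE; last by blin.
  by do 2!apply: eq_tsum => ? ?; rewrite !mulrA.
(* [L] is [K] with the coaction of v0 taken out; with that sum outermost, coassociativity brings g3
   and g4 together as two legs of one element and [S g3 * g4] cancels. *)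
pose L g g4 v1 := \tsum_(x, y <- dl (word w)) \tsum_(g1, z <- Δ g)
    \tsum_(g2, g3 <- Δ z) \tsum_(c, x0 <- coact x) \tsum_(h, y0 <- tcoact y)
     (g1 * c * (S g3 * g4) * h) ⊗ (act g2 x0 ⊗ (tin v1 * y0)).
transitivity (\tsum_(g, v0 <- coact v) \tsum_(g4, v1 <- coact v0) L g g4 v1); last first.
  apply: eq_tsum => g v0; rewrite /L /K.
  do 4!(rewrite tsum_exch; apply: eq_tsum => ? ?).
  by [].
rewrite -coactA; last by rewrite /L; tlin.
apply: eq_tsum => g v0.
rewrite /L [RHS]tsum_exch tsum_exch; apply: eq_tsum => x y.
rewrite (comulA (F := fun g1 z g4 => \tsum_(g2, g3 <- Δ z) \tsum_(c, x0 <- coact x)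
  \tsum_(h, y0 <- tcoact y)
     (g1 * c * (S g3 * g4) * h) ⊗ (act g2 x0 ⊗ (tin v0 * y0)))); last by tlin.
apply: eq_tsum => g1 u.
pose F g2 q := \tsum_(c, x0 <- coact x) \tsum_(h, y0 <- tcoact y)
     (g1 * c * q * h) ⊗ (act g2 x0 ⊗ (tin v0 * y0)).
rewrite (comulA (F := fun g2 g3 g4 => F g2 (S g3 * g4))); last by rewrite /F; tlin.
transitivity (F u 1).
  by rewrite /F; do 2!apply: eq_tsum => ? ?; rewrite mulr1 !mulrA.
rewrite -[LHS](counit_rE (G := F^~ 1)); last by rewrite /F; linr.
apply: eq_tsum => g2 z; rewrite (antipode_lE (G := F g2))//.
by rewrite /F; linr.
Qed.

Lemma dl_coactE W (b : H -> (V ⊗ T)%type -> W) t : bilin b ->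
  \tsum_(h, t0 <- tcoact t) b h (dl t0) =
  \tsum_(x, y <- dl t) \tsum_(g, x0 <- coact x) \tsum_(h, y0 <- tcoact y)
    b (g * h) (x0 ⊗ y0).
Proof.
move=> bb; transitivity (tsum (\tsum_(h, t0 <- tcoact t) h ⊗ dl t0) b).
  by rewrite tsum_tsum//; apply: eq_tsum => *; rewrite tsum_ten.
rewrite dl_coact; do 3!(rewrite tsum_tsum//; apply: eq_tsum => ? ?).
by rewrite tsum_ten.
Qed.

End SkewDerivation.
#[export] Hint Extern 0 => exact: dl_linear : lin.

(** * The Nichols ideal through iterated skew derivations *)

Section NicholsIdeal.
Variables (k : fieldType) (H : hopfAlgebra k) (V : ydModule H).
Local Notation Δ := (@comul k H).
Local Notation ε := (@counit k H).
Local Notation S := (@antipode k H).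
Local Notation T := (tensalg V).
Local Notation tε := (@tcounit k V).
Implicit Types (W : lmodType k) (h g : H) (v : V) (t u : T).

Lemma tcounit1 : tε (1 : T) = 1.
Proof.
by rewrite -word_nil /tcounit wlift_word//; apply: tcounit_multilin.
Qed.

Lemma tcounit_cons v t : tε (tin v * t) = 0.
Proof.
move: t; apply: tensalg_eq; [linr|linr|move=> w].
by rewrite -word_cons /tcounit wlift_word//; apply: tcounit_multilin.
Qed.

Lemma tcounitM (s t : T) : tε (s * t) = (tε s : k) * (tε t : k).
Proof.
move: s; apply: tensalg_eq; [linr| |case=> [|v w]].
- by move=> a x y; rewrite (tcounit_linear a x y) mulrDl -mulrA.
- by rewrite word_nil mul1r tcounit1 mul1r.
- by rewrite word_cons -mulrA !tcounit_cons mul0r.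
Qed.

Lemma tcounit_act h t : tε (tact h t) = (ε h : k) * (tε t : k).
Proof.
have le : linear tε by linr.
move: t; apply: tensalg_eq; [linr|exact: (@lin_scaler k T k^o tε (ε h))|case=> [|v w]].
- by rewrite word_nil tact1r (linZ le) tcounit1.
- rewrite word_cons tact_cons (tsum_comp _ _ le) tcounit_cons mulr0 tsum_eq0//.
  by move=> *; rewrite tcounit_cons.
Qed.

Lemma tcoact_counit1 t : \tsum_(h, t0 <- tcoact t) (tε t0 : k) *: h = (tε t : k) *: 1.
Proof.
move: t; apply: tensalg_eq; [linr|linr|case=> [|v w]].
- by rewrite word_nil tcoact1 tsum_ten ?tcounit1//; blin.
- rewrite word_cons tcoact_consE; last by blin.
  rewrite tcounit_cons scale0r tsum_eq0// => *; rewrite tsum_eq0// => *.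
  by rewrite tcounit_cons scale0r.
Qed.

Definition tdeg1 (t : T) : V := wlift (fun w => if w is [:: v] then v else 0) t.

Lemma tdeg1_multilin : multilin (fun w : seq V => if w is [:: v] then v else 0).
Proof.
move=> [|u [|u' p]] [|x q] a y z /=; rewrite ?scaler0 ?addr0//.
Qed.

Lemma tdeg1_linear : linear tdeg1.
Proof. exact/wlift_linear/tdeg1_multilin. Qed.
Hint Extern 0 => exact: tdeg1_linear : lin.

Lemma tdeg1_1 : tdeg1 1 = 0.
Proof. by rewrite -word_nil /tdeg1 wlift_word//; apply: tdeg1_multilin. Qed.

Lemma tdeg1_cons v t : tdeg1 (tin v * t) = (tε t : k) *: v.
Proof.
move: t; apply: tensalg_eq; [linr|linr|case=> [|u w]].
  rewrite -word_cons word_nil tcounit1 scale1r /tdeg1 wlift_word//.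
  exact: tdeg1_multilin.
rewrite word_cons tcounit_cons scale0r -!word_cons /tdeg1 wlift_word//.
exact: tdeg1_multilin.
Qed.

Lemma tdeg1_tin v : tdeg1 (tin v) = v.
Proof. by rewrite -[X in tdeg1 X]mulr1 tdeg1_cons tcounit1 scale1r. Qed.

Lemma tdeg1_act h t : tdeg1 (tact h t) = act h (tdeg1 t).
Proof.
have ld := tdeg1_linear.
move: t; apply: tensalg_eq; [linr|linr|case=> [|v w]].
  rewrite word_nil tact1r (linZ ld) tdeg1_1 scaler0 (linear_at0 _)//.
  exact: (act_bilin V).2.
rewrite word_cons tact_cons (tsum_comp _ _ ld) tdeg1_cons (linZ ((act_bilin V).2 h)).
rewrite -[in RHS](counit_rE (G := fun h => act h v)); last by linr.
rewrite -tsumZ; apply: eq_tsum => x y.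
by rewrite tdeg1_cons tcounit_act scalerA mulrC.
Qed.

Lemma tdeg1_ge2 t : degree_ge2 t -> tdeg1 t = 0.
Proof.
move: t; apply: lspan_sub; first exact: submod_preimage tdeg1_linear (submod0 _).
move=> _ [w + <-] /=; case: w => [|u [|u' w]]//= _.
by rewrite /tdeg1 wlift_word//; apply: tdeg1_multilin.
Qed.

Lemma degree_ge2P t : degree_ge2 (t - (tε t : k) *: 1 - tin (tdeg1 t)).
Proof.
pose e t := t - (tε t : k) *: 1 - tin (tdeg1 t).
have le : linear e.
  rewrite /e; have l2 : linear (fun t : T => (tε t : k) *: (1 : T)) by linr.
  have l3 : linear (fun t : T => tin (tdeg1 t)) by linr.
  exact: lin_add (lin_add (@lin_id _ _) (lin_opp l2)) (lin_opp l3).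
have se := submod_preimage le (submod_lspan [set word w | w in [set w | 1 < size w]%N]).
rewrite -/(e t); move: t; apply: word_ind => [|a w y ey]; first exact: se.1.
apply: se.2 => //; rewrite /preimage /= /e; case: w => [|v [|u w]].
- rewrite word_nil tcounit1 tdeg1_1 (linear_at0 (@tin_linear _ _)) scale1r subr0 subrr.
  exact: (submod_lspan _).1.
- rewrite word_cons word_nil tdeg1_cons tcounit_cons tcounit1 !scale1r scale0r.
  by rewrite subr0 mulr1 subrr; apply: (submod_lspan _).1.
- rewrite !word_cons tdeg1_cons !tcounit_cons !scale0r.
  rewrite (linear_at0 (@tin_linear _ _)) !subr0 -!word_cons.
  by apply: lspan_gen; exists [:: v, u & w].
Qed.

Lemma tcomul_tin_mulE v t : tcomul (tin v * t) = \tsum_(c, d <- tcomul t)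
  ((tin v * c) ⊗ d + \tsum_(g, v0 <- coact v) tact g c ⊗ (tin v0 * d)).
Proof.
have -> : tcomul (tin v * t) = bmul (tin v ⊗ 1 + 1 ⊗ tin v) (tcomul t).
  move: t; apply: tensalg_eq; [linr|linr|move=> w].
  by rewrite -word_cons tcomul_word.
rewrite /bmul tsumDl; last by blin.
rewrite !tsum_ten; try by blin.
rewrite -tsumD; apply: eq_tsum => c d; congr (_ + _).
  rewrite tcoact1 tsum_ten; last by blin.
  by rewrite tact_unit mul1r.
rewrite tcoact_tinE; last by blin.
by apply: eq_tsum => g v0; rewrite mul1r.
Qed.

Lemma tcomul_tin_mul W (b : T -> T -> W) v t : bilin b ->
  \tsum_(x, y <- tcomul (tin v * t)) b x y = \tsum_(c, d <- tcomul t)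
  (b (tin v * c) d + \tsum_(g, v0 <- coact v) b (tact g c) (tin v0 * d)).
Proof.
move=> bb; rewrite tcomul_tin_mulE tsum_tsum//; apply: eq_tsum => c d.
rewrite tsumDl// tsum_ten// tsum_tsum//; congr (_ + _).
by apply: eq_tsum => *; rewrite tsum_ten.
Qed.

Lemma tcomul1 : tcomul (1 : T) = 1 ⊗ 1.
Proof.
by rewrite -word_nil /tcomul wlift_word//; apply: comul_word_multilin.
Qed.

Lemma tcomul_counit_l t : \tsum_(c, d <- tcomul t) (tε c : k) *: d = t.
Proof.
move: t; apply: tensalg_eq; [linr|exact: lin_id|elim=> [|v w ih]].
  rewrite word_nil tcomul1 tsum_ten; last by blin.
  by rewrite tcounit1 scale1r.
rewrite word_cons tcomul_tin_mul; last by blin.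
transitivity (\tsum_(c, d <- tcomul (word w)) (tε c : k) *: (tin v * d)).
  apply: eq_tsum => c d; rewrite tcounit_cons scale0r add0r.
  rewrite -[RHS](coact_counitE (G := fun v => (tε c : k) *: (tin v * d))); last by linr.
  by apply: eq_tsum => g v0; rewrite tcounit_act scalerA.
rewrite -[in RHS]ih (tsum_comp (F := GRing.mul (tin v))); last by linr.
by apply: eq_tsum => c d; rewrite scalerAr.
Qed.

(** This ties the recursively defined [dl] to the coproduct, hence to the coideals that define the
    Nichols algebra. *)
Lemma tcomul_dl t : \tsum_(c, d <- tcomul t) tdeg1 c ⊗ d = dl t.
Proof.
move: t; apply: tensalg_eq; [linr|linr|elim=> [|v w ih]].
  rewrite word_nil tcomul1 dl1 tsum_ten; last by blin.
  by rewrite tdeg1_1 (linear_at0 ((ten_bilin _ _).1 _)).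
rewrite word_cons tcomul_tin_mul; last by blin.
rewrite dl_cons tsumD; congr (_ + _).
  rewrite -[in RHS](tcomul_counit_l (word w)) (tsum_comp (F := ten v)); last by linr.
  apply: eq_tsum => c d; rewrite tdeg1_cons (linZ ((ten_bilin _ _).1 _)).
  by rewrite (linZ ((ten_bilin _ _).2 _)).
rewrite tsum_exch; apply: eq_tsum => g v0; rewrite -ih tsum_tsum; last by blin.
apply: eq_tsum => c d; rewrite tsum_ten; last by blin.
by rewrite tdeg1_act.
Qed.

(** The part of coassociativity whose first tensor factor lies in V. Contracted with a form on V it
    yields [tcomul_dd], and then [dds_cat] by iteration. *)
Lemma dl_tcomul t :
  \tsum_(c, d <- tcomul t) \tsum_(x, y <- dl c) x ⊗ (y ⊗ d) =
  \tsum_(x, y <- dl t) x ⊗ tcomul y.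
Proof.
have tE (z : T) : tcomul z = \tsum_(a, b <- tcomul z) a ⊗ b by rewrite tsum_id.
move: t; apply: tensalg_eq; [linr|linr|elim=> [|v w ih]].
  rewrite word_nil tcomul1 dl1 tsum0l; last by blin.
  rewrite tsum_ten; last by blin.
  by rewrite dl1 tsum0l; last by blin.
rewrite word_cons tcomul_tin_mul; last by blin.
rewrite dl_consE; last by blin.
transitivity (\tsum_(c, d <- tcomul (word w)) (v ⊗ (c ⊗ d) +
  (\tsum_(g, v0 <- coact v) \tsum_(x, y <- dl c) act g x ⊗ ((tin v0 * y) ⊗ d) +
   \tsum_(g, v0 <- coact v) \tsum_(g1, g2 <- Δ g) \tsum_(x, y <- dl c)
      act g1 x ⊗ (tact g2 y ⊗ (tin v0 * d))))).
  apply: eq_tsum => c d; rewrite dl_consE; last by blin.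
  rewrite addrA; congr (_ + _); apply: eq_tsum => g v0.
  by rewrite dl_actE; last by blin.
rewrite tsumD; congr (_ + _).
  by rewrite [in RHS]tE (tsum_comp (F := ten v)); last by linr.
transitivity (\tsum_(g, v0 <- coact v) \tsum_(x, y <- dl (word w))
   (act g x ⊗ (\tsum_(c, d <- tcomul y) ((tin v0 * c) ⊗ d)) +
     \tsum_(g1, g2 <- Δ g) act g1 x ⊗
       (\tsum_(c, d <- tcomul y) (tact g2 c ⊗ (tin v0 * d))))).
  rewrite tsumD.
  under [RHS]eq_tsum => g v0 do rewrite tsumD.
  rewrite [RHS]tsumD; congr (_ + _).
    rewrite [LHS]tsum_exch; apply: eq_tsum => g v0.
    pose G (z : (V ⊗ (T ⊗ T))%type) := \tsum_(x, u <- z) \tsum_(c, d <- u)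
       act g x ⊗ ((tin v0 * c) ⊗ d).
    have lG : linear G by rewrite /G; linr.
    have := ih => /(congr1 G); rewrite !(tsum_comp _ _ lG) => e.
    transitivity (\tsum_(x, y <- tcomul (word w)) G (\tsum_(x0, y0 <- dl x) x0 ⊗ (y0 ⊗ y))).
      apply: eq_tsum => c d; rewrite (tsum_comp _ _ lG); apply: eq_tsum => x y.
      by rewrite /G !tsum_ten//; blin.
    rewrite e; apply: eq_tsum => x y; rewrite /G tsum_ten; last by blin.
    by rewrite (tsum_comp (F := ten (act g x))); last by linr.
  rewrite [LHS]tsum_exch; apply: eq_tsum => g v0.
  rewrite [LHS]tsum_exch [RHS]tsum_exch; apply: eq_tsum => g1 g2.
  pose G (z : (V ⊗ (T ⊗ T))%type) := \tsum_(x, u <- z) \tsum_(c, d <- u)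
     act g1 x ⊗ (tact g2 c ⊗ (tin v0 * d)).
  have lG : linear G by rewrite /G; linr.
  have := ih => /(congr1 G); rewrite !(tsum_comp _ _ lG) => e.
  transitivity (\tsum_(x, y <- tcomul (word w)) G (\tsum_(x0, y0 <- dl x) x0 ⊗ (y0 ⊗ y))).
    apply: eq_tsum => c d; rewrite (tsum_comp _ _ lG); apply: eq_tsum => x y.
    by rewrite /G !tsum_ten//; blin.
  rewrite e; apply: eq_tsum => x y; rewrite /G tsum_ten; last by blin.
  by rewrite (tsum_comp (F := ten (act g1 x))); last by linr.
transitivity (\tsum_(g, v0 <- coact v) (\tsum_(x, y <- dl (word w))
   (act g x ⊗ (\tsum_(c, d <- tcomul y) ((tin v0 * c) ⊗ d))) +
    \tsum_(g2, v1 <- coact v0) \tsum_(x, y <- dl (word w)) act g x ⊗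
       (\tsum_(c, d <- tcomul y) (tact g2 c ⊗ (tin v1 * d))))).
  under eq_tsum => g v0 do rewrite tsumD.
  rewrite !tsumD; congr (_ + _).
  under eq_tsum => g v0 do rewrite tsum_exch.
  by rewrite coactA; last by tlin.
apply: eq_tsum => g v0; rewrite [X in _ + X]tsum_exch -tsumD; apply: eq_tsum => x y.
have lt : linear (ten (V := (T ⊗ T)%type) (act g x)) by linr.
rewrite -(tsum_comp _ _ lt) -(linD lt) tcomul_tin_mulE tsumD; congr (_ ⊗ (_ + _)).
by rewrite tsum_exch.
Qed.

Definition dd (psi : V -> k^o) (t : T) : T := \tsum_(x, y <- dl t) (psi x : k) *: y.

Lemma dd_linear psi : linear psi -> linear (dd psi).
Proof. by rewrite /dd; linr. Qed.

Lemma tcomul_dd psi t : linear psi ->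
  tcomul (dd psi t) = \tsum_(c, d <- tcomul t) dd psi c ⊗ d.
Proof.
move=> lpsi; pose G (z : (V ⊗ (T ⊗ T))%type) := \tsum_(x, u <- z) (psi x : k) *: u.
have bG : bilin (fun (x : V) (u : (T ⊗ T)%type) => (psi x : k) *: u) by blin.
have lG : linear G by rewrite /G; linr.
have := dl_tcomul t => /(congr1 G); rewrite !(tsum_comp _ _ lG) => e.
transitivity (\tsum_(x, y <- dl t) G (x ⊗ tcomul y)).
  rewrite /dd (tsum_comp _ _ (@tcomul_linear _ _ V)); apply: eq_tsum => x y.
  by rewrite /G tsum_ten// (linZ (@tcomul_linear _ _ V)).
rewrite -e; apply: eq_tsum => c d.
rewrite (tsum_comp _ _ lG) /dd (tsum_comp (F := fun y => y ⊗ d)); last by linr.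
by apply: eq_tsum => x y; rewrite /G tsum_ten// (linZ ((ten_bilin _ _).1 _)).
Qed.

Lemma dl_counit t : \tsum_(x, y <- dl t) (tε y : k) *: x = tdeg1 t.
Proof.
move: t; apply: tensalg_eq; [linr|linr|case=> [|v w]].
  by rewrite word_nil dl1 tdeg1_1 tsum0l//; blin.
rewrite word_cons tdeg1_cons dl_consE; last by blin.
rewrite tsum_eq0 ?addr0// => *; rewrite tsum_eq0// => *.
by rewrite tcounit_cons scale0r.
Qed.

(** A word of forms on V acting as a form on T(V). By [dds_cat] concatenation of words corresponds
    to convolution of forms. *)
Definition dds (s : seq {linear V -> k^o}) (t : T) : k^o :=
  tε (foldl (fun t (psi : {linear V -> k^o}) => dd psi t) t s).

Lemma dds_linear s : linear (dds s).
Proof.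
rewrite /dds; elim: s => [|psi s ih] /=; first by linr.
by apply: (lin_comp ih); apply: dd_linear; linr.
Qed.
Hint Extern 0 => exact: dds_linear : lin.

Lemma dds_cat s1 s2 t :
  dds (s1 ++ s2) t = \tsum_(c, d <- tcomul t) ((dds s1 c : k) * (dds s2 d : k) : k^o).
Proof.
elim: s1 t => [|psi s1 ih] t.
  rewrite -[in LHS](tcomul_counit_l t) (tsum_comp _ _ (dds_linear s2)).
  by apply: eq_tsum => x y; rewrite (linZ (dds_linear s2)).
rewrite -[LHS]/(dds (s1 ++ s2) (dd psi t)) ih tcomul_dd; last by linr.
have b : bilin (fun c d => ((dds s1 c : k) *: dds s2 d)) by blin.
by rewrite (tsum_tsum _ _ b); apply: eq_tsum => c d; rewrite (tsum_ten _ _ b).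
Qed.

(** Contracting the left factor of I ⊗ T(V) + T(V) ⊗ I with psi composed with [tdeg1] lands in I,
    since [tdeg1] vanishes on I, which sits in degrees at least 2. *)
Lemma nichols_ideal_dd psi t : linear psi -> nichols_ideal t -> nichols_ideal (dd psi t).
Proof.
move=> lpsi It; have sI := nichols_ideal_submod V.
have b : bilin (fun c d : T => (psi (tdeg1 c) : k) *: d) by blin.
have -> : dd psi t = \tsum_(c, d <- tcomul t) (psi (tdeg1 c) : k) *: d.
  rewrite /dd -tcomul_dl tsum_tsum; last by blin.
  by apply: eq_tsum => c d; rewrite tsum_ten; last by blin.
have [_ _ /(_ t It)] := nichols_ideal_coideal V.
pose F (z : (T ⊗ T)%type) : T := \tsum_(c, d <- z) (psi (tdeg1 c) : k) *: d.
rewrite -[X in _ -> nichols_ideal X]/(F (tcomul t)).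
move: (tcomul t); apply: (lspan_sub (B := F @^-1` @nichols_ideal _ _ V)).
  exact: submod_preimage (tsum_linear b) sI.
move=> _ [x [y [-> xy]]]; rewrite /preimage /= /F tsum_ten//.
case: xy => [/nichols_ideal_sub/tdeg1_ge2 ->|Iy]; last exact: submodZ.
by rewrite (linear_at0 lpsi) scale0r; case: sI.
Qed.

(* Since dds (s1 ++ s2) is the convolution of dds s1 and dds s2, the common   *)
(* kernel of all the dds s is a coideal.                                      *)
Lemma nichols_idealP t : nichols_ideal t <-> forall s, dds s t = 0.
Proof.
split=> [It s|It].
  rewrite /dds; elim: s t It => [|psi s ih] t It /=.
    by have [_ + _] := nichols_ideal_coideal V; apply.
  by apply: ih; apply: nichols_ideal_dd => //; linr.
pose J := [set t : T | forall s, dds s t = 0].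
have sJ : submod J.
  split=> [s|a x y Jx Jy s]; first by rewrite (linear_at0 (dds_linear s)).
  by rewrite dds_linear Jx Jy scaler0 addr0.
suff : J `<=` @nichols_ideal _ _ V by apply.
apply: nichols_ideal_largest => [|u Ju].
  split=> // [x /(_ [::])//|x Jx].
  (* With e of kernel J, it suffices that e ⊗ e kills the coproduct of x. The left factor is
     contracted with an arbitrary form and the right one with [dds s2]; [dds_cat] then applies. *)
  have [e [le Je eJ]] := projector sJ.
  have ee : \tsum_(c, d <- tcomul x) e c ⊗ e d = 0.
    apply: tensor_sep => phi lphi.
    rewrite tsum_tsum; last by blin.
    under eq_tsum => c d do (rewrite tsum_ten; last by blin).
    under eq_tsum => c d do rewrite -(linZ le).
    rewrite -(tsum_comp _ _ le); apply/Je => s2.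
    rewrite (tsum_comp _ _ (dds_linear s2)).
    pose f c := phi (e c); have lf : linear f by rewrite /f; linr.
    transitivity (f (\tsum_(c, d <- tcomul x) (dds s2 d : k) *: c)).
      rewrite (tsum_comp _ _ lf); apply: eq_tsum => c d.
      by rewrite (linZ (dds_linear s2)) (linZ lf) /GRing.scale /= mulrC.
    suff /Je ee : J (\tsum_(c, d <- tcomul x) (dds s2 d : k) *: c).
      by rewrite /f ee; apply: linear_at0 lphi.
    move=> s1; rewrite (tsum_comp _ _ (dds_linear s1)) -[RHS](Jx (s1 ++ s2)) dds_cat.
    by apply: eq_tsum => c d; rewrite (linZ (dds_linear s1)) /GRing.scale /= mulrC.
  have sC := submod_lspan [set z | exists x y : T, z = x ⊗ y /\ (J x \/ J y)].
  (* Here c ⊗ d = (c - e c) ⊗ d + e c ⊗ (d - e d) + e c ⊗ e d, and the last terms add up to 0 by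
     [ee]. *)
  have -> : tcomul x = \tsum_(c, d <- tcomul x) (c - e c) ⊗ d +
      \tsum_(c, d <- tcomul x) e c ⊗ (d - e d).
    rewrite -[RHS]addr0 -ee -!tsumD -[LHS]tsum_id; apply: eq_tsum => c d.
    rewrite -addrA -(linD ((ten_bilin _ _).2 _)) subrK.
    by rewrite -(linD ((ten_bilin _ _).1 _)) subrK.
  apply: (submodD sC); apply: (tsum_in_sub _ sC) => c d; apply: lspan_gen.
    by exists (c - e c), d; split=> //; left.
  by exists (e c), (d - e d); split=> //; right.
(* J lies in degrees at least 2: the empty word gives the counit, and words of length one test the
   component of degree one. *)
have := degree_ge2P u; have -> : tε u = 0 by exact: (Ju [::]).
suff -> : tdeg1 u = 0 by rewrite scale0r (linear_at0 (@tin_linear _ _)) !subr0.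
apply: functional_sep => phi lphi; have [F ->] := linear_pack lphi.
rewrite -[RHS](Ju [:: F]) -dl_counit (tsum_comp (F := F)); last by linr.
rewrite /dds /= /dd (tsum_comp _ _ (@tcounit_linear _ V)).
apply: eq_tsum => x y; rewrite (linZ (@tcounit_linear _ V)) (linZ (f := F)); last by linr.
by rewrite /GRing.scale /= mulrC.
Qed.

(** Coinduction for membership in the ideal: a set without constant terms whose derivatives stay in
    its span. That the ideal is two-sided and stable under action and coaction is shown by applying
    it to the set of the elements in question, because the Leibniz rules only produce sums of such
    elements. *)
Lemma nichols_ideal_coind (J : set T) :
  (forall t, J t -> tε t = 0) ->
  (forall psi t, linear psi -> J t -> lspan J (dd psi t)) ->
  lspan J `<=` @nichols_ideal _ _ V.
Proof.
move=> Jε Jd.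
have {}Jε : forall t, lspan J t -> tε t = 0.
  by apply: lspan_sub; first exact: submod_preimage (@tcounit_linear _ V) (submod0 _).
have {}Jd psi t : linear psi -> lspan J t -> lspan J (dd psi t).
  move=> lp; move: t; apply: lspan_sub => [|t Jt]; last exact: Jd.
  exact: submod_preimage (dd_linear lp) (submod_lspan J).
move=> t Jt; apply/nichols_idealP => s; elim: s t Jt => [|psi s ih] t Jt.
  exact: Jε.
by apply: ih; apply: Jd => //; linr.
Qed.

Lemma nichols_ideal_counit t : nichols_ideal t -> tε t = 0.
Proof. by have [_ + _] := nichols_ideal_coideal V; apply. Qed.

Lemma nichols_ideal_dl t : nichols_ideal t -> tens_in (@nichols_ideal _ _ V) (dl t).
Proof.
move=> It; apply/tens_inP => [|phi lphi]; first exact: nichols_ideal_submod.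
exact: nichols_ideal_dd.
Qed.

Lemma dd_intro t : tε t = 0 -> (forall psi, linear psi -> nichols_ideal (dd psi t)) ->
  nichols_ideal t.
Proof.
move=> t0 td; apply/nichols_idealP; case=> [|psi s]; first exact: t0.
by have /nichols_idealP/(_ s) := td psi (lin_pack psi).
Qed.

Lemma nichols_ideal_act h t : nichols_ideal t -> nichols_ideal (tact h t).
Proof.
move=> It; apply: (nichols_ideal_coind
  (J := [set t | exists h b, nichols_ideal b /\ t = tact h b])).
- by move=> _ [h' [b [Ib ->]]]; rewrite tcounit_act nichols_ideal_counit// mulr0.
- move=> psi _ lp [h' [b [Ib ->]]]; rewrite /dd dl_actE; last by blin.
  apply: tsum_in_sub => [|h1 h2]; first exact: submod_lspan.
  apply: lspan_gen; pose p x := psi (act h1 x).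
  have lp' : linear p by rewrite /p; linr.
  exists h2, (dd p b); split; first exact: nichols_ideal_dd.
  rewrite /dd (tsum_comp _ _ ((tact_bilin V).2 h2)); apply: eq_tsum => x y.
  by rewrite (linZ ((tact_bilin V).2 h2)).
- by apply: lspan_gen; exists h, t.
Qed.

Lemma nichols_ideal_coact t : nichols_ideal t -> tens_in (@nichols_ideal _ _ V) (tcoact t).
Proof.
move=> It; apply/tens_inP => [|phi lphi]; first exact: nichols_ideal_submod.
(* J consists of the contracted coactions of elements of the ideal. By [dl_coactE] a derivative of
   one is a combination of others, with phi replaced by the forms phi(g _). *)
apply: (nichols_ideal_coind (J := [set t | exists (phi : H -> k^o) b,
  [/\ linear phi, nichols_ideal b & t = \tsum_(h, b0 <- tcoact b) (phi h : k) *: b0]])).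
- move=> _ [p [b [lp Ib ->]]]; rewrite (tsum_comp _ _ (@tcounit_linear _ V)).
  have := tcoact_counit1 b => /(congr1 p).
  rewrite (tsum_comp _ _ lp) nichols_ideal_counit// scale0r (linear_at0 lp) => <-.
  apply: eq_tsum => x y; rewrite (linZ lp) (linZ (@tcounit_linear _ V)).
  by rewrite /GRing.scale /= mulrC.
- move=> psi _ lp [p [b [lp' Ib ->]]]; rewrite (tsum_comp _ _ (dd_linear lp)).
  pose G (h : H) (z : (V ⊗ T)%type) := (p h : k) *: \tsum_(x, y <- z) (psi x : k) *: y.
  have bG : bilin G by rewrite /G; blin.
  have -> : \tsum_(h, b0 <- tcoact b) dd psi ((p h : k) *: b0) =
      \tsum_(h, b0 <- tcoact b) G h (dl b0).
    by apply: eq_tsum => x y; rewrite (linZ (dd_linear lp)).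
  rewrite dl_coactE//.
  apply: (tsum_in (submod_lspan _) _ (nichols_ideal_dl Ib)); first by rewrite /G; blin.
  move=> x y Iy; apply: tsum_in_sub => [|g x0]; first exact: submod_lspan.
  pose q h := p (g * h); have lq : linear q by rewrite /q; linr.
  have -> : \tsum_(h, y0 <- tcoact y) G (g * h) (x0 ⊗ y0) =
      (psi x0 : k) *: \tsum_(h, y0 <- tcoact y) (q h : k) *: y0.
    rewrite -tsumZ; apply: eq_tsum => h y0; rewrite /G tsum_ten; last by blin.
    by rewrite !scalerA mulrC.
  apply: (submodZ (submod_lspan _)).
  by apply: lspan_gen; exists q, y.
- by apply: lspan_gen; exists phi, t.
Qed.

Lemma nichols_ideal_tinl v t : nichols_ideal t -> nichols_ideal (tin v * t).
Proof.
move=> It; apply: (nichols_ideal_coind (J := [set t | nichols_ideal t \/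
  exists v b, nichols_ideal b /\ t = tin v * b])).
- move=> _ [/nichols_ideal_counit//|[u [b [_ ->]]]]; exact: tcounit_cons.
- move=> psi b lp [Ib|[u [c [Ic ->]]]].
    by apply: lspan_gen; left; apply: nichols_ideal_dd.
  rewrite /dd dl_consE; last by blin.
  apply: (submodD (submod_lspan _)).
    by apply: (submodZ (submod_lspan _)); apply: lspan_gen; left.
  apply: tsum_in_sub => [|g u0]; first exact: submod_lspan.
  pose q x := psi (act g x); have lq : linear q by rewrite /q; linr.
  apply: lspan_gen; right; exists u0, (dd q c); split; first exact: nichols_ideal_dd.
  rewrite /dd (tsum_comp (F := GRing.mul (tin u0))); last by linr.
  by apply: eq_tsum => x y; rewrite scalerAr.
- by apply: lspan_gen; right; exists v, t.
Qed.

Lemma nichols_ideal_tinr v t : nichols_ideal t -> nichols_ideal (t * tin v).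
Proof.
move=> It; apply: (nichols_ideal_coind (J := [set t | nichols_ideal t \/
  exists v b, nichols_ideal b /\ t = b * tin v])).
- move=> _ [/nichols_ideal_counit//|[u [b [/nichols_ideal_counit b0 ->]]]].
  by rewrite tcounitM b0 mul0r.
- move=> psi b lp [Ib|[u [c [Ic ->]]]].
    by apply: lspan_gen; left; apply: nichols_ideal_dd.
  rewrite /dd dlME; last by blin.
  apply: (submodD (submod_lspan _)).
    apply: lspan_gen; right; exists u, (dd psi c); split; first exact: nichols_ideal_dd.
    rewrite /dd (tsum_comp (F := fun z => z * tin u)); last by linr.
    by apply: eq_tsum => x y; rewrite scalerAl.
  apply: (tsum_in (submod_lspan _) _ (nichols_ideal_coact Ic)); first by blin.
  move=> h x Ix; apply: (submodZ (submod_lspan _)).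
  by apply: lspan_gen; left.
- by apply: lspan_gen; right; exists v, t.
Qed.

Lemma nichols_ideal_mull t u : nichols_ideal u -> nichols_ideal (t * u).
Proof.
move=> Iu; have sI := nichols_ideal_submod V; move: t; apply: word_ind => [|a w y Iy].
  by rewrite mul0r; case: sI.
rewrite mulrDl -scalerAl; apply: sI.2 => //.
elim: w => [|v w ih]; first by rewrite word_nil mul1r.
by rewrite word_cons -mulrA; apply: nichols_ideal_tinl.
Qed.

Lemma nichols_ideal_mulr t u : nichols_ideal t -> nichols_ideal (t * u).
Proof.
move=> It; have sI := nichols_ideal_submod V; move: u; apply: word_ind => [|a w y Iy].
  by rewrite mulr0; case: sI.
rewrite mulrDr -scalerAr; apply: sI.2 => // {y Iy}.
elim: w t It => [|v w ih] t It; first by rewrite word_nil mulr1.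
by rewrite word_cons mulrA; apply/ih/nichols_ideal_tinr.
Qed.

End NicholsIdeal.
#[export] Hint Extern 0 => exact: tdeg1_linear : lin.
#[export] Hint Extern 0 => exact: dds_linear : lin.

(** * The Nichols algebra as a Yetter-Drinfeld module; its skew derivations and adjoint action *)

Section NicholsYD.
Variables (k : fieldType) (H : hopfAlgebra k) (V : ydModule H).
Local Notation Δ := (@comul k H).
Local Notation ε := (@counit k H).
Local Notation S := (@antipode k H).
Local Notation T := (tensalg V).
Local Notation B := (nichols V).
Local Notation I := (@nichols_ideal _ _ V).
Local Notation π := (@nproj _ _ V).
Implicit Types (W : lmodType k) (h g : H) (v : V).

Lemma nproj_linear : linear π.
Proof. by move=> a x y; rewrite nprojD -nscaleE. Qed.
Hint Extern 0 => exact: nproj_linear : lin.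

Lemma nproj_eq0 t : π t = 0 <-> I t.
Proof. by rewrite -(linear_at0 nproj_linear) nproj_eq subr0. Qed.

Lemma nproj_ind (P : B -> Prop) : (forall t, P (π t)) -> forall y, P y.
Proof. by move=> Pt y; rewrite -[y]nprojK. Qed.

Lemma repr_nproj t : I (repr (π t) - t).
Proof. by apply/nproj_eq; rewrite nprojK. Qed.

(** The operations on [nichols] are computed on chosen representatives; this removes the choice for
    any map that vanishes on the ideal. *)
Lemma nproj_factor W (f : T -> W) t :
  linear f -> (forall t, I t -> f t = 0) -> f (repr (π t)) = f t.
Proof. by move=> lf f0; apply/eqP; rewrite -subr_eq0 -linB// f0//; apply: repr_nproj. Qed.

Lemma nmulE s t : nmul (π s) (π t) = π (s * t).
Proof.
rewrite /nmul (nproj_factor (f := fun z => π (repr (π s) * z))).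
- rewrite (nproj_factor (f := fun z => π (z * t)))//; first by linr.
  by move=> u Iu; apply/nproj_eq0/nichols_ideal_mulr.
- by linr.
- by move=> u Iu; apply/nproj_eq0/nichols_ideal_mull.
Qed.

Lemma nactE h t : nact h (π t) = π (tact h t).
Proof.
rewrite /nact (nproj_factor (f := fun z => π (tact h z)))//; first by linr.
by move=> u Iu; apply/nproj_eq0/nichols_ideal_act.
Qed.

Lemma ncoactE t : ncoact (π t) = \tsum_(h, t0 <- tcoact t) h ⊗ π t0.
Proof.
rewrite /ncoact (nproj_factor (f := fun z => \tsum_(h, t0 <- tcoact z) h ⊗ π t0))//.
  by linr.
move=> u Iu; apply: (tsum_in (submod0 _) _ (nichols_ideal_coact Iu)); first by blin.
by move=> h x /nproj_eq0 ->; apply: linear_at0 ((ten_bilin _ _).2 h).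
Qed.

Lemma ncoact_projE W (b : H -> B -> W) t : bilin b ->
  \tsum_(h, y <- ncoact (π t)) b h y = \tsum_(h, t0 <- tcoact t) b h (π t0).
Proof.
by move=> bb; rewrite ncoactE tsum_tsum//; apply: eq_tsum => *; rewrite tsum_ten.
Qed.

Lemma nact_bilin : bilin (@nact _ _ V).
Proof.
split=> [y|h] a; first move=> g h.
  by rewrite -[y]nprojK !nactE (tact_bilin V).1 nproj_linear.
by move=> y z; rewrite -[y]nprojK -[z]nprojK -nproj_linear !nactE (tact_bilin V).2 nproj_linear.
Qed.

Lemma ncoact_linear : linear (@ncoact _ _ V).
Proof.
move=> a y z; rewrite -[y]nprojK -[z]nprojK -nproj_linear !ncoactE.
have l : linear (fun t => \tsum_(h, t0 <- tcoact t) h ⊗ π t0) by linr.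
by rewrite l.
Qed.

Hint Extern 0 => exact: ncoact_linear : lin.

Lemma nmul_bilin : bilin (@nmul _ _ V).
Proof.
split=> [z|z] a x y; rewrite -[x]nprojK -[y]nprojK -[z]nprojK -nproj_linear !nmulE.
  by rewrite mulrDl -scalerAl nproj_linear.
by rewrite mulrDr -scalerAr nproj_linear.
Qed.
Hint Resolve nmul_bilin nact_bilin : lin.

Definition ncoactL : {linear B -> (H ⊗ B)%type} :=
  HB.pack (@ncoact _ _ V) (GRing.isLinear.Build k B (H ⊗ B)%type *:%R _ ncoact_linear).

Lemma nact1 (y : B) : nact 1 y = y.
Proof. by elim/nproj_ind: y => t; rewrite nactE tact_unit. Qed.

Lemma nactM g h (y : B) : nact (g * h) y = nact g (nact h y).
Proof. by elim/nproj_ind: y => t; rewrite !nactE tact_mul. Qed.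

Lemma ncoact_assoc (y : B) :
  \tsum_(h, v0 <- ncoactL y) \tsum_(h1, h2 <- Δ h) h1 ⊗ (h2 ⊗ v0) =
  \tsum_(h, v0 <- ncoactL y) h ⊗ ncoactL v0.
Proof.
elim/nproj_ind: y => t.
rewrite !ncoact_projE; try by blin.
pose G (z : (H ⊗ (H ⊗ T))%type) := \tsum_(a, u <- z) \tsum_(b, c <- u) a ⊗ (b ⊗ π c).
have lG : linear G by rewrite /G; linr.
have := tcoact_assoc t => /(congr1 G); rewrite !(tsum_comp _ _ lG) => e.
transitivity (\tsum_(h, t0 <- tcoact t) G (\tsum_(h1, h2 <- Δ h) h1 ⊗ (h2 ⊗ t0))).
  apply: eq_tsum => h t0; rewrite (tsum_comp _ _ lG); apply: eq_tsum => h1 h2.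
  by rewrite /G !tsum_ten//; blin.
rewrite e; apply: eq_tsum => h t0; rewrite /G tsum_ten; last by blin.
by rewrite /= ncoactE (tsum_comp (F := ten h)); last by linr.
Qed.

Lemma ncoact_counit (y : B) : \tsum_(h, v0 <- ncoactL y) (ε h : k) *: v0 = y.
Proof.
elim/nproj_ind: y => t; rewrite ncoact_projE; last by blin.
rewrite -[in RHS](tcoact_counit t) (tsum_comp _ _ nproj_linear).
by apply: eq_tsum => *; rewrite (linZ nproj_linear).
Qed.

Lemma ncoact_compat h (y : B) : ncoactL (nact h y) =
  \tsum_(h1, h23 <- Δ h) \tsum_(h2, h3 <- Δ h23) \tsum_(g, y0 <- ncoactL y)
    (h1 * g * S h3) ⊗ nact h2 y0.
Proof.
elim/nproj_ind: y => t; rewrite /= nactE ncoactE tcoact_compat tsum_tsum; last by blin.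
apply: eq_tsum => h1 h23; rewrite tsum_tsum; last by blin.
apply: eq_tsum => h2 h3; rewrite tsum_tsum; last by blin.
rewrite ncoact_projE; last by blin.
by apply: eq_tsum => g t0; rewrite tsum_ten ?nactE//; blin.
Qed.

Definition nyd : ydModule H := YDModule nact_bilin nact1 nactM
  ncoact_assoc ncoact_counit ncoact_compat.

Lemma nmul_act h (y z : B) :
  nact h (nmul y z) = \tsum_(h1, h2 <- Δ h) nmul (nact h1 y) (nact h2 z).
Proof.
elim/nproj_ind: y => s; elim/nproj_ind: z => t.
rewrite nmulE nactE tactM (tsum_comp _ _ nproj_linear).
by apply: eq_tsum => h1 h2; rewrite !nactE nmulE.
Qed.

Lemma nmul_coactE W (b : H -> B -> W) (y z : B) : bilin b ->
  \tsum_(h, x <- ncoact (nmul y z)) b h x =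
  \tsum_(g, y0 <- ncoact y) \tsum_(h, z0 <- ncoact z) b (g * h) (nmul y0 z0).
Proof.
move=> bb; elim/nproj_ind: y => s; elim/nproj_ind: z => t.
rewrite nmulE ncoact_projE// tcoactME; last by blin.
rewrite ncoact_projE; last by blin.
apply: eq_tsum => g s0; rewrite ncoact_projE; last by blin.
by apply: eq_tsum => *; rewrite nmulE.
Qed.

Lemma nin_linear : linear (@nin _ _ V).
Proof. by rewrite /nin; linr. Qed.
Hint Extern 0 => exact: nin_linear : lin.

Lemma nin_inj : injective (@nin _ _ V).
Proof.
move=> u v /nproj_eq; rewrite -(linB (@tin_linear _ _)) => /nichols_ideal_sub/tdeg1_ge2.
by rewrite tdeg1_tin => /eqP; rewrite subr_eq0 => /eqP.
Qed.

Lemma nact_nin h v : nact h (nin v) = nin (act h v).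
Proof. by rewrite /nin nactE tact_tin. Qed.

Lemma ncoact_ninE W (b : H -> B -> W) v : bilin b ->
  \tsum_(h, y <- ncoact (nin v)) b h y = \tsum_(h, v0 <- coact v) b h (nin v0).
Proof. by move=> bb; rewrite ncoact_projE// tcoact_tinE; last by blin. Qed.

Definition n1 : B := π 1.

Lemma nmul1r (y : B) : nmul y n1 = y.
Proof. by elim/nproj_ind: y => t; rewrite /n1 nmulE mulr1. Qed.

Lemma nact_n1 h : nact h n1 = (ε h : k) *: n1.
Proof. by rewrite /n1 nactE tact1r (linZ nproj_linear). Qed.

Definition ncounit (y : B) : k^o := tcounit (repr y).

Lemma ncounitE t : ncounit (π t) = tcounit t.
Proof. by rewrite /ncounit (nproj_factor (f := @tcounit k V))//; [linr|exact: nichols_ideal_counit]. Qed.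

Lemma ncounit_linear : linear ncounit.
Proof.
by move=> a y z; rewrite -[y]nprojK -[z]nprojK -nproj_linear !ncounitE tcounit_linear.
Qed.

Definition ndl (y : B) : (V ⊗ B)%type := \tsum_(a, b <- dl (repr y)) a ⊗ π b.

Lemma ndlE t : ndl (π t) = \tsum_(a, b <- dl t) a ⊗ π b.
Proof.
rewrite /ndl (nproj_factor (f := fun t => \tsum_(a, b <- dl t) a ⊗ π b))//; first by linr.
move=> u Iu; apply: (tsum_in (submod0 _) _ (nichols_ideal_dl Iu)); first by blin.
by move=> h x /nproj_eq0 ->; apply: linear_at0 ((ten_bilin _ _).2 h).
Qed.

Lemma ndl_linear : linear ndl.
Proof.
have l : linear (fun t => \tsum_(a, b <- dl t) a ⊗ π b) by linr.
by move=> a y z; rewrite -[y]nprojK -[z]nprojK -nproj_linear !ndlE l.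
Qed.
Hint Extern 0 => exact: ndl_linear : lin.

Lemma ndl_projE W (b : V -> B -> W) t : bilin b ->
  \tsum_(x, y <- ndl (π t)) b x y = \tsum_(x, t0 <- dl t) b x (π t0).
Proof.
by move=> bb; rewrite ndlE tsum_tsum//; apply: eq_tsum => *; rewrite tsum_ten.
Qed.

Lemma ndl_coactE W (b : H -> (V ⊗ B)%type -> W) y : bilin b ->
  \tsum_(h, y0 <- ncoact y) b h (ndl y0) =
  \tsum_(x, z <- ndl y) \tsum_(g, x0 <- coact x) \tsum_(h, z0 <- ncoact z)
    b (g * h) (x0 ⊗ z0).
Proof.
move=> bb; elim/nproj_ind: y => t; rewrite ncoact_projE; last by blin.
pose c h (z : (V ⊗ T)%type) := b h (\tsum_(x, y <- z) x ⊗ π y).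
have bc : bilin c by rewrite /c; blin.
transitivity (\tsum_(h, t0 <- tcoact t) c h (dl t0)).
  by apply: eq_tsum => *; rewrite /c ndlE.
rewrite dl_coactE// ndl_projE; last by blin.
apply: eq_tsum => x y; apply: eq_tsum => g x0; rewrite ncoact_projE; last by blin.
by apply: eq_tsum => h y0; rewrite /c tsum_ten//; blin.
Qed.

Definition nd (psi : V -> k^o) (y : B) : B := \tsum_(a, b <- ndl y) (psi a : k) *: b.

Lemma nd_linear psi : linear psi -> linear (nd psi).
Proof. by rewrite /nd; linr. Qed.

Lemma ndE psi t : linear psi -> nd psi (π t) = π (dd psi t).
Proof.
move=> lp; rewrite /nd ndl_projE; last by blin.
by rewrite /dd (tsum_comp _ _ nproj_linear); apply: eq_tsum => *; rewrite (linZ nproj_linear).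
Qed.

(** The form in which the maximality of the Nichols ideal is used from here on. *)
Lemma nd_sep y : ncounit y = 0 -> (forall psi, linear psi -> nd psi y = 0) -> y = 0.
Proof.
elim/nproj_ind: y => t; rewrite ncounitE => t0 dt; apply/nproj_eq0/dd_intro => // psi lp.
by apply/nproj_eq0; rewrite -ndE// dt.
Qed.

Lemma nd_nin psi v : linear psi -> nd psi (nin v) = (psi v : k) *: n1.
Proof.
by move=> lp; rewrite /nin ndE// /dd dl_tin tsum_ten ?(linZ nproj_linear)//; blin.
Qed.

Lemma nd_ninM psi v y : linear psi -> nd psi (nmul (nin v) y) =
  (psi v : k) *: y + \tsum_(g, v0 <- coact v) nmul (nin v0) (nd (fun x => psi (act g x)) y).
Proof.
move=> lp; elim/nproj_ind: y => t; rewrite nmulE ndE// /dd dl_consE; last by blin.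
rewrite (linD nproj_linear) (linZ nproj_linear) (tsum_comp _ _ nproj_linear).
congr (_ + _); apply: eq_tsum => g v0; rewrite ndE; last by linr.
rewrite nmulE /dd (tsum_comp _ _ nproj_linear) (tsum_comp (F := fun z => π (tin v0 * z))).
  by apply: eq_tsum => *; rewrite scalerAr.
by linr.
Qed.

Lemma nd_Mnin psi v y : linear psi -> nd psi (nmul y (nin v)) =
  nmul (nd psi y) (nin v) + \tsum_(h, y0 <- ncoact y) (psi (act h v) : k) *: y0.
Proof.
move=> lp; elim/nproj_ind: y => t; rewrite nmulE ndE// /dd dlME; last by blin.
rewrite (linD nproj_linear) !(tsum_comp _ _ nproj_linear) ndE// nmulE.
congr (_ + _).
  rewrite /dd (tsum_comp (F := fun z => π (z * tin v))); last by linr.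
  by apply: eq_tsum => *; rewrite scalerAl.
rewrite ncoact_projE; last by blin.
by apply: eq_tsum => *; rewrite (linZ nproj_linear).
Qed.

Lemma nd_act psi h y : linear psi -> nd psi (nact h y) =
  \tsum_(h1, h2 <- Δ h) nact h2 (nd (fun x => psi (act h1 x)) y).
Proof.
move=> lp; elim/nproj_ind: y => t; rewrite nactE ndE// /dd dl_actE; last by blin.
rewrite (tsum_comp _ _ nproj_linear); apply: eq_tsum => h1 h2.
rewrite ndE ?nactE; last by linr.
rewrite /dd (tsum_comp _ _ nproj_linear) (tsum_comp (F := fun z => π (tact h2 z))).
  by apply: eq_tsum => *; rewrite (linZ ((tact_bilin V).2 _)).
by linr.
Qed.

Lemma ad_c_bilin : bilin (@ad_c _ _ V).
Proof. by rewrite /ad_c; blin. Qed.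
Hint Resolve ad_c_bilin : lin.

Lemma ad_c_n1 v : ad_c v n1 = 0.
Proof.
rewrite /ad_c nmul1r -[X in X - _](coact_counitE v nin_linear).
apply/eqP; rewrite subr_eq0; apply/eqP; apply: eq_tsum => g v0.
rewrite nact_n1 (linZ (nmul_bilin.1 _)); congr (_ *: _).
by rewrite /n1 /nin nmulE mul1r.
Qed.

Lemma ncounit_ad v y : ncounit (ad_c v y) = 0.
Proof.
elim/nproj_ind: y => t; rewrite /ad_c (linB ncounit_linear) /nin nmulE ncounitE.
rewrite tcounit_cons sub0r (tsum_comp _ _ ncounit_linear) tsum_eq0 ?oppr0// => g v0.
by rewrite nactE nmulE ncounitE tcounitM -[tin v0]mulr1 tcounit_cons mulr0.
Qed.

(** Origin of the relation in [adsys]. The left Leibniz rule for vy gives psi(v) y, the right one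
    for (v_(-1).y) v_(0) gives the double braiding term, and the remaining terms form ad_c of
    derivatives of y. *)
Lemma nd_ad psi v y : linear psi -> nd psi (ad_c v y) =
  (psi v : k) *: y -
  \tsum_(g, v0 <- coact v) \tsum_(h, y0 <- ncoact (nact g y)) (psi (act h v0) : k) *: y0
  + \tsum_(g, v0 <- coact v) ad_c v0 (nd (fun x => psi (act g x)) y).
Proof.
move=> lp; have ld := nd_linear lp.
rewrite /ad_c (linB ld) nd_ninM// (tsum_comp _ _ ld) tsumD tsumN.
rewrite -!addrA; congr (_ + _).
rewrite [RHS]addrCA -opprD; congr (_ - _).
under eq_tsum => g v0 do rewrite nd_Mnin//.
rewrite tsumD addrC; congr (_ + _).
pose F g1 g2 v0 := nmul (nact g2 (nd (fun x => psi (act g1 x)) y)) (nin v0).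
rewrite -(coactA (F := F)); last by rewrite /F /nd; tlin.
apply: eq_tsum => g v0; rewrite nd_act// (tsum_comp (F := fun z => nmul z (nin v0)))//.
by linr.
Qed.

(** The cancellation of [S h3 * h4] below is the H-linearity of the braiding; [ad_c_coactE] is the
    colinear counterpart. *)
Lemma ad_c_act h v y : nact h (ad_c v y) =
  \tsum_(h1, h2 <- Δ h) ad_c (act h1 v) (nact h2 y).
Proof.
rewrite /ad_c (linB (nact_bilin.2 h)) nmul_act tsumD tsumN; congr (_ - _).
  by apply: eq_tsum => h1 h2; rewrite nact_nin.
transitivity (\tsum_(x, h4 <- Δ h) \tsum_(h1, u <- Δ x) \tsum_(h2, h3 <- Δ u)
   \tsum_(g, v0 <- coact v) nmul (nact (h1 * g * (S h3 * h4)) y) (nin (act h2 v0))); last first.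
  apply: eq_tsum => x h4; rewrite coact_actE; last by blin.
  by do 3!apply: eq_tsum => ? ?; rewrite mulrA nactM.
rewrite comulA; last by tlin.
transitivity (\tsum_(h1, h2 <- Δ h) \tsum_(g, v0 <- coact v)
   nmul (nact (h1 * g) y) (nin (act h2 v0))).
  rewrite tsum_exch (tsum_comp (F := nact h)); last by linr.
  apply: eq_tsum => g v0; rewrite nmul_act; apply: eq_tsum => h1 h2.
  by rewrite nact_nin nactM.
apply: eq_tsum => h1 u.
pose F h2 z := \tsum_(g, v0 <- coact v) nmul (nact (h1 * g * z) y) (nin (act h2 v0)).
rewrite (comulA (F := fun h2 h3 h4 => F h2 (S h3 * h4))); last by rewrite /F; tlin.
transitivity (F u 1); first by rewrite /F; apply: eq_tsum => g v0; rewrite mulr1.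
rewrite -[LHS](counit_rE (G := F^~ 1)); last by rewrite /F; linr.
by apply: eq_tsum => h2 z; rewrite (antipode_lE (G := F h2))//; rewrite /F; linr.
Qed.

Lemma ad_c_coactE W (b : H -> B -> W) v y : bilin b ->
  \tsum_(h, z <- ncoact (ad_c v y)) b h z =
  \tsum_(g, v0 <- coact v) \tsum_(h, y0 <- ncoact y) b (g * h) (ad_c v0 y0).
Proof.
move=> bb; have lc : linear (fun z => \tsum_(h, z <- ncoact z) b h z).
  by linr.
rewrite /ad_c (linB lc) nmul_coactE// ncoact_ninE; last first.
  by blin.
transitivity (\tsum_(g, v0 <- coact v) \tsum_(h, y0 <- ncoact y)
   (b (g * h) (nmul (nin v0) y0) -
    \tsum_(g2, v1 <- coact v0) b (g * h) (nmul (nact g2 y0) (nin v1)))); last first.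
  do 2!apply: eq_tsum => ? ?; rewrite (linB (bb.2 _)) (tsum_comp (F := b _))//.
  exact: bb.2.
under [RHS]eq_tsum => g v0 do rewrite tsumD tsumN.
rewrite tsumD tsumN; congr (_ - _); rewrite (tsum_comp _ _ lc).
under [RHS]eq_tsum => g v0 do rewrite tsum_exch.
rewrite -(coactA (F := fun g g2 v1 => \tsum_(h, y0 <- ncoact y)
   b (g * h) (nmul (nact g2 y0) (nin v1)))); last first.
  by tlin.
transitivity (\tsum_(g, v0 <- coact v) \tsum_(g4, v1 <- coact v0) \tsum_(g1, u <- Δ g)
  \tsum_(g2, g3 <- Δ u) \tsum_(h, y0 <- ncoact y)
    b (g1 * h * (S g3 * g4)) (nmul (nact g2 y0) (nin v1))).
  apply: eq_tsum => g v0; rewrite nmul_coactE//.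
  rewrite (coact_actE (U := nyd)); last by blin.
  do 3!(rewrite [RHS]tsum_exch; apply: eq_tsum => ? ?).
  rewrite ncoact_ninE; last by blin.
  by apply: eq_tsum => *; rewrite mulrA.
pose L g g4 v1 := \tsum_(g1, u <- Δ g) \tsum_(g2, g3 <- Δ u) \tsum_(h, y0 <- ncoact y)
    b (g1 * h * (S g3 * g4)) (nmul (nact g2 y0) (nin v1)).
rewrite -(coactA (F := L)); last by rewrite /L; tlin.
apply: eq_tsum => g v0; rewrite /L comulA; last by tlin.
apply: eq_tsum => g1 u.
pose F g2 z := \tsum_(h, y0 <- ncoact y) b (g1 * h * z) (nmul (nact g2 y0) (nin v0)).
rewrite (comulA (F := fun g2 g3 g4 => F g2 (S g3 * g4))); last by rewrite /F; tlin.
transitivity (F u 1); last by rewrite /F; apply: eq_tsum => *; rewrite mulr1.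
rewrite -[RHS](counit_rE (G := F^~ 1)); last by rewrite /F; linr.
by apply: eq_tsum => g2 z; rewrite (antipode_lE (G := F g2))//; rewrite /F; linr.
Qed.

End NicholsYD.
#[export] Hint Extern 0 => exact: nproj_linear : lin.
#[export] Hint Extern 0 => exact: ncoact_linear : lin.
#[export] Hint Extern 0 => exact: nin_linear : lin.
#[export] Hint Extern 0 => exact: ndl_linear : lin.
#[export] Hint Resolve nmul_bilin nact_bilin ad_c_bilin : lin.

(** * Systems of adjoint actions and skew derivations *)

Section YDMaps.
Variables (k : fieldType) (H : hopfAlgebra k).
Local Notation Δ := (@comul k H).
Local Notation ε := (@counit k H).
Local Notation S := (@antipode k H).
Implicit Types U V W D E : ydModule H.

Definition yd_lin V W (f : V -> W) :=
  [/\ linear f, forall h v, f (act h v) = act h (f v) &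
      forall v, coact (f v) = \tsum_(h, v0 <- coact v) h ⊗ f v0].

(** A morphism V ⊗ E -> W of Yetter-Drinfeld modules, written as a bilinear map so that the tensor
    product object need not be formed. *)
Definition yd_bimap V E W (a : V -> E -> W) :=
  [/\ bilin a,
      forall h v y, act h (a v y) = \tsum_(h1, h2 <- Δ h) a (act h1 v) (act h2 y) &
      forall v y, coact (a v y) =
        \tsum_(g, v0 <- coact v) \tsum_(h, y0 <- coact y) (g * h) ⊗ a v0 y0].

Lemma yd_lin_coactE V W (X : lmodType k) (f : V -> W) (b : H -> W -> X) v :
  yd_lin f -> bilin b ->
  \tsum_(h, w <- coact (f v)) b h w = \tsum_(h, v0 <- coact v) b h (f v0).
Proof.
by move=> [lf _ fc] bb; rewrite fc tsum_tsum//; apply: eq_tsum => *; rewrite tsum_ten.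
Qed.

Lemma yd_bimap_coactE V E W (X : lmodType k) (a : V -> E -> W) (b : H -> W -> X) v y :
  yd_bimap a -> bilin b ->
  \tsum_(h, w <- coact (a v y)) b h w =
  \tsum_(g, v0 <- coact v) \tsum_(h, y0 <- coact y) b (g * h) (a v0 y0).
Proof.
move=> [ba _ ac] bb; rewrite ac tsum_tsum//; apply: eq_tsum => *.
by rewrite tsum_tsum//; apply: eq_tsum => *; rewrite tsum_ten.
Qed.

(** Coaction stability tested by contractions with forms on H, as [tens_inP] allows; in this form it
    passes easily to images and preimages under morphisms. *)
Lemma yd_submodP V (A : set V) : yd_submod A <->
  [/\ submod A, forall h v, A v -> A (act h v) &
      forall (phi : H -> k^o) v, linear phi -> A v ->
        A (\tsum_(h, v0 <- coact v) (phi h : k) *: v0)].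
Proof.
split=> -[sA Ah Ac]; split=> //.
  by move=> phi v lphi Av; apply: (tens_inP _ sA).1 => //; apply: Ac.
by move=> v Av; apply/(tens_inP _ sA) => phi lphi; apply: Ac.
Qed.

Lemma yd_submod_coact V (A : set V) v : yd_submod A -> A v -> tens_in A (coact v).
Proof. by case=> _ _; apply. Qed.

Lemma yd_submod_submod V (A : set V) : yd_submod A -> submod A.
Proof. by case. Qed.

Lemma yd_submod_lspan V (A : set V) :
  (forall h v, A v -> lspan A (act h v)) ->
  (forall v, A v -> tens_in (lspan A) (coact v)) -> yd_submod (lspan A).
Proof.
move=> Ah Ac; split=> [|h|]; first exact: submod_lspan.
  apply: lspan_sub => [|v Av]; last exact: Ah.
  exact: submod_preimage ((act_bilin V).2 h) (submod_lspan A).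
apply: lspan_sub => [|v Av]; last exact: Ac.
exact: submod_preimage (lin_pack coact) (submod_lspan _).
Qed.

Definition bispan V E W (a : V -> E -> W) (A : set E) : set W :=
  lspan [set a x y | x in setT & y in A].

Lemma bispan_in V E W (a : V -> E -> W) (A : set E) x y : A y -> bispan a A (a x y).
Proof. by move=> Ay; apply: lspan_gen; exists x => //; exists y. Qed.

Lemma bispan_sub V E W (a : V -> E -> W) (A : set E) (C : set W) : submod C ->
  (forall x y, A y -> C (a x y)) -> bispan a A `<=` C.
Proof. by move=> sC aC; apply: lspan_sub => // _ [x _ [y Ay <-]]; apply: aC. Qed.

Lemma bispan_submod V E W (a : V -> E -> W) (A : set E) : submod (bispan a A).
Proof. exact: submod_lspan. Qed.

Lemma bispan_yd_submod V E W (a : V -> E -> W) (A : set E) :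
  yd_bimap a -> yd_submod A -> yd_submod (bispan a A).
Proof.
move=> [ba ah ac] yA; have [sA Ah _] := yA; apply: yd_submod_lspan => [h _ [x _ [y Ay <-]]|_ [x _ [y Ay <-]]].
  rewrite ah; apply: tsum_in_sub => [|h1 h2]; first exact: submod_lspan.
  by apply: lspan_gen; exists (act h1 x) => //; exists (act h2 y) => //; apply: Ah.
rewrite ac; apply: tsum_in_sub => [|g x0].
  exact: tens_in_submod.
apply: (tsum_in (tens_in_submod _ _) _ (yd_submod_coact yA Ay)); first by blin.
move=> h z Az; apply: tens_in_ten.
by apply: lspan_gen; exists x0 => //; exists z.
Qed.

Lemma bispanS V E W (a : V -> E -> W) (A B : set E) :
  A `<=` B -> bispan a A `<=` bispan a B.
Proof.
move=> AB; apply: bispan_sub => [|x y Ay]; first exact: bispan_submod.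
by apply: bispan_in; apply: AB.
Qed.

End YDMaps.

Section Systems.
Variables (k : fieldType) (H : hopfAlgebra k).
Local Notation Δ := (@comul k H).
Local Notation ε := (@counit k H).
Local Notation S := (@antipode k H).
Implicit Types U V W D E : ydModule H.

Variable Si : H -> H.
Hypotheses (SK : cancel S Si) (SiK : cancel Si S).

Let lSi : linear Si := Si_linear SK SiK.

(* For V = N_i, D its dual, E the Nichols algebra, a the adjoint action and d *)
(* the skew derivations along N_i, this is the commutation relation           *)
(*   (id ⊗ d) a = id - c^2 + (id ⊗ a) (c ⊗ id) (id ⊗ d),                      *)
(* with its first tensor factor contracted with f.                            *)
Definition adsys V D E (ev : D -> V -> k^o) (a : V -> E -> E) (d : D -> E -> E) :=
  [/\ bilin ev, yd_bimap a, bilin d & forall f x y, d f (a x y) =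
    (ev f x : k) *: y -
    \tsum_(g, x0 <- coact x) \tsum_(h, y0 <- coact (act g y)) (ev f (act h x0) : k) *: y0
    + \tsum_(g, x0 <- coact x) a x0 (d (act (Si g) f) y)].

Definition adseq V E (a : V -> E -> E) (X : set E) (n : nat) : set E :=
  iter n (bispan a) X.

Lemma adseqS V E (a : V -> E -> E) X n : adseq a X n.+1 = bispan a (adseq a X n).
Proof. by []. Qed.

Lemma adseq_yd_submod V E (a : V -> E -> E) X n :
  yd_bimap a -> yd_submod X -> yd_submod (adseq a X n).
Proof. by move=> ya yX; elim: n => //= n ih; apply: bispan_yd_submod. Qed.

(** For y in X_n, the first two terms of d f (a x y) stay in the submodule X_n; the third lies in
    a(V ⊗ X_(n-1)) by induction, and is 0 when n = 0. *)
Lemma adseq_d V D E ev a d (X : set E) : @adsys V D E ev a d -> yd_submod X ->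
  (forall f y, X y -> d f y = 0) ->
  forall n f y, adseq a X n.+1 y -> adseq a X n (d f y).
Proof.
move=> [be ya bd R] yX dX; have [ba _ _] := ya.
elim=> [|n ih] f;
  [apply: (bispan_sub (C := d f @^-1` X))|apply: (bispan_sub (C := d f @^-1` adseq a X n.+1))].
- exact: submod_preimage (bd.2 f) (yd_submod_submod yX).
- move=> x y Xy; rewrite /preimage /= R.
  have [sX Xh _] := yX.
  have third : \tsum_(g, x0 <- coact x) a x0 (d (act (Si g) f) y) = 0.
    by rewrite tsum_eq0// => g x0; rewrite dX// (linear_at0 (ba.2 _)).
  rewrite third addr0; apply: (submodB sX); first exact: (submodZ sX).
  apply: (tsum_in_sub _ sX) => g x0; apply: (tsum_in sX _ (yd_submod_coact yX (Xh g y Xy))); first by blin.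
  by move=> h z Xz; apply: (submodZ sX).
- exact: submod_preimage (bd.2 f) (bispan_submod _ _).
- move=> x y Xy; rewrite /preimage /= R.
  have yXn := adseq_yd_submod n.+1 ya yX; have [sX Xh _] := yXn.
  apply: (submodD sX); last first.
    by apply: (tsum_in_sub _ sX) => g x0; apply: bispan_in; apply: ih.
  apply: (submodB sX); first exact: (submodZ sX).
  apply: (tsum_in_sub _ sX) => g x0; apply: (tsum_in sX _ (yd_submod_coact yXn (Xh g y Xy))); first by blin.
  by move=> h z Xz; apply: (submodZ sX).
Qed.

Lemma adseq0_le V E (a : V -> E -> E) X m n : bilin a ->
  adseq a X m `<=` [set 0] -> (m <= n)%N -> adseq a X n `<=` [set 0].
Proof.
move=> ba X0; elim: n => [|n ih]; first by rewrite leqn0 => /eqP <-.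
rewrite leq_eqVlt => /orP[/eqP <-//|/ih {}ih].
apply: bispan_sub => [|x y /ih ->]; first exact: submod0.
exact: linear_at0 (ba.2 x).
Qed.

Definition d_sep V D E (a : V -> E -> E) (d : D -> E -> E) (X : set E) :=
  forall (n : nat) (U : set E), yd_submod U -> U `<=` adseq a X n.+1 ->
    (forall f y, U y -> d f y = 0) -> U `<=` [set 0].

Section DualPairing.
Variables (V D : ydModule H) (ev : D -> V -> k^o).
Hypothesis be : bilin ev.
Hypothesis ev_act : forall h f v, ev (act h f) v = ev f (act (S h) v).
Hypothesis ev_coact : forall f v, \tsum_(g, f0 <- coact f) (ev f0 v : k) *: S g =
                                  \tsum_(g, v0 <- coact v) (ev f v0 : k) *: g.

(** The pairing that exhibits V as the left dual of D, see [dual_ev_left_dual]. The swapped pairing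
    [ev f u] would satisfy the action rule only up to S^2. *)
Definition dual_ev (u : V) (f : D) : k^o :=
  \tsum_(g, f0 <- coact f) ev f0 (act (Si g) u).

Lemma dual_ev_bilin : bilin dual_ev.
Proof. by rewrite /dual_ev; blin. Qed.

Lemma ev_coactE (W : lmodType k) (G : H -> W) f v : linear G ->
  \tsum_(h, v0 <- coact v) (ev f v0 : k) *: G (Si h) =
  \tsum_(g, f0 <- coact f) (ev f0 v : k) *: G g.
Proof.
move=> lG; have lGS : linear (fun x => G (Si x)) by linr.
have := ev_coact f v => /(congr1 (fun z => G (Si z))).
rewrite !(tsum_comp _ _ lGS) => e.
transitivity (\tsum_(h, v0 <- coact v) G (Si ((ev f v0 : k) *: h))).
  by apply: eq_tsum => *; rewrite (linZ lGS).
by rewrite -e; apply: eq_tsum => *; rewrite (linZ lGS) SK.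
Qed.

Lemma dual_ev_act h u f : dual_ev (act h u) f = dual_ev u (act (S h) f).
Proof.
rewrite /dual_ev coact_actE; last by blin.
pose F z h1 := \tsum_(g, f0 <- coact f) ev f0 (act (z * Si g * Si h1) u).
transitivity (\tsum_(h1, y <- Δ (S h)) (ε y : k) *: F 1 h1).
  rewrite counit_rE; last by rewrite /F; linr.
  by apply: eq_tsum => g f0; rewrite SK mul1r actM.
apply: eq_tsum => h1 y.
rewrite -(antipode_lE (G := F^~ h1)); last by rewrite /F; linr.
apply: eq_tsum => h2 h3; apply: eq_tsum => g f0.
by rewrite ev_act -actM !(SiM SK SiK) SK !mulrA.
Qed.

(** The twist in [dual_ev] is undone by the map f -> S(f_(-1)) f_(0), named [sigma] below. *)
Lemma dual_ev_sigma u f : \tsum_(g, f0 <- coact f) dual_ev u (act (S g) f0) = ev f u.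
Proof.
pose F g g' f1 := ev f1 (act (Si g' * g) u).
transitivity (\tsum_(g, f0 <- coact f) \tsum_(g', f1 <- coact f0) F g g' f1).
  apply: eq_tsum => g f0; rewrite -dual_ev_act /dual_ev.
  by apply: eq_tsum => *; rewrite /F actM.
rewrite -coactA; last by rewrite /F; tlin.
transitivity (\tsum_(q, f0 <- coact f) (ε q : k) *: ev f0 u); last first.
  by rewrite (coact_counitE (G := fun f => ev f u))//; linr.
apply: eq_tsum => q f0; rewrite (Si_lE SK SiK (G := fun z => ev f0 (act z u))) ?act1//.
by linr.
Qed.

End DualPairing.

(** * Exchanging the two actions of a system, and the sequence read backwards *)

Section DualSystem.
Variables (V D E : ydModule H) (ev : D -> V -> k^o).
Variables (a : V -> E -> E) (d : D -> E -> E).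
Hypotheses (sys : adsys ev a d) (yd : yd_bimap d).
Hypothesis ev_act : forall h f v, ev (act h f) v = ev f (act (S h) v).
Hypothesis ev_coact : forall f v, \tsum_(g, f0 <- coact f) (ev f0 v : k) *: S g =
                                  \tsum_(g, v0 <- coact v) (ev f v0 : k) *: g.

Local Notation dual_ev := (dual_ev ev).

Let be : bilin ev. Proof. by case: sys. Qed.
Let ya : yd_bimap a. Proof. by case: sys. Qed.
Let ba : bilin a. Proof. by case: ya. Qed.
Let bd : bilin d. Proof. by case: yd. Qed.

(* The composition of a with the inverse of the double braiding of V ⊗ E. *)
Definition dual_d (x : V) (y : E) : E :=
  \tsum_(g, y0 <- coact y) \tsum_(h, w <- coact (act (Si g) x)) a w (act (Si h) y0).

Lemma dual_d_bilin : bilin dual_d.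
Proof. by rewrite /dual_d; blin. Qed.

(* The commutation relation of d and dual_d before moving x to the other     *)
(* side of the pairing: compose the relation of adsys with c^-2.             *)
Lemma d_dual_d f x y : d f (dual_d x y) =
  - ((ev f x : k) *: y)
  + \tsum_(g, f0 <- coact f) \tsum_(h, y0 <- coact y)
      (ev f0 (act (Si h) x) : k) *: act g y0
  + \tsum_(g, f0 <- coact f) dual_d (act g x) (d f0 y).
Proof.
have [_ _ _ R] := sys; have [_ dh dc] := yd.
have ldf : linear (d f) by linr.
rewrite /dual_d (tsum_comp _ _ ldf).
under eq_tsum => g y0 do rewrite (tsum_comp _ _ ldf).
under eq_tsum => g y0.
  under eq_tsum => h w do rewrite R.
  rewrite tsumD tsumD tsumN.
  over.
rewrite tsumD tsumD tsumN.
congr (_ + _); first (rewrite addrC; congr (- _ + _)).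
(* The c^2 term: composed with c^-2 it becomes the bare pairing. *)
- transitivity (\tsum_(g, y0 <- coact y) \tsum_(h', z0 <- coact y0)
     (ev f (act h' (act (Si g) x)) : k) *: z0).
    apply: eq_tsum => g y0.
    pose K q x0 := \tsum_(h', z0 <- coact (act q y0)) (ev f (act h' x0) : k) *: z0.
    transitivity (\tsum_(h, w <- coact (act (Si g) x)) \tsum_(g', x0 <- coact w)
       K (g' * Si h) x0).
      by do 2!apply: eq_tsum => ? ?; rewrite /K actM.
    rewrite -(coactA (F := fun h g' x0 => K (g' * Si h) x0)); last by rewrite /K; tlin.
    transitivity (\tsum_(q, w <- coact (act (Si g) x)) (ε q : k) *: K 1 w).
      apply: eq_tsum => q w; rewrite (Si_rE SK SiK (G := K^~ w))//.
      by rewrite /K; linr.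
    rewrite (coact_counitE (G := K 1)); last by rewrite /K; linr.
    by rewrite /K act1.
  transitivity (\tsum_(g, y0 <- coact y) \tsum_(h, z0 <- coact y0)
    (ev f (act (h * Si g) x) : k) *: z0).
    by do 2!apply: eq_tsum => ? ?; rewrite actM.
  rewrite -(coactA (F := fun g h z0 => (ev f (act (h * Si g) x) : k) *: z0)); last by tlin.
  transitivity (\tsum_(q, z0 <- coact y) (ε q : k) *: ((ev f x : k) *: z0)); last first.
    by rewrite coact_counitE//; linr.
  apply: eq_tsum => q z0.
  rewrite (Si_rE SK SiK (G := fun q => (ev f (act q x) : k) *: z0)) ?act1//.
  by linr.
(* The identity term becomes c^-2; [ev_coactE] moves the coaction from x to f. *)
- rewrite [RHS]tsum_exch; apply: eq_tsum => g y0.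
  by rewrite (ev_coactE ev_coact (G := fun h => act h y0))//; linr.
(* The term with the derivative of y: linearity of d collects the action in front of d, and
   colinearity of d recognizes the coaction of [d f0 y]. *)
- pose Z c f' y0 := \tsum_(q, w0 <- coact (act c x)) a w0 (act (Si q) (d f' y0)).
  transitivity (\tsum_(g, y0 <- coact y) Z (Si g) f y0).
    apply: eq_tsum => g y0.
    rewrite -(coactA (F := fun h g' x0 => a x0 (d (act (Si g') f) (act (Si h) y0))));
      last by tlin.
    apply: eq_tsum => q w0; rewrite dh comul_SiE//; last by blin.
    by rewrite (tsum_comp (F := a w0))//; linr.
  transitivity (\tsum_(g', f0 <- coact f) \tsum_(g2, f1 <- coact f0)
     \tsum_(g, y0 <- coact y) Z (Si g * (Si g2 * g')) f1 y0).
    rewrite -(coactA (F := fun g' g2 f1 => \tsum_(g, y0 <- coact y)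
      Z (Si g * (Si g2 * g')) f1 y0)); last by rewrite /Z; tlin.
    transitivity (\tsum_(q, f1 <- coact f) (ε q : k) *:
        (\tsum_(g, y0 <- coact y) Z (Si g) f1 y0)).
      by rewrite coact_counitE//; rewrite /Z; linr.
    apply: eq_tsum => q f1.
    rewrite (Si_lE SK SiK (G := fun c => \tsum_(g, y0 <- coact y) Z (Si g * c) f1 y0)).
      by under [in RHS]eq_tsum => g y0 do rewrite mulr1.
    by rewrite /Z; linr.
  apply: eq_tsum => g' f0; rewrite (yd_bimap_coactE _ _ yd); last by blin.
  do 2!apply: eq_tsum => ? ?; rewrite /Z.
  by rewrite -actM (SiM SK SiK) mulrA.
Qed.

(** Sum [d_dual_d] over the coaction of f with x = S^-1(f_(-1)) u. The pairing becomes
    [dual_ev u f], the last term collapses to [dual_d u (d f y)], and solving for it gives the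
    relation; [dual_ev_sigma] identifies the double braiding terms. *)
Lemma dual_adsys : adsys dual_ev d dual_d.
Proof.
have bA := dual_d_bilin; have be2 := dual_ev_bilin be.
split=> // u f y.
under [X in _ = _ + X]eq_tsum => g f0 do rewrite d_dual_d.
rewrite tsumD tsumD.
have -> : \tsum_(g, f0 <- coact f) - ((ev f0 (act (Si g) u) : k) *: y) =
    - ((dual_ev u f : k) *: y).
  rewrite tsumN /dual_ev (tsum_comp (F := fun c : k^o => (c : k) *: y))//.
  by linr.
have -> : \tsum_(g, f0 <- coact f) \tsum_(g2, f1 <- coact f0)
    dual_d (act g2 (act (Si g) u)) (d f1 y) = dual_d u (d f y).
  transitivity (\tsum_(g, f0 <- coact f) \tsum_(g2, f1 <- coact f0)
    dual_d (act (g2 * Si g) u) (d f1 y)).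
    by do 2!apply: eq_tsum => ? ?; rewrite actM.
  rewrite -(coactA (F := fun g g2 f1 => dual_d (act (g2 * Si g) u) (d f1 y)));
    last by tlin.
  transitivity (\tsum_(q, f1 <- coact f) (ε q : k) *: dual_d u (d f1 y)); last first.
    by rewrite (coact_counitE (G := fun f => dual_d u (d f y)))//; linr.
  apply: eq_tsum => q f1.
  rewrite (Si_rE SK SiK (G := fun z => dual_d (act z u) (d f1 y))) ?act1//.
  by linr.
have cancel2 (p q r : E) : p = q - r + (- q + r + p).
  by rewrite [RHS]addrA addrACA subrr addNr addr0 add0r.
rewrite [LHS](cancel2 _ ((dual_ev u f : k) *: y) (\tsum_(g, f0 <- coact f)
   \tsum_(g2, f1 <- coact f0) \tsum_(h, y0 <- coact y)
      (ev f1 (act (Si h) (act (Si g) u)) : k) *: act g2 y0)).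
congr (_ - _ + _).
transitivity (\tsum_(g, f0 <- coact f) \tsum_(g1, z <- Δ g) \tsum_(g2, g3 <- Δ z)
  \tsum_(h, y0 <- coact y) (dual_ev (act (Si (g1 * h)) u) (act (S g3) f0) : k) *: act g2 y0);
  last first.
  apply: eq_tsum => g f0; rewrite coact_actE; last by blin.
  do 3!apply: eq_tsum => ? ?.
  by rewrite (dual_ev_act be ev_act) SiK -actM.
pose K g1 g2 g3 f0 := \tsum_(h, y0 <- coact y)
  (dual_ev (act (Si (g1 * h)) u) (act (S g3) f0) : k) *: act g2 y0.
rewrite (coactA (F := fun g1 z f0 => \tsum_(g2, g3 <- Δ z) K g1 g2 g3 f0));
  last by rewrite /K; tlin.
apply: eq_tsum => g1 f'.
rewrite (coactA (F := fun g2 g3 f0 => K g1 g2 g3 f0)); last by rewrite /K; tlin.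
apply: eq_tsum => g2 f''; rewrite /K [RHS]tsum_exch; apply: eq_tsum => h y0.
rewrite -(tsum_comp (F := fun c : k^o => (c : k) *: act g2 y0)); last by linr.
by rewrite (dual_ev_sigma be ev_act) -actM (SiM SK SiK).
Qed.

Lemma a_dual_d x y : a x y =
  \tsum_(g, x0 <- coact x) \tsum_(h, y0 <- coact (act g y)) dual_d (act h x0) y0.
Proof.
have bA := dual_d_bilin.
transitivity (\tsum_(g, x0 <- coact x) \tsum_(h, w <- coact x0)
   a w (act (Si h * g) y)).
  rewrite -(coactA (F := fun g h w => a w (act (Si h * g) y))); last by tlin.
  transitivity (\tsum_(q, w <- coact x) (ε q : k) *: a w y).
    by rewrite (coact_counitE (G := fun w => a w y))//; linr.
  apply: eq_tsum => q w.
  rewrite (Si_lE SK SiK (G := fun z => a w (act z y))) ?act1//.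
  by linr.
apply: eq_tsum => g x0.
pose G c y1 := \tsum_(h', w <- coact (act c x0)) a w (act (Si h') y1).
transitivity (\tsum_(h, y0 <- coact (act g y)) \tsum_(g', y1 <- coact y0)
   G (Si g' * h) y1); last first.
  by do 2!apply: eq_tsum => ? ?; rewrite /G actM.
rewrite -(coactA (F := fun h g' y1 => G (Si g' * h) y1)); last by rewrite /G; tlin.
transitivity (\tsum_(q, y1 <- coact (act g y)) (ε q : k) *: G 1 y1).
  rewrite coact_counitE; last by rewrite /G; linr.
  by rewrite /G act1; apply: eq_tsum => h w; rewrite actM.
apply: eq_tsum => q y1; rewrite (Si_lE SK SiK (G := G^~ y1))//.
by rewrite /G; linr.
Qed.

(** The double braiding is an automorphism of V ⊗ A, so a and a c^-2 have the same image; [a_dual_d]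
    recovers a from [dual_d]. *)
Lemma bispan_dual_d (A : set E) : yd_submod A -> bispan dual_d A = bispan a A.
Proof.
move=> yA; have [sA Ah _] := yA; apply/seteqP; split.
  apply: bispan_sub => [|x y Ay]; first exact: bispan_submod.
  rewrite /dual_d.
  apply: (tsum_in (bispan_submod _ _) _ (yd_submod_coact yA Ay)); first by blin.
  move=> g y0 Ay0; apply: (tsum_in_sub _ (bispan_submod _ _)) => h w.
  by apply: bispan_in; apply: Ah.
apply: bispan_sub => [|x y Ay]; first exact: bispan_submod.
rewrite a_dual_d; apply: (tsum_in_sub _ (bispan_submod _ _)) => g x0.
have bA := dual_d_bilin.
apply: (tsum_in (bispan_submod _ _) _ (yd_submod_coact yA (Ah g y Ay))); first by blin.
by move=> h z Az; apply: bispan_in.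
Qed.

Section Dichotomy.
Variable X : set E.
Hypothesis yX : yd_submod X.
Hypothesis X_irr : forall U : set E, yd_submod U -> U `<=` X ->
  U `<=` [set 0] \/ X `<=` U.
Hypothesis dX : forall f y, X y -> d f y = 0.
Hypothesis sX : d_sep a d X.

Let yXn n : yd_submod (adseq a X n).
Proof. exact: adseq_yd_submod ya yX. Qed.

Section Sub.
Variables (p : nat) (U : set E).
Hypotheses (yU : yd_submod U) (UX : U `<=` adseq a X p).
Hypothesis AU : forall u y, U y -> dual_d u y = 0.

Let yYn n : yd_submod (adseq d U n).
Proof. exact: adseq_yd_submod yd yU. Qed.

Lemma dual_seq_sub n : (n <= p)%N -> adseq d U n `<=` adseq a X (p - n).
Proof.
elim: n => [_|n ih np]; first by rewrite subn0.
apply: bispan_sub => [|f y Yy]; first exact: yd_submod_submod (yXn _).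
apply: (adseq_d sys yX dX); rewrite -subnSK// in ih.
by apply: ih => //; apply: ltnW.
Qed.

Lemma dual_seq_end : adseq d U p.+1 `<=` [set 0].
Proof.
apply: bispan_sub => [|f y Yy]; first exact: submod0.
by apply: dX; have := dual_seq_sub (leqnn p) Yy; rewrite subnn.
Qed.

(** Everything is decided at the bottom, where d^p(U) is a submodule of the irreducible X_0. If it
    is 0, separation carries the vanishing back up to U. If it is X_0, applying [dual_d], which has
    the same image as a and moves the D-sequence of U one step back, rebuilds each X_j inside
    d^(p-j)(U). *)
Lemma dual_seq_dichotomy : U `<=` [set 0] \/
  forall j, (j <= p)%N -> adseq a X j `<=` adseq d U (p - j).
Proof.
have Yp : adseq d U p `<=` X by have := dual_seq_sub (leqnn p); rewrite subnn.
have [Y0|XY] := X_irr (yYn p) Yp; [left|right].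
  suff H0 n : (n <= p)%N -> adseq d U (p - n) `<=` [set 0].
    by have := H0 p (leqnn p); rewrite subnn.
  elim: n => [_|n ih np]; first by rewrite subn0.
  apply: (sX (n := n) (yYn _)).
    by have := dual_seq_sub (leq_subr n.+1 p); rewrite subKn.
  move=> f y Yy; apply: (ih (ltnW np)); rewrite -(subnSK np).
  exact: bispan_in.
elim=> [_|j ih jp]; first by rewrite subn0.
rewrite adseqS -bispan_dual_d//; apply: bispan_sub.
  exact: yd_submod_submod (yYn _).
move=> x y Xy; apply: (adseq_d dual_adsys yU AU).
by rewrite (subnSK jp); apply: ih => //; apply: ltnW.
Qed.

End Sub.

Variable m : nat.
Hypotheses (Xm : ~ adseq a X m `<=` [set 0]) (XSm : adseq a X m.+1 `<=` [set 0]).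

Lemma dual_d_sub0 (U : set E) u y :
  yd_submod U -> U `<=` adseq a X m -> U y -> dual_d u y = 0.
Proof.
move=> yU UX Uy; apply: XSm; rewrite adseqS.
apply: (bispanS UX); rewrite -bispan_dual_d//; exact: bispan_in.
Qed.

(** The dichotomy for p = m at the index m: a submodule of the last nonzero term is killed by
    [dual_d], because X_(m+1) = 0. This is the source of the irreducibility of N'_j. *)
Lemma top_irr (U : set E) : yd_submod U -> U `<=` adseq a X m ->
  U `<=` [set 0] \/ adseq a X m `<=` U.
Proof.
move=> yU UX; have [|XU] := dual_seq_dichotomy yU UX (fun u y => dual_d_sub0 u yU UX).
  by left.
by right; have := XU m (leqnn m); rewrite subnn.
Qed.

Lemma top_dual0 u y : adseq a X m y -> dual_d u y = 0.
Proof. exact: dual_d_sub0. Qed.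

Lemma dual_seqE n : (n <= m)%N -> adseq d (adseq a X m) n = adseq a X (m - n).
Proof.
move=> nm; apply/seteqP; split; first exact: dual_seq_sub.
have [//|XU] := dual_seq_dichotomy (yXn m) (@subset_refl _ _) top_dual0.
by have := XU (m - n)%N (leq_subr n m); rewrite subKn.
Qed.

Lemma dual_seq_endE : adseq d (adseq a X m) m.+1 `<=` [set 0].
Proof. exact: dual_seq_end. Qed.

(** If U inside X_p, with p < m, is killed by [dual_d] and nonzero, the dichotomy gives X_p inside
    U. Then X_(p+1) = 0, contrary to X_m being nonzero. Beyond the m-th step the exchanged sequence
    is 0. *)
Lemma dual_seq_sep : d_sep d dual_d (adseq a X m).
Proof.
move=> n U yU UY AU; have [nm|mn] := leqP n.+1 m; last first.
  apply: subset_trans UY _; elim: n mn => [|n ih].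
    by rewrite ltnS leqn0 => /eqP m0; have := dual_seq_endE; rewrite m0.
  rewrite leq_eqVlt => /orP[/eqP <-|mn]; first exact: dual_seq_endE.
  apply: bispan_sub => [|f y /(ih mn) ->]; first exact: submod0.
  exact: linear_at0 (bd.2 f).
rewrite dual_seqE// in UY.
have [//|XU] := dual_seq_dichotomy yU UY AU.
exfalso; apply: Xm; apply: (@adseq0_le _ _ _ _ (m - n.+1).+1 _ ba); last by rewrite subnSK// leq_subr.
rewrite adseqS -bispan_dual_d//; apply: bispan_sub => [|u y Xy]; first exact: submod0.
by apply: AU; have := XU _ (leqnn _); rewrite subnn; apply.
Qed.

End Dichotomy.

End DualSystem.
End Systems.

(** * Direct sums of systems *)

Section SumOfSystems.
Variables (k : fieldType) (H : hopfAlgebra k) (I : finType) (E_ : I -> ydModule H).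
Local Notation E := (ydsum E_).
Local Notation inj i := (@ydinj k I H E_ i).
Implicit Types (V D : ydModule H).

Lemma ydinj_linear i : linear (inj i).
Proof. exact: dinj_linear. Qed.

Lemma ydcomp_linear i : linear (fun u : E => u i).
Proof. by []. Qed.

Lemma ydinj_in i (x : E_ i) : inj i x i = x.
Proof. exact: dfwith_in. Qed.

Lemma ydinj_out i j (x : E_ i) : i != j -> inj i x j = 0.
Proof. exact: dfwith_out. Qed.

Lemma ydinj_injective i : injective (inj i).
Proof. by move=> x y e; rewrite -[x]ydinj_in e ydinj_in. Qed.

Lemma ydsum_ext (u v : E) : (forall i, u i = v i) -> u = v.
Proof. exact: dsum_ext. Qed.

Lemma ydinj_yd_lin i : yd_lin (inj i).
Proof.
split; first exact: ydinj_linear.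
  by move=> h v; apply: esym (dact_inj h v).
exact: dcoact_inj.
Qed.

Lemma ydsum_coactE (W : lmodType k) (b : H -> E -> W) (u : E) : bilin b ->
  \tsum_(h, u0 <- coact u) b h u0 =
  \sum_i \tsum_(h, y <- coact (u i)) b h (inj i y).
Proof.
move=> bb; rewrite -[coact u]/(dcoact u) /dcoact (lin_sum _ _ _ (tsum_linear bb)).
apply: eq_bigr => i _; rewrite tsum_tsum//.
by apply: eq_tsum => *; rewrite tsum_ten.
Qed.

Lemma ydsum_coact_comp (W : lmodType k) i (b : H -> E_ i -> W) (u : E) : bilin b ->
  \tsum_(h, u0 <- coact u) b h (u0 i) = \tsum_(h, y <- coact (u i)) b h y.
Proof.
move=> bb; rewrite ydsum_coactE; last first.
  by split=> [v|h]; [exact: bb.1|exact: (lin_comp (bb.2 h) (ydcomp_linear i))].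
rewrite (bigD1 i)//= [X in _ + X]big1 ?addr0 => [|j ji].
  by apply: eq_tsum => *; rewrite ydinj_in.
rewrite tsum_eq0// => h y; rewrite ydinj_out//.
exact: linear_at0 (bb.2 h).
Qed.

Lemma ydsum_tsum (U W : lmodType k) (t : (U ⊗ W)%type) (F : U -> W -> E) i :
  (\tsum_(x, y <- t) F x y) i = \tsum_(x, y <- t) F x y i.
Proof. by rewrite (tsum_comp _ _ (ydcomp_linear i)). Qed.

Section Maps.
Variables (V : ydModule H) (a_ : forall i, V -> E_ i -> E_ i).
Arguments a_ : clear implicits.

Definition sum_map (x : V) (u : E) : E := fun i => a_ i x (u i).

Lemma sum_map_inj i x (y : E_ i) : (forall j, bilin (a_ j)) ->
  sum_map x (inj i y) = inj i (a_ i x y).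
Proof.
move=> ba; apply: ydsum_ext => j; rewrite /sum_map; have [<-|ij] := eqVneq i j.
  by rewrite !ydinj_in.
by rewrite !ydinj_out//; apply: linear_at0 ((ba j).2 x).
Qed.

Hypothesis ya : forall i, yd_bimap (a_ i).

Lemma sum_map_bilin : bilin sum_map.
Proof.
by split=> [u x|x u] b; move=> *; apply: ydsum_ext => i; have [ba _ _] := ya i;
  [exact: ba.1|exact: ba.2].
Qed.

Lemma sum_map_yd : yd_bimap sum_map.
Proof.
have bs := sum_map_bilin.
have li i := ydinj_linear i.
split=> // [h x u|x u].
  apply: ydsum_ext => i; have [_ ah _] := ya i.
  by rewrite ydsum_tsum -[LHS]/(act h (a_ i x (u i))) ah.
rewrite -[LHS]tsum_id ydsum_coactE; last exact: ten_bilin.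
transitivity (\tsum_(g, x0 <- coact x) \sum_i \tsum_(h, y0 <- coact (u i))
    (g * h) ⊗ inj i (a_ i x0 y0)).
  rewrite tsum_bigsum; apply: eq_bigr => i _; rewrite (yd_bimap_coactE _ _ (ya i))//.
  by split=> ?; linr.
apply: eq_tsum => g x0; rewrite ydsum_coactE; last by blin.
by apply: eq_bigr => i _; apply: eq_tsum => h y0; rewrite sum_map_inj// => j; case: (ya j).
Qed.

End Maps.

Lemma sum_adsys (Si : H -> H) V D (ev : D -> V -> k^o)
    (a_ : forall i, V -> E_ i -> E_ i) (d_ : forall i, D -> E_ i -> E_ i) :
  bilin ev ->
  (forall i, adsys Si ev (a_ i) (d_ i)) -> adsys Si ev (sum_map a_) (sum_map d_).
Proof.
move=> be sys; split=> //.
- by apply: sum_map_yd => i; case: (sys i).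
- by split=> [u x|x u] b; move=> *; apply: ydsum_ext => i; have [_ _ bd _] := sys i;
    [exact: bd.1|exact: bd.2].
- move=> f x y; apply: ydsum_ext => i; have [_ [ba _ _] _ R] := sys i.
  rewrite -[LHS]/(d_ i f (a_ i x (y i))) R.
  pose c (u : E) := u i; have lc : linear c by exact: ydcomp_linear.
  rewrite -[RHS]/(c _) (linD lc) (linB lc) (linZ lc).
  rewrite !(tsum_comp _ _ lc); congr (_ - _ + _).
  apply: eq_tsum => g x0; rewrite (tsum_comp _ _ lc).
  apply/esym/(@ydsum_coact_comp _ i (fun h z => (ev f (act h x0) : k) *: z)).
  by blin.
Qed.

End SumOfSystems.

(** * Uniqueness of the sequence of a system *)

Section Uniqueness.
Variables (k : fieldType) (H : hopfAlgebra k) (Si : H -> H).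
Variables (V D : ydModule H) (ev : D -> V -> k^o) (E_ : bool -> ydModule H).
Variables (a_ : forall i, V -> E_ i -> E_ i) (d_ : forall i, D -> E_ i -> E_ i).
Arguments a_ : clear implicits.
Arguments d_ : clear implicits.
Hypotheses (be : bilin ev) (sys : forall i, adsys Si ev (a_ i) (d_ i)).
Variables (W : ydModule H) (g_ : forall i, W -> E_ i).
Arguments g_ : clear implicits.
Hypotheses (yg : forall i, yd_lin (g_ i)) (gI : forall i, injective (g_ i)).
Hypothesis dg : forall i f w, d_ i f (g_ i w) = 0.
Hypothesis sep : forall i, d_sep (a_ i) (d_ i) (range (g_ i)).
Local Notation E := (ydsum E_).
Local Notation inj i := (@ydinj k _ H E_ i).

Let a := sum_map a_.
Let d := sum_map d_.
Let sysE : adsys Si ev a d := sum_adsys be sys.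
Let ya : yd_bimap a. Proof. by case: sysE. Qed.

(* The graph of the isomorphism between the n-th terms of the two sequences   *)
(* is the n-th term of a sequence in the sum of the two systems.              *)
Definition gr (w : W) : E := fun i => g_ i w.

Definition graph0 : set E := range gr.
Definition graph n : set E := adseq a graph0 n.

Let lgraph : linear gr.
Proof. by move=> b x y; apply: ydsum_ext => i; have [lg _ _] := yg i; apply: lg. Qed.

Lemma graph0_yd : yd_submod graph0.
Proof.
split; first exact: submod_image lgraph (submodT W).
  move=> h _ [w _ <-]; exists (act h w) => //; apply: ydsum_ext => i.
  by have [_ gh _] := yg i; rewrite /gr gh.
move=> _ [w _ <-].
have -> : coact (gr w) = \tsum_(h, w0 <- coact w) h ⊗ (gr w0).
  rewrite -[LHS]tsum_id ydsum_coactE; last exact: ten_bilin.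
  transitivity (\tsum_(h, w0 <- coact w) \sum_i h ⊗ inj i (g_ i w0)).
    rewrite tsum_bigsum; apply: eq_bigr => i _.
    by rewrite (yd_lin_coactE _ (yg i))//; split=> *; have li := ydinj_linear i; linr.
  apply: eq_tsum => h w0; rewrite -(lin_sum _ _ _ ((ten_bilin _ _).2 h)).
  by congr (_ ⊗ _); rewrite [RHS]dsum_inj.
apply: (tsum_in_sub _ (tens_in_submod _ _)) => h w0.
by apply: tens_in_ten; exists w0.
Qed.

Lemma graph_yd n : yd_submod (graph n).
Proof. exact: adseq_yd_submod ya graph0_yd. Qed.

Lemma graph_comp n i u : graph n u -> adseq (a_ i) (range (g_ i)) n (u i).
Proof.
elim: n u => [|n ih]; first by move=> _ [w _ <-]; exists w.
apply: (bispan_sub (C := (fun u : E => u i) @^-1` adseq (a_ i) (range (g_ i)) n.+1)).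
  exact: submod_preimage (ydcomp_linear i) (bispan_submod _ _).
by move=> x u /ih ui; apply: bispan_in.
Qed.

Lemma graph_surj n i y : adseq (a_ i) (range (g_ i)) n y ->
  exists2 u, graph n u & u i = y.
Proof.
elim: n y => [|n ih]; first by move=> _ [w _ <-]; exists (gr w) => //; exists w.
apply: (bispan_sub (C := (fun u : E => u i) @` graph n.+1)).
  exact: submod_image (ydcomp_linear i) (bispan_submod _ _).
by move=> x _ /ih [u gu <-]; exists (a x u) => //; apply: bispan_in.
Qed.

Lemma graph_d n f u : graph n.+1 u -> graph n (d f u).
Proof.
apply: (adseq_d sysE graph0_yd) => {u} f' _ [w _ <-].
by apply: ydsum_ext => i; apply: dg.
Qed.

(** The graph meets each summand trivially, so its projections are injective ([graph_comp0]). The y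
    with [inj i y] in the graph form a submodule, which d kills by induction, hence 0 by separation;
    at n = 0 the injectivity of the other [g_] decides. *)
Lemma graph_inj0 n i y : graph n (inj i y) -> y = 0.
Proof.
elim: n i y => [|n ih] i y.
  move=> [w _ ew]; have w0 : w = 0.
    apply: (gI (i := ~~ i)); have [lg _ _] := yg (~~ i); rewrite (linear_at0 lg).
    rewrite -[LHS]/(gr w (~~ i)) ew ydinj_out//.
    by case: (i).
  have [lg _ _] := yg i.
  by rewrite -[y](ydinj_in) -ew w0 /gr (linear_at0 lg).
pose U := [set y | graph n.+1 (inj i y)].
have [sG Gh Gc] := (yd_submodP _).1 (graph_yd n.+1).
have [li lh lc] := ydinj_yd_lin E_ i.
suff : U `<=` [set 0] by move=> U0 /U0.
apply: (@sep i n) => [|z|f z Uz].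
- apply/yd_submodP; split; first exact: submod_preimage li sG.
    by move=> h z Uz; rewrite /U /= lh; apply: Gh.
  move=> phi z lphi Uz; rewrite /U /= (tsum_comp _ _ li).
  have := Gc phi _ lphi Uz; rewrite (yd_lin_coactE _ (ydinj_yd_lin E_ i)); last by blin.
  congr (graph _ _); apply: eq_tsum => h v; exact/esym/(linZ li).
- by move=> /graph_comp -/(_ i); rewrite ydinj_in.
- apply: (ih i); have := graph_d f Uz; rewrite /d sum_map_inj//.
  by move=> j; case: (sys j).
Qed.

Lemma graph_comp0 n i u : graph n u -> u i = 0 -> u = 0.
Proof.
move=> gu ui; have uE : u = inj (~~ i) (u (~~ i)).
  apply: ydsum_ext => j; have [<-|ij] := eqVneq (~~ i) j; first by rewrite ydinj_in.
  have ji : i = j by move: ij; case: (i) (j) => [] [].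
  by rewrite ydinj_out//; case: _ / ji.
rewrite uE in gu; rewrite uE (graph_inj0 gu).
exact: linear_at0 (@ydinj_linear _ _ _ E_ _).
Qed.

Lemma adseq_unique0 n i j : adseq (a_ i) (range (g_ i)) n `<=` [set 0] ->
  adseq (a_ j) (range (g_ j)) n `<=` [set 0].
Proof.
move=> X0 y /graph_surj [u gu <-].
by rewrite (graph_comp0 gu (X0 _ (graph_comp i gu))).
Qed.

(** An embedding onto the n-th term of one sequence is carried along the graph to the other: [u w]
    is the only graph element with i-th component [phi w]. *)
Lemma adseq_unique n i j (W' : ydModule H) (phi : W' -> E_ i) :
  yd_lin phi -> injective phi -> range phi = adseq (a_ i) (range (g_ i)) n ->
  exists psi : W' -> E_ j, [/\ yd_lin psi, injective psi &
    range psi = adseq (a_ j) (range (g_ j)) n].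
Proof.
move=> [lp ph pc] phiI phiX.
have ex w : exists u, graph n u /\ u i = phi w.
  have /graph_surj[u gu uw] : adseq (a_ i) (range (g_ i)) n (phi w).
    by rewrite -phiX; exists w.
  by exists u.
have [u uP] := choice ex.
have gu w : graph n (u w) by case: (uP w).
have ui w : u w i = phi w by case: (uP w).
have [sG Gh Gc] := (yd_submodP _).1 (graph_yd n).
have uni w v : graph n v -> v i = phi w -> u w = v.
  move=> gv vi; apply/eqP; rewrite -subr_eq0; apply/eqP.
  apply: (graph_comp0 (n := n) (i := i)); first exact: (submodB sG).
  by rewrite -[LHS]/(u w i - v i) ui vi subrr.
have lu : linear u.
  move=> b x y; apply: uni; first exact: sG.2.
  by rewrite -[LHS]/(b *: u x i + u y i) !ui lp.
have uh h w : u (act h w) = act h (u w).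
  by apply: uni; [exact: Gh|rewrite -[LHS]/(act h (u w i)) ui ph].
(* Colinearity is checked after contraction with forms on H, under which the graph is stable. *)
have uc (p : H -> k^o) w : linear p -> u (\tsum_(h, w0 <- coact w) (p h : k) *: w0) =
    \tsum_(h, u0 <- coact (u w)) (p h : k) *: u0.
  move=> lp'; apply: uni; first exact: Gc.
  have b : bilin (fun (h : H) (z : E_ i) => (p h : k) *: z) by blin.
  rewrite (tsum_comp _ _ (@ydcomp_linear _ _ _ E_ i)).
  rewrite (ydsum_coact_comp _ b) ui (yd_lin_coactE _ (And3 lp ph pc) b).
  by rewrite (tsum_comp _ _ lp); apply: eq_tsum => *; rewrite (linZ lp).
exists (fun w => u w j); split.
- split=> [b x y|h w|w]; [by rewrite lu|by rewrite uh|].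
  apply: tensor_ext => p lp'.
  have b : bilin (fun (h : H) (z : E_ j) => (p h : k) *: z) by blin.
  have luj : linear (fun w => u w j) by move=> c x y; rewrite lu.
  rewrite tsum_tsum//.
  rewrite -(ydsum_coact_comp _ b).
  transitivity (u (\tsum_(h, w0 <- coact w) (p h : k) *: w0) j).
    by rewrite uc// ydsum_tsum.
  rewrite (tsum_comp _ _ luj); apply: eq_tsum => h w0.
  by rewrite tsum_ten// (linZ luj).
- move=> x y xy; apply: phiI; rewrite -!ui.
  suff -> : u x = u y by [].
  apply/eqP; rewrite -subr_eq0; apply/eqP.
  apply: (graph_comp0 (n := n) (i := j)); first exact: (submodB sG).
  by rewrite -[LHS]/(u x j - u y j) xy subrr.
- apply/seteqP; split=> [_ [w _ <-]|y]; first exact: graph_comp.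
  move=> /graph_surj[v gv vy].
  have := graph_comp i gv; rewrite -phiX => -[w _ wv].
  by exists w => //; rewrite -vy; congr (_ j); apply: uni.
Qed.

End Uniqueness.

(** * Submodules and duals *)

Section SubspaceType.
Variables (k : fieldType) (V : lmodType k) (A : set V).
Hypothesis sA : submod A.

(* The proof of submod A is a parameter so that the instances can find it. *)
Definition sub_pred_of of submod A : {pred V} := fun x => `[< A x >].
Local Notation sub_pred := (sub_pred_of sA).

Lemma sub_pred_closed : submod_closed sub_pred.
Proof.
split=> [|a x y /asboolP Ax /asboolP Ay]; apply/asboolP; first by case: sA.
exact: sA.2.
Qed.
HB.instance Definition _ := GRing.isSubmodClosed.Build k V sub_pred sub_pred_closed.

Record subspace := Subspace { sub_val :> V; _ : sub_val \in sub_pred }.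
HB.instance Definition _ := [isSub for sub_val].
HB.instance Definition _ := [Choice of subspace by <:].
HB.instance Definition _ := [SubChoice_isSubLmodule of subspace by <:].

Lemma sub_val_linear : linear (sub_val : subspace -> V).
Proof. by []. Qed.

Lemma sub_val_inj : injective sub_val.
Proof. exact: val_inj. Qed.

Lemma sub_val_range : range sub_val = A.
Proof.
apply/seteqP; split=> [_ [[x Ax] _ <-]|x Ax]; first exact/asboolP.
have Ax' : x \in sub_pred by exact/asboolP.
by exists (Subspace Ax').
Qed.

End SubspaceType.

Lemma subspace_exists (k : fieldType) (V : lmodType k) (A : set V) : submod A ->
  exists (W : lmodType k) (i : W -> V), [/\ linear i, injective i & range i = A].
Proof.
move=> sA; exists (subspace sA), (@sub_val _ _ _ sA); split.
- exact: sub_val_linear.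
- exact: sub_val_inj.
- exact: sub_val_range.
Qed.

Section SubYD.
Variables (k : fieldType) (H : hopfAlgebra k).
Local Notation Δ := (@comul k H).
Local Notation ε := (@counit k H).
Local Notation S := (@antipode k H).

Lemma tsum_eq_in (U V W : lmodType k) (A : set V) (b b' : U -> V -> W)
    (z : (U ⊗ V)%type) :
  bilin b -> bilin b' -> tens_in A z -> (forall u x, A x -> b u x = b' u x) ->
  \tsum_(u, x <- z) b u x = \tsum_(u, x <- z) b' u x.
Proof.
move=> bb bb' Az e; apply/eqP; rewrite -subr_eq0; apply/eqP.
rewrite -tsumN -tsumD; apply: (tsum_in (submod0 W) _ Az); first by blin.
by move=> u x /e ->; rewrite subrr.
Qed.

(** The structure is transported by a linear retraction r of the inclusion. It need not be a
    morphism on V; the identities are checked on A, where [i (r x) = x]. *)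
Lemma sub_yd_exists (V : ydModule H) (A : set V) : yd_submod A ->
  exists (W : ydModule H) (i : W -> V), [/\ yd_lin i, injective i & range i = A].
Proof.
move=> yA; have [sA Ah _] := yA.
have [W [i [li iI iA]]] := subspace_exists sA.
have [r [lr ri]] := lin_retract li iI.
have Ai w : A (i w) by rewrite -iA; exists w.
have ir x : A x -> i (r x) = x by rewrite -iA => -[w _ <-]; rewrite ri.
pose actW h w := r (act h (i w)).
have iact h w : i (actW h w) = act h (i w) by rewrite ir//; apply: Ah.
have bactW : bilin actW by rewrite /actW; blin.
pose c w : (H ⊗ W)%type := \tsum_(h, v <- coact (i w)) h ⊗ r v.
have lc : linear c by rewrite /c; linr.
pose cW : {linear W -> (H ⊗ W)%type} :=
  HB.pack c (GRing.isLinear.Build k W (H ⊗ W)%type *:%R c lc).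
have cE (X : lmodType k) (b : H -> W -> X) w : bilin b ->
    \tsum_(h, w0 <- cW w) b h w0 = \tsum_(h, v <- coact (i w)) b h (r v).
  by move=> bb; rewrite /= /c tsum_tsum//; apply: eq_tsum => *; rewrite tsum_ten.
have Ac w := yd_submod_coact yA (Ai w).
have cA w : \tsum_(h, w0 <- cW w) \tsum_(h1, h2 <- Δ h) h1 ⊗ (h2 ⊗ w0) =
    \tsum_(h, w0 <- cW w) h ⊗ cW w0.
  rewrite !cE; [|by blin|by have l : linear cW by []; blin].
  rewrite (coactA (F := fun h1 h2 v => h1 ⊗ (h2 ⊗ r v))); last by tlin.
  apply: (tsum_eq_in _ _ (Ac w)); [by blin|by have l : linear cW by []; blin|].
  move=> g v0 Av; rewrite /= /c ir// (tsum_comp (F := ten g))//.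
  by linr.
have cc w : \tsum_(h, w0 <- cW w) (ε h : k) *: w0 = w.
  rewrite cE; last by blin.
  by rewrite coact_counitE// ri.
have cy h w : cW (actW h w) =
    \tsum_(h1, h23 <- Δ h) \tsum_(h2, h3 <- Δ h23) \tsum_(v1, v0 <- cW w)
      (h1 * v1 * S h3) ⊗ actW h2 v0.
  rewrite -[LHS]tsum_id cE; last exact: ten_bilin.
  rewrite iact coact_actE; last by blin.
  do 2!apply: eq_tsum => ? ?; rewrite cE; last by blin.
  apply: (tsum_eq_in _ _ (Ac w)); [by blin|by blin|].
  by move=> g v0 Av; rewrite /actW ir.
have a1 w : actW 1 w = w by rewrite /actW act1 ri.
have aM g h w : actW (g * h) w = actW g (actW h w).
  by rewrite {1 2}/actW iact actM.
exists (YDModule bactW a1 aM cA cc cy), i; split=> //; split=> // w.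
rewrite -[RHS]/(\tsum_(h, w0 <- cW w) h ⊗ i w0) cE; last by blin.
rewrite -[LHS]tsum_id; apply: (tsum_eq_in _ _ (Ac w)); [exact: ten_bilin|by blin|].
by move=> h x Ax; rewrite ir.
Qed.

End SubYD.

(** * Perfect pairings of finite-dimensional modules *)

Section Pairing.
Variables (k : fieldType) (H : hopfAlgebra k).
Local Notation Δ := (@comul k H).
Local Notation ε := (@counit k H).
Local Notation S := (@antipode k H).

Lemma fin_dim_dual_basis (V : ydModule H) : fin_dim V ->
  exists n (e : 'I_n -> V) (e' : 'I_n -> V -> k^o),
    (forall i, linear (e' i)) /\ forall v, v = \sum_i (e' i v : k) *: e i.
Proof.
move=> [s sV]; pose e (i : 'I_(size s)) := tnth (in_tuple s) i.
have [e' [le' eE]] := span_coord e.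
exists (size s), e, e'; split=> // v; apply: eE.
have : lspan [set` s] v by rewrite sV.
apply: lspan_sub => [|x xs]; first exact: submod_lspan.
apply: lspan_gen; have /tnthP[i ->] : x \in in_tuple s by [].
by exists i.
Qed.

Section Dual.
Variables (V : ydModule H) (D : lmodType k) (ev : D -> V -> k^o).
Hypothesis be : bilin ev.
Hypothesis perfect : forall phi : {linear V -> k^o}, exists! f, ev f = phi.
Hypothesis Vfin : fin_dim V.

Lemma pairing_ex (phi : V -> k^o) : linear phi -> exists f, forall v, ev f v = phi v.
Proof.
by move=> /linear_pack[F ->]; have [f [ef _]] := perfect F; exists f => v; rewrite ef.
Qed.

Lemma pairing_injl f g : (forall v, ev f v = ev g v) -> f = g.
Proof.
move=> fg; have [F FE] := linear_pack (be.2 f); have [f' [_ uf]] := perfect F.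
by rewrite -(uf f)// -(uf g)// -FE; apply/funext => v; rewrite fg.
Qed.

Lemma pairing_injr u v : (forall f, ev f u = ev f v) -> u = v.
Proof.
move=> uv; apply/eqP; rewrite -subr_eq0; apply/eqP; apply: functional_sep => phi lphi.
have [f fE] := pairing_ex lphi.
by rewrite (linB lphi) -!fE uv subrr.
Qed.

Lemma pairing_dual_basis : exists n (e : 'I_n -> V) (e' : 'I_n -> D),
  (forall v, v = \sum_i (ev (e' i) v : k) *: e i) /\
  (forall f, f = \sum_i (ev f (e i) : k) *: e' i).
Proof.
have [n [e [e' [le' eE]]]] := fin_dim_dual_basis Vfin.
have [f fE] := choice (fun i => pairing_ex (le' i)).
have eE' v : v = \sum_i (ev (f i) v : k) *: e i.
  by rewrite [LHS]eE; apply: eq_bigr => i _; rewrite fE.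
exists n, e, f; split=> // g; apply: pairing_injl => v.
rewrite (lin_sum _ _ _ (be.1 v)) [in LHS](eE' v) (lin_sum _ _ _ (be.2 g)).
apply: eq_bigr => i _; rewrite (linZ (be.2 g)) (linZ (be.1 v)).
by rewrite /GRing.scale /= mulrC.
Qed.

Lemma pairing_reflexive (phi : D -> k^o) : linear phi ->
  exists v, forall f, ev f v = phi f.
Proof.
move=> lphi; have [n [e [e' [_ fE]]]] := pairing_dual_basis.
exists (\sum_i (phi (e' i) : k) *: e i) => f.
rewrite (lin_sum _ _ _ (be.2 f)) [in RHS](fE f) (lin_sum _ _ _ lphi).
apply: eq_bigr => i _; rewrite (linZ (be.2 f)) (linZ lphi).
by rewrite /GRing.scale /= mulrC.
Qed.

Lemma pairing_tensor_ext (U : lmodType k) (z z' : (U ⊗ D)%type) :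
  (forall v, \tsum_(u, f <- z) (ev f v : k) *: u = \tsum_(u, f <- z') (ev f v : k) *: u) ->
  z = z'.
Proof.
have [n [e [e' [_ fE]]]] := pairing_dual_basis.
have zE (t : (U ⊗ D)%type) :
    t = \sum_i (\tsum_(u, f <- t) (ev f (e i) : k) *: u) ⊗ e' i.
  rewrite -[LHS]tsum_id; transitivity
    (\tsum_(u, f <- t) \sum_i ((ev f (e i) : k) *: u) ⊗ e' i).
    apply: eq_tsum => u f; rewrite [in LHS](fE f) (lin_sum _ _ _ ((ten_bilin _ _).2 u)).
    apply: eq_bigr => i _; rewrite (linZ ((ten_bilin _ _).2 u)).
    by rewrite (linZ ((ten_bilin _ _).1 _)).
  rewrite tsum_bigsum; apply: eq_bigr => i _.
  by rewrite (tsum_comp (F := fun u => u ⊗ e' i))//; linr.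
by move=> zz; rewrite (zE z) (zE z'); apply: eq_bigr => i _; rewrite zz.
Qed.

End Dual.
End Pairing.

Section DualModule.
Variables (k : fieldType) (H : hopfAlgebra k).
Local Notation Δ := (@comul k H).
Local Notation ε := (@counit k H).
Local Notation S := (@antipode k H).
Variable Si : H -> H.
Hypotheses (SK : cancel S Si) (SiK : cancel Si S).

Let lSi : linear Si := Si_linear SK SiK.

Lemma perfect_pairing_exists (V : lmodType k) :
  exists (D : lmodType k) (ev : D -> V -> k^o), bilin ev /\
    forall phi : {linear V -> k^o}, exists! f, ev f = phi.
Proof.
pose A := [set f : V -> k^o | linear f].
have sA : submod A.
  split; first by move=> a x y; rewrite /= scaler0 addr0.
  move=> a f g lf lg b x y; rewrite /= !fctE lf lg scalerDr.
  rewrite addrACA scalerDr; congr (_ + _).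
  by rewrite !scalerA mulrC.
have [D [i [li iI iA]]] := subspace_exists sA.
exists D, i; split.
  split=> [v a f g|f]; first by rewrite li.
  by have : A (i f) by rewrite -iA; exists f.
move=> phi; have : A phi by move=> a x y; rewrite linearP.
rewrite -iA => -[f _ fphi]; exists f; split=> // g gphi.
by apply: iI; rewrite fphi gphi.
Qed.

(** The action is the transpose of S, the coaction is written in a dual basis. Through [cE], [cEG]
    and [pairing_tensor_ext] its axioms are checked on evaluations at vectors of V. *)
Lemma dual_exists (V : ydModule H) : fin_dim V ->
  exists D : ydModule H, yd_left_dual V D.
Proof.
move=> Vfin; have [D [ev [be perfect]]] := perfect_pairing_exists V.
have inj := pairing_injl be perfect.
have [n [e [e' [eE fE]]]] := pairing_dual_basis be perfect Vfin.
have lS : linear S by linr.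
have bV := act_bilin V.
have ex h f : exists g, forall v, ev g v = ev f (act (S h) v).
  by apply: (pairing_ex perfect); linr.
have [act0 act0E] := choice (fun p : H * D => ex p.1 p.2).
pose actD h f := act0 (h, f).
have actE h f v : ev (actD h f) v = ev f (act (S h) v) by exact: act0E.
have bact : bilin actD.
  split=> [f a x y|h a x y]; apply: inj => v; rewrite (be.1 v) !actE.
    by rewrite lS bV.1 (be.2 f).
  by rewrite (be.1 _).
have act1D f : actD 1 f = f by apply: inj => v; rewrite actE antipode1 act1.
have actMD g h f : actD (g * h) f = actD g (actD h f).
  by apply: inj => v; rewrite !actE antipodeM actM.
pose c f : (H ⊗ D)%type :=
  \sum_i \tsum_(h, v0 <- coact (e i)) (ev f v0 : k) *: (Si h ⊗ e' i).
have lc : linear c.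
  by rewrite /c; apply: lin_bigsum => i; linr.
pose cD : {linear D -> (H ⊗ D)%type} :=
  HB.pack c (GRing.isLinear.Build k D (H ⊗ D)%type *:%R c lc).
have cE f v : \tsum_(g, f0 <- cD f) (ev f0 v : k) *: g =
    \tsum_(h, v0 <- coact v) (ev f v0 : k) *: Si h.
  have b : bilin (fun (h : H) (f0 : D) => (ev f0 v : k) *: h) by blin.
  rewrite /= /c (lin_sum _ _ _ (tsum_linear b)).
  have lr : linear (fun v => \tsum_(h, v0 <- coact v) (ev f v0 : k) *: Si h) by linr.
  rewrite [in RHS](eE v) (lin_sum _ _ _ lr); apply: eq_bigr => i _.
  rewrite (linZ lr) tsum_tsum// -tsumZ; apply: eq_tsum => h v0.
  by rewrite (linZ (tsum_linear b)) tsum_ten// !scalerA mulrC.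
have cEG (W : lmodType k) (G : H -> W) f v : linear G ->
    \tsum_(g, f0 <- cD f) (ev f0 v : k) *: G g =
    \tsum_(h, v0 <- coact v) (ev f v0 : k) *: G (Si h).
  move=> lG; have := cE f v => /(congr1 G); rewrite !(tsum_comp _ _ lG) => e1.
  transitivity (\tsum_(x, y <- cD f) G ((ev y v : k) *: x)).
    by apply: eq_tsum => *; rewrite (linZ lG).
  by rewrite e1; apply: eq_tsum => *; rewrite (linZ lG).
have ext := pairing_tensor_ext be perfect Vfin.
have lcD : linear cD by [].
have coass f : \tsum_(h, f0 <- cD f) \tsum_(h1, h2 <- Δ h) h1 ⊗ (h2 ⊗ f0) =
    \tsum_(h, f0 <- cD f) h ⊗ cD f0.
  (* Reassociation makes D the last factor, so that it can be evaluated at v. *)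
  pose asc (z : (H ⊗ (H ⊗ D))%type) : ((H ⊗ H) ⊗ D)%type :=
    \tsum_(h1, y <- z) \tsum_(h2, f0 <- y) (h1 ⊗ h2) ⊗ f0.
  pose asc' (z : ((H ⊗ H) ⊗ D)%type) : (H ⊗ (H ⊗ D))%type :=
    \tsum_(y, f0 <- z) \tsum_(h1, h2 <- y) h1 ⊗ (h2 ⊗ f0).
  have las : linear asc by rewrite /asc; linr.
  have las' : linear asc' by rewrite /asc'; linr.
  have ascK : cancel asc asc'.
    apply: (tensor_eq (f := fun z => asc' (asc z))) => [|//|h1]; first by linr.
    apply: (tensor_eq (f := fun y => asc' (asc (h1 ⊗ y)))) => [||h2 f0]; [by linr|by linr|].
    by rewrite /asc /asc' !tsum_ten//; blin.
  have ascE h1 h2 f0 : asc (h1 ⊗ (h2 ⊗ f0)) = (h1 ⊗ h2) ⊗ f0.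
    by rewrite /asc !tsum_ten//; blin.
  apply: (can_inj ascK); apply: ext => v.
  have b : bilin (fun (y : (H ⊗ H)%type) (f0 : D) => (ev f0 v : k) *: y) by blin.
  rewrite !(tsum_comp _ _ las) !tsum_tsum//.
  transitivity (\tsum_(h, f0 <- cD f) (ev f0 v : k) *: Δ h).
    apply: eq_tsum => h f0; rewrite (tsum_comp _ _ las) tsum_tsum//.
    under eq_tsum => h1 h2 do rewrite ascE tsum_ten//.
    by rewrite tsumZ tsum_id.
  rewrite cEG; last by linr.
  transitivity (\tsum_(h, v0 <- coact v) \tsum_(h1, h2 <- Δ h)
     (ev f v0 : k) *: (Si h2 ⊗ Si h1)).
    apply: eq_tsum => h v0; rewrite tsumZ; congr (_ *: _).
    by rewrite -[LHS]tsum_id comul_SiE//; blin.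
  rewrite (coactA (F := fun h1 h2 v0 => (ev f v0 : k) *: (Si h2 ⊗ Si h1))); last by tlin.
  transitivity (\tsum_(h, f0 <- cD f) h ⊗ \tsum_(g, v0 <- coact v) (ev f0 v0 : k) *: Si g).
    transitivity (\tsum_(g, v0 <- coact v)
        (\tsum_(h, f0 <- cD f) (ev f0 v0 : k) *: h) ⊗ Si g).
      apply: eq_tsum => g v0; rewrite cE (tsum_comp (F := fun h => h ⊗ Si g)); last by linr.
      by apply: eq_tsum => h v1; rewrite (linZ ((ten_bilin _ _).1 _)).
    transitivity (\tsum_(g, v0 <- coact v) \tsum_(h, f0 <- cD f)
        (ev f0 v0 : k) *: (h ⊗ Si g)).
      apply: eq_tsum => g v0; rewrite (tsum_comp (F := fun h => h ⊗ Si g)); last by linr.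
      by apply: eq_tsum => h v1; rewrite (linZ ((ten_bilin _ _).1 _)).
    rewrite tsum_exch; apply: eq_tsum => h f0.
    rewrite (tsum_comp _ _ ((ten_bilin _ _).2 h)).
    by apply: eq_tsum => *; rewrite (linZ ((ten_bilin _ _).2 _)).
  apply: eq_tsum => h f0; rewrite -cE (tsum_comp _ _ ((ten_bilin _ _).2 h)).
  rewrite -[cD f0 in RHS]tsum_id !(tsum_comp _ _ ((ten_bilin _ _).2 h)).
  rewrite (tsum_comp _ _ las) tsum_tsum//; apply: eq_tsum => g f1.
  by rewrite ascE tsum_ten// (linZ ((ten_bilin _ _).2 _)).
have cou f : \tsum_(h, f0 <- cD f) (ε h : k) *: f0 = f.
  apply: inj => v; rewrite (tsum_comp _ _ (be.1 v)).
  transitivity (\tsum_(h, f0 <- cD f) (ev f0 v : k) *: (ε h : k^o)).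
    by apply: eq_tsum => *; rewrite (linZ (be.1 v)) /GRing.scale /= mulrC.
  rewrite (cEG _ (fun h => ε h : k^o)); last by linr.
  rewrite -[RHS](coact_counitE (G := fun v => ev f v)); last by linr.
  by apply: eq_tsum => *; rewrite (counitSi SiK) /GRing.scale /= mulrC.
have comp h f : cD (actD h f) =
  \tsum_(h1, h23 <- Δ h) \tsum_(h2, h3 <- Δ h23) \tsum_(g, f0 <- cD f)
    (h1 * g * S h3) ⊗ actD h2 f0.
  apply: ext => v; have b : bilin (fun (g : H) f0 => (ev f0 v : k) *: g) by blin.
  rewrite cE tsum_tsum//.
  under [RHS]eq_tsum => h1 h23 do rewrite tsum_tsum//.
  (* Both sides become sums of values of [P]; then [a3 * S h3] on the right and [h1 * S a1] on the
     left cancel. *)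
  pose P x y z := \tsum_(g, v0 <- coact v) (ev f (act (S y) v0) : k) *: (x * Si g * z).
  have lP1 y z : linear (fun x => P x y z) by rewrite /P; linr.
  have lP3 x y : linear (fun z => P x y z) by rewrite /P; linr.
  transitivity (\tsum_(h1, y <- Δ h) \tsum_(h2, h3 <- Δ y)
     \tsum_(q, a3 <- Δ h2) \tsum_(a1, a2 <- Δ q) P (h1 * S a1) a2 (a3 * S h3)); last first.
    apply: eq_tsum => h1 y; apply: eq_tsum => h2 h3; rewrite tsum_tsum//.
    transitivity (\tsum_(g, f0 <- cD f) (ev f0 (act (S h2) v) : k) *: (h1 * g * S h3));
      last by apply: eq_tsum => *; rewrite tsum_ten// actE.
    rewrite (cEG _ (fun g => h1 * g * S h3)); last by linr.
    rewrite coact_actE; last by blin.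
    rewrite comul_antipodeE; last by blin.
    apply: eq_tsum => q a3; rewrite comul_antipodeE; last by blin.
    apply: eq_tsum => a1 a2; rewrite /P; apply: eq_tsum => g v0.
    by rewrite !(SiM SK SiK) !SK !mulrA.
  transitivity (\tsum_(h1, y <- Δ h) \tsum_(a1, a2 <- Δ y) P (h1 * S a1) a2 1).
    rewrite -(comulA (F := fun h1 a1 a2 => P (h1 * S a1) a2 1)); last by rewrite /P; tlin.
    transitivity (\tsum_(z, a2 <- Δ h) (ε z : k) *: P 1 a2 1).
      rewrite counit_lE; last by rewrite /P; linr.
      by apply: eq_tsum => g v0; rewrite actE mul1r mulr1.
    apply: eq_tsum => z a2.
    by rewrite (antipode_rE (G := fun x => P x a2 1)).
  apply: eq_tsum => h1 y.
  rewrite (comulA (F := fun q a3 h3 => \tsum_(a1, a2 <- Δ q)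
     P (h1 * S a1) a2 (a3 * S h3))); last by rewrite /P; tlin.
  rewrite -[LHS](counit_rE (G := fun q => \tsum_(a1, a2 <- Δ q) P (h1 * S a1) a2 1));
    last by rewrite /P; linr.
  apply: eq_tsum => q u; rewrite tsum_exch -tsumZ; apply: eq_tsum => a1 a2.
  by rewrite (antipode_rE (G := fun z => P (h1 * S a1) a2 z)).
exists (YDModule bact act1D actMD coass cou comp), ev; split=> // f v.
rewrite -[coact f]/(cD f) cEG; last by linr.
by apply: eq_tsum => g v0; rewrite SiK.
Qed.

End DualModule.

(** * Irreducibility of the dual, and V as the left dual of its left dual *)

Section LeftDual.
Variables (k : fieldType) (H : hopfAlgebra k).
Local Notation Δ := (@comul k H).
Local Notation ε := (@counit k H).
Local Notation S := (@antipode k H).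
Variable Si : H -> H.
Hypotheses (SK : cancel S Si) (SiK : cancel Si S).
Let lSi : linear Si := Si_linear SK SiK.

Variables (V D : ydModule H) (ev : D -> V -> k^o).
Hypothesis be : bilin ev.
Hypothesis perfect : forall phi : {linear V -> k^o}, exists! f, ev f = phi.
Hypothesis ev_act : forall h f v, ev (act h f) v = ev f (act (S h) v).
Hypothesis ev_coact : forall f v, \tsum_(g, f0 <- coact f) (ev f0 v : k) *: S g =
                                  \tsum_(g, v0 <- coact v) (ev f v0 : k) *: g.
Hypothesis Vfin : fin_dim V.

Lemma dual_fin_dim : fin_dim D.
Proof.
have [n [e [e' [_ fE]]]] := pairing_dual_basis be perfect Vfin.
exists [seq e' i | i <- enum 'I_n]; apply/seteqP; split=> // f _.
rewrite (fE f); apply: submod_sum => [|i _]; first exact: submod_lspan.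
apply: (submodZ (submod_lspan _)); apply: lspan_gen.
by rewrite /= map_f// mem_enum.
Qed.

(** The annihilator P in V of a submodule A of D is a submodule, hence 0 or V, and then A is D or
    0. *)
Lemma dual_irreducible : yd_irreducible V -> yd_irreducible D.
Proof.
move=> [[v0 v0n] Virr]; split.
  have [[f fn]|nf] := pselect (exists f : D, f != 0); first by exists f.
  exfalso; move/eqP: v0n; apply; apply: (pairing_injr perfect) => f.
  have -> : f = 0 by apply/eqP/negP => /negP fn; apply: nf; exists f.
  by rewrite !(linear_at0 (be.1 _)).
move=> A yA; have [sA Ah Ac] := (yd_submodP A).1 yA.
pose P := [set v : V | forall f, A f -> ev f v = 0].
have yP : yd_submod P.
  apply/yd_submodP; split.
  - split=> [f _|a x y Px Py f Af]; first exact: linear_at0 (be.2 f).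
    by rewrite (be.2 f) Px// Py// scaler0 addr0.
  - by move=> h v Pv f Af; rewrite -(SiK h) -ev_act; apply/Pv/Ah.
  - move=> phi v lphi Pv f Af; rewrite (tsum_comp _ _ (be.2 f)).
    have b : bilin (fun (g : H) (f0 : D) => (ev f0 v : k) *: S g) by blin.
    have e : \tsum_(g, v0 <- coact v) (ev f v0 : k) *: g = 0.
      rewrite -ev_coact; apply: (tsum_in (submod0 _) b (yd_submod_coact yA Af)).
      by move=> g f0 Af0; rewrite Pv// scale0r.
    have := e => /(congr1 phi); rewrite (linear_at0 lphi) (tsum_comp _ _ lphi) => <-.
    apply: eq_tsum => g v1; rewrite (linZ (be.2 f)) (linZ lphi).
    by rewrite /GRing.scale /= mulrC.
have [P0|PT] := Virr P yP; [right|left]; apply/seteqP; split=> //.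
(* P = 0: by reflexivity, a form on D that vanishes on A is evaluation at some v, and v lies in
   P. *)
- move=> f _; have [e [le Ae _]] := projector sA.
  apply/Ae; apply: functional_sep => phi lphi.
  have lpe : linear (fun f => phi (e f)) by linr.
  have [v vE] := pairing_reflexive be perfect Vfin lpe.
  have : P v by move=> g /Ae ge; rewrite vE ge (linear_at0 lphi).
  by rewrite P0 -vE => ->; apply: linear_at0 (be.2 f).
- move=> f Af; apply: (pairing_injl be perfect) => v.
  have : P v by rewrite PT.
  by move=> /(_ f Af) ->; rewrite (linear_at0 (be.1 v)).
- by move=> _ ->; case: sA.
Qed.

(** [sigma] and [tau] are mutually inverse, and [sigma] intertwines action and coaction with their
    twists by S^2. They account for the difference between [ev] and [dual_ev]. *)
Definition sigma (f : D) : D := \tsum_(g, f0 <- coact f) act (S g) f0.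
Definition tau (f : D) : D := \tsum_(g, f0 <- coact f) act (Si (Si g)) f0.

Lemma sigma_linear : linear sigma.
Proof. by rewrite /sigma; linr. Qed.

Lemma sigma_act h f : sigma (act h f) = act (S (S h)) (sigma f).
Proof.
rewrite /sigma coact_actE; last by blin.
pose F x z := \tsum_(g, f0 <- coact f) act (S (S z) * S g * x) f0.
transitivity (\tsum_(x, h3 <- Δ h) \tsum_(h1, h2 <- Δ x) F (S h1 * h2) h3).
  rewrite comulA; last by rewrite /F; tlin.
  do 2!apply: eq_tsum => ? ?; rewrite /F; apply: eq_tsum => g f0.
  by rewrite -actM !antipodeM !mulrA.
transitivity (\tsum_(x, h3 <- Δ h) (ε x : k) *: F 1 h3).
  by apply: eq_tsum => x h3; rewrite (antipode_lE (G := F^~ h3))//; rewrite /F; linr.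
rewrite counit_lE; last by rewrite /F; linr.
rewrite /F (tsum_comp (F := act (S (S h)))); last by linr.
by apply: eq_tsum => g f0; rewrite mulr1 actM.
Qed.

Lemma sigmaK f : sigma (tau f) = f.
Proof.
rewrite /tau (tsum_comp _ _ sigma_linear).
pose F (x : H) (f1 : D) := act x f1.
transitivity (\tsum_(g, f0 <- coact f) \tsum_(g', f1 <- coact f0) F (g * S g') f1).
  apply: eq_tsum => g f0; rewrite sigma_act !SiK /sigma (tsum_comp (F := act g)).
    by apply: eq_tsum => *; rewrite /F actM.
  by linr.
rewrite -(coactA (F := fun g g' f1 => F (g * S g') f1)); last by rewrite /F; tlin.
transitivity (\tsum_(q, f1 <- coact f) (ε q : k) *: f1); last exact: coact_counit.
apply: eq_tsum => q f1; rewrite (antipode_rE (G := F^~ f1)).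
  by rewrite /F act1.
by rewrite /F; linr.
Qed.

Let dev := dual_ev Si ev.

Lemma dual_ev_tau u f : dev u f = ev (tau f) u.
Proof.
rewrite /dev /dual_ev /tau (tsum_comp _ _ (be.1 u)); apply: eq_tsum => g f0.
by rewrite ev_act SiK.
Qed.

Lemma sigma_coactE (W : lmodType k) (b : H -> D -> W) f : bilin b ->
  \tsum_(g, f0 <- coact (sigma f)) b g f0 =
  \tsum_(g, f0 <- coact f) b (S (S g)) (sigma f0).
Proof.
move=> bb; pose L f := \tsum_(g, f0 <- coact f) b g f0.
have lL : linear L by rewrite /L; linr.
rewrite -[LHS]/(L _) {1}/sigma (tsum_comp _ _ lL) /L.
pose K c1 c2 x f1 := b (x * S (S c1)) (act (S c2) f1).
pose M b1 b2 f0 := \tsum_(c1, c2 <- Δ b1) \tsum_(c, f1 <- coact f0) K c1 c2 (S b2 * c) f1.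
transitivity (\tsum_(g, f0 <- coact f) \tsum_(b1, b2 <- Δ g) M b1 b2 f0).
  apply: eq_tsum => g f0; rewrite coact_actE//.
  rewrite comul_antipodeE; last by blin.
  apply: eq_tsum => b1 b2; rewrite comul_antipodeE; last by blin.
  by apply: eq_tsum => c1 c2.
rewrite (coactA (F := M)); last by rewrite /M /K; tlin.
transitivity (\tsum_(b1, f' <- coact f) \tsum_(c1, c2 <- Δ b1) K c1 c2 1 f').
  apply: eq_tsum => b1 f'; rewrite /M tsum_exch; apply: eq_tsum => c1 c2.
  rewrite -(coactA (F := fun b2 c f1 => K c1 c2 (S b2 * c) f1)); last by rewrite /K; tlin.
  transitivity (\tsum_(q, f1 <- coact f') (ε q : k) *: K c1 c2 1 f1).
    apply: eq_tsum => q f1.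
    by rewrite (antipode_lE (G := fun x => K c1 c2 x f1))//; rewrite /K; linr.
  by rewrite coact_counitE//; rewrite /K; linr.
rewrite (coactA (F := fun c1 c2 f' => K c1 c2 1 f')); last by rewrite /K; tlin.
apply: eq_tsum => g f0; rewrite /sigma (tsum_comp (F := b (S (S g)))).
  by apply: eq_tsum => c2 f1; rewrite /K mul1r.
exact: bb.2.
Qed.

Lemma tauK f : tau (sigma f) = f.
Proof.
apply: (pairing_injl be perfect) => u; rewrite -dual_ev_tau.
have ld : linear (dev u) by apply: (dual_ev_bilin SK SiK be).2.
rewrite /sigma (tsum_comp _ _ ld).
exact: (dual_ev_sigma SK SiK be ev_act).
Qed.

(** The i-th coordinate of r_i^2 = id. The rules for [dual_ev] follow from those for [ev] by way of
    [sigma] and [tau]. *)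
Lemma dual_ev_left_dual :
  [/\ bilin dev, forall phi : {linear D -> k^o}, exists! u, dev u = phi,
      forall h u f, dev (act h u) f = dev u (act (S h) f) &
      forall u f, \tsum_(g, u0 <- coact u) (dev u0 f : k) *: S g =
                  \tsum_(g, f0 <- coact f) (dev u f0 : k) *: g].
Proof.
split.
- exact: (dual_ev_bilin SK SiK be).
- move=> phi; have lps : linear (fun f => phi (sigma f)).
    by have ls := sigma_linear; linr.
  have [v vE] := pairing_reflexive be perfect Vfin lps.
  exists v; split; first by apply/funext => f; rewrite dual_ev_tau vE sigmaK.
  move=> w wE; apply: (pairing_injr perfect) => f.
  by rewrite -[f]tauK -!dual_ev_tau wE dual_ev_tau vE sigmaK.
- exact: (dual_ev_act SK SiK be ev_act).
- move=> u f; rewrite -[f]sigmaK; move: (tau f) => {}f.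
  have ls := sigma_linear; have bd := dual_ev_bilin SK SiK be; rewrite -/dev in bd.
  rewrite sigma_coactE; last by blin.
  transitivity (S (\tsum_(g, f0 <- coact f) (ev f0 u : k) *: S g)).
    rewrite ev_coact (tsum_comp (F := S)); last by linr.
    by apply: eq_tsum => g u0; rewrite linearZ dual_ev_tau tauK.
  rewrite (tsum_comp (F := S)); last by linr.
  by apply: eq_tsum => g f0; rewrite linearZ dual_ev_tau tauK.
Qed.

End LeftDual.

Section DualUnique.
Variables (k : fieldType) (H : hopfAlgebra k) (Si : H -> H).
Hypotheses (SK : cancel (@antipode k H) Si) (SiK : cancel Si (@antipode k H)).
Local Notation S := (@antipode k H).

Lemma left_dual_unique (V D D' : ydModule H) : fin_dim V ->
  yd_left_dual V D -> yd_left_dual V D' -> yd_iso D D'.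
Proof.
move=> Vfin [ev [be perf ea ec]] [ev' [be' perf' ea' ec']].
have inj := pairing_injl be perf; have inj' := pairing_injl be' perf'.
have ex f : exists f', forall v, ev' f' v = ev f v.
  exact: (pairing_ex perf' (be.2 f)).
have [F FE] := choice ex.
have ex' f' : exists f, forall v, ev f v = ev' f' v.
  exact: (pairing_ex perf (be'.2 f')).
have [G GE] := choice ex'.
have lF : linear F by move=> b x y; apply: inj' => v; rewrite (be'.1 v) !FE (be.1 v).
exists F; split=> //.
- by exists G => f; [apply: inj => v; rewrite GE FE|apply: inj' => v; rewrite FE GE].
- by move=> h f; apply: inj' => v; rewrite FE ea ea' FE.
move=> f; apply: (pairing_tensor_ext be' perf' Vfin) => v.
have b : bilin (fun (g : H) f0 => (ev' f0 v : k) *: g) by blin.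
rewrite tsum_tsum//; apply: (can_inj SK).
have lS : linear S by linr.
rewrite !(tsum_comp _ _ lS).
transitivity (\tsum_(g, f0 <- coact (F f)) (ev' f0 v : k) *: S g).
  by apply: eq_tsum => *; rewrite linearZ.
rewrite ec'; transitivity (\tsum_(g, v0 <- coact v) (ev f v0 : k) *: g).
  by apply: eq_tsum => *; rewrite FE.
by rewrite -ec; apply: eq_tsum => *; rewrite tsum_ten// linearZ FE.
Qed.

End DualUnique.

(** * Reflections *)

Section Isomorphisms.
Variables (k : fieldType) (H : hopfAlgebra k).
Implicit Types V W D E : ydModule H.

Lemma yd_lin_factor V W E (f : V -> E) (g : W -> E) :
  yd_lin f -> yd_lin g -> injective g -> range f `<=` range g ->
  exists F : V -> W, yd_lin F /\ forall v, g (F v) = f v.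
Proof.
move=> [lf fh fc] [lg gh gc] gI fg.
have ex v : exists w, g w = f v.
  by have [|w _ <-] := fg (f v); [exists v|exists w].
have [F FE] := choice ex; exists F; split=> //.
have lF : linear F by move=> b x y; apply: gI; rewrite lg !FE lf.
split=> // [h v|v]; first by apply: gI; rewrite gh !FE fh.
have [r [lr rg]] := lin_retract lg gI.
have K (U : lmodType k) : cancel (fun z : (U ⊗ W)%type => \tsum_(h, w <- z) h ⊗ g w)
    (fun z : (U ⊗ E)%type => \tsum_(h, w <- z) h ⊗ r w).
  move=> z; rewrite tsum_tsum; last by blin.
  rewrite -[RHS]tsum_id; apply: eq_tsum => h w.
  by rewrite tsum_ten ?rg//; blin.
apply: (can_inj (K _)); rewrite -gc FE fc tsum_tsum; last by blin.
by apply: eq_tsum => h v0; rewrite tsum_ten ?FE//; blin.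
Qed.

Lemma yd_lin_id V : yd_lin (fun v : V => v).
Proof. by split=> // v; rewrite tsum_id. Qed.

Lemma yd_lin_comp V W E (f : W -> E) (g : V -> W) :
  yd_lin f -> yd_lin g -> yd_lin (fun v => f (g v)).
Proof.
move=> yf yg; have [lf fh fc] := yf; have [lg gh gc] := yg.
split=> [|h v|v]; [exact: lin_comp lf lg|by rewrite gh fh|].
by rewrite fc (yd_lin_coactE _ yg)//; blin.
Qed.

Lemma yd_isoP V W : yd_iso V W <-> exists f : V -> W, yd_lin f /\ bijective f.
Proof.
by split=> [[f [lf bf fh fc]]|[f [[lf fh fc] bf]]]; exists f.
Qed.

Lemma same_range_iso V W E (f : V -> E) (g : W -> E) :
  yd_lin f -> injective f -> yd_lin g -> injective g -> range f = range g ->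
  yd_iso V W.
Proof.
move=> yf fI yg gI fg.
have [F [yF FE]] : exists F : V -> W, yd_lin F /\ forall v, g (F v) = f v.
  by apply: yd_lin_factor => //; rewrite fg.
have [G [yG GE]] : exists G : W -> V, yd_lin G /\ forall v, f (G v) = g v.
  by apply: yd_lin_factor => //; rewrite fg.
apply/yd_isoP; exists F; split=> //; exists G => v.
  by apply: fI; rewrite GE FE.
by apply: gI; rewrite FE GE.
Qed.

Lemma yd_iso_refl V : yd_iso V V.
Proof. by apply/yd_isoP; exists id; split; [exact: yd_lin_id|exists id]. Qed.

Lemma yd_iso_sym V W : yd_iso V W -> yd_iso W V.
Proof.
move=> /yd_isoP[f [yf bf]].
apply: (@same_range_iso _ _ W id f) => //; [exact: yd_lin_id|exact: bij_inj|].
by case: bf => g _ fK; apply/seteqP; split=> // w _; exists (g w).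
Qed.

Lemma yd_iso_trans V W E : yd_iso V W -> yd_iso W E -> yd_iso V E.
Proof.
move=> /yd_isoP[f [yf bf]] /yd_isoP[g [yg bg]]; apply/yd_isoP.
by exists (fun v => g (f v)); split; [exact: yd_lin_comp|exact: bij_comp].
Qed.

Lemma rep_fin_dim (C : isoclass H) : fin_dim (rep C).
Proof. by rewrite /rep; case: cid => V [/=]. Qed.

Lemma rep_irr (C : isoclass H) : yd_irreducible (rep C).
Proof. by rewrite /rep; case: cid => V [/=]. Qed.

Lemma sval_rep (C : isoclass H) : sval C = yd_iso (rep C).
Proof. by rewrite /rep; case: cid => V [/=]. Qed.

Lemma isoclass_eq (C C' : isoclass H) : yd_iso (rep C) (rep C') -> C = C'.
Proof.
move=> CC; apply: eq_sig_hprop => [P|]; first exact: Prop_irrelevance.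
rewrite !sval_rep; apply/funext => V; apply/propext; split=> h.
  exact: yd_iso_trans (yd_iso_sym CC) h.
exact: yd_iso_trans CC h.
Qed.

Lemma isoclass_exists V : fin_dim V -> yd_irreducible V ->
  exists C : isoclass H, yd_iso V (rep C).
Proof.
move=> Vfin Virr; have p : exists V', [/\ fin_dim V', yd_irreducible V' & yd_iso V = yd_iso V'].
  by exists V.
pose C : isoclass H := exist _ (yd_iso V) p.
exists C; rewrite -[yd_iso V]/(sval C) sval_rep; exact: yd_iso_refl.
Qed.

Lemma left_dual_iso V D D' : yd_left_dual V D -> yd_iso D D' -> yd_left_dual V D'.
Proof.
move=> [ev [be perf ea ec]] /yd_iso_sym /yd_isoP[f [yf [g gK fK]]].
have [lf fh fc] := yf.
exists (fun d => ev (f d)); split.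
- split=> [v|d]; [exact: lin_comp (be.1 v) lf|exact: be.2].
- move=> phi; have [d [dE ud]] := perf phi; exists (g d); split; first by rewrite fK.
  by move=> d' d'E; rewrite -[d']gK (ud (f d')).
- by move=> h d v; rewrite fh ea.
by move=> d v; rewrite -ec (yd_lin_coactE _ yf)//; blin.
Qed.

Lemma range_irr V E (g : V -> E) : yd_lin g -> yd_irreducible V ->
  forall U, yd_submod U -> U `<=` range g -> U `<=` [set 0] \/ range g `<=` U.
Proof.
move=> yg [_ Virr] U yU Ug; have [lg gh gc] := yg.
have [sU Uh Uc] := (yd_submodP U).1 yU.
have yA : yd_submod (g @^-1` U).
  apply/yd_submodP; split; first exact: (submod_preimage lg sU).
    by move=> h v Uv; rewrite /preimage /= gh; apply: Uh.
  move=> phi v lphi Uv; rewrite /preimage /= (tsum_comp _ _ lg).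
  have := Uc phi _ lphi Uv; rewrite (yd_lin_coactE _ yg); last by blin.
  congr (U _); apply: eq_tsum => h v0; exact/esym/(linZ lg).
have [A0|AT] := Virr _ yA; [left|right].
  move=> y Uy; have [v _ vy] := Ug _ Uy.
  have : (g @^-1` U) v by rewrite /preimage /= vy.
  by rewrite A0 => v0; rewrite -vy v0; apply: linear_at0 lg.
by move=> _ [v _ <-]; have : (g @^-1` U) v by rewrite AT.
Qed.

Lemma irr_range V E (g : V -> E) (X : set E) : yd_lin g -> injective g -> range g = X ->
  ~ X `<=` [set 0] ->
  (forall U, yd_submod U -> U `<=` X -> U `<=` [set 0] \/ X `<=` U) ->
  yd_irreducible V.
Proof.
move=> yg gI gX X0 Xirr; have [lg gh gc] := yg; split.
  apply: contrapT => nv; apply: X0; rewrite -gX => _ [v _ <-].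
  have -> : v = 0 by apply/eqP/negP => /negP v0; apply: nv; exists v.
  exact: linear_at0 lg.
move=> A yA; have [sA Ah Ac] := (yd_submodP A).1 yA.
have yU : yd_submod (g @` A).
  apply/yd_submodP; split; first exact: (submod_image lg sA).
    by move=> h _ [v Av <-]; exists (act h v); [exact: Ah|exact: gh].
  move=> phi _ lphi [v Av <-]; exists (\tsum_(h, v0 <- coact v) (phi h : k) *: v0).
    exact: Ac.
  rewrite (yd_lin_coactE _ yg); last by blin.
  by rewrite (tsum_comp _ _ lg); apply: eq_tsum => *; rewrite (linZ lg).
have UX : g @` A `<=` X by rewrite -gX => _ [v _ <-]; exists v.
have [U0|XU] := Xirr _ yU UX; [left|right]; apply/seteqP; split=> //.
- move=> v Av; apply: gI; rewrite (linear_at0 lg).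
  by apply: U0; exists v.
- by move=> _ ->; case: sA.
- move=> v _; have /XU[w Aw wv] : X (g v) by rewrite -gX; exists v.
  by rewrite -(gI _ _ wv).
Qed.

End Isomorphisms.

(** * The system carried by a Nichols algebra of a direct sum *)

Section NicholsSystem.
Variables (k : fieldType) (H : hopfAlgebra k).
Local Notation Δ := (@comul k H).
Local Notation ε := (@counit k H).
Local Notation S := (@antipode k H).
Variable Si : H -> H.
Hypotheses (SK : cancel S Si) (SiK : cancel Si S).
Let lSi : linear Si := Si_linear SK SiK.

Variables (I : finType) (V_ : I -> ydModule H).
Local Notation V := (ydsum V_).
Local Notation E := (nyd V).
Local Notation inj i := (@ydinj k I H V_ i).

Definition nad i (x : V_ i) (y : E) : E := ad_c (inj i x) y.
Definition ngen i (x : V_ i) : E := nin (inj i x).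
(** The skew derivation for the form on V that is [ev f] on the i-th summand and 0 on the others. *)
Definition nder (D : ydModule H) i (ev : D -> V_ i -> k^o) (f : D) (y : E) : E :=
  nd (fun u : V => ev f (u i)) y.

Lemma ngen_yd_lin i : yd_lin (@ngen i).
Proof.
have yi := ydinj_yd_lin V_ i; have [li lh lc] := yi.
split.
- exact: lin_comp (@nin_linear _ _ _) li.
- by move=> h v; rewrite /ngen lh; apply: (esym (nact_nin _ _)).
- move=> v; rewrite -[LHS]tsum_id /= ncoact_ninE; last exact: ten_bilin.
  by rewrite (yd_lin_coactE _ yi)//; blin.
Qed.

Lemma ngen_inj i : injective (@ngen i).
Proof. by move=> x y /nin_inj/ydinj_injective. Qed.

Lemma nad_yd_bimap i : yd_bimap (@nad i).
Proof.
have yi := ydinj_yd_lin V_ i; have [li lh lc] := yi.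
split; first by rewrite /nad; split=> ?; linr.
  move=> h v y; rewrite /nad [LHS]ad_c_act; apply: eq_tsum => h1 h2.
  by rewrite lh.
move=> v y; rewrite -[LHS]tsum_id /= ad_c_coactE; last exact: ten_bilin.
by rewrite (yd_lin_coactE _ yi)//; blin.
Qed.

Section Der.
Variables (D : ydModule H) (i : I) (ev : D -> V_ i -> k^o).
Hypothesis be : bilin ev.
Hypothesis perfect : forall phi : {linear V_ i -> k^o}, exists! f, ev f = phi.
Hypothesis ev_act : forall h f v, ev (act h f) v = ev f (act (S h) v).
Hypothesis ev_coact : forall f v, \tsum_(g, f0 <- coact f) (ev f0 v : k) *: S g =
                                  \tsum_(g, v0 <- coact v) (ev f v0 : k) *: g.

Let lev f : linear (fun u : V => ev f (u i)).
Proof. exact: (lin_comp (be.2 f) (@ydcomp_linear _ _ _ V_ i)). Qed.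

Lemma nder_bilin : bilin (nder ev).
Proof.
split=> [y b f g|f]; last exact: nd_linear.
rewrite /nder /nd -tsumZ -tsumD; apply: eq_tsum => u z.
by rewrite (be.1 (u i)) scalerDl scalerA.
Qed.

Lemma nder_act_ev h f : (fun u : V => ev f ((act h u : V) i)) =
  (fun u : V => ev (act (Si h) f) (u i)).
Proof. by apply/funext => u; rewrite ev_act SiK. Qed.

(** An instance of [nd_ad]. Composing the form with the action of g amounts to letting S^-1(g) act
    on f, whence [Si] in [adsys]. *)
Lemma nichols_adsys : adsys Si ev (@nad i) (nder ev).
Proof.
have yi := ydinj_yd_lin V_ i; have [li lh lc] := yi.
split=> //; [exact: nad_yd_bimap|exact: nder_bilin|].
move=> f x y; pose psi (u : V) : k^o := ev f (u i).
have lp : linear psi by exact: lev.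
have psiE z : psi (inj i z) = ev f z by rewrite /psi ydinj_in.
rewrite -[LHS]/(nd psi (nad x y)) /nad nd_ad// psiE.
congr (_ - _ + _).
  rewrite (yd_lin_coactE _ yi); last by blin.
  apply: eq_tsum => g x0; apply: eq_tsum => h y0.
  by rewrite -lh psiE.
rewrite (yd_lin_coactE _ yi); last first.
  split=> [u|g]; last by linr.
  move=> b g h; rewrite /psi !nder_act_ev lSi (act_bilin D).1.
  have bd := nder_bilin; rewrite -![nd _ _]/(nder ev _ y).
  by rewrite (bd.1 y) (ad_c_bilin V).2.
by apply: eq_tsum => g x0; rewrite /psi nder_act_ev.
Qed.

Lemma nder_yd_bimap : yd_bimap (nder ev).
Proof.
have bd := nder_bilin; split=> // [h f y|f y].
  pose F z b := act b (nder ev (act (Si z) f) y) : E.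
  transitivity (\tsum_(h1, u <- Δ h) \tsum_(x, z <- Δ u) F (S h1 * x) z); last first.
    apply: eq_tsum => h1 h2; rewrite /nder nd_act//.
    apply: eq_tsum => x z; rewrite /F SiM// SK actM.
    by rewrite nder_act_ev.
  rewrite -(comulA (F := fun h1 x z => F (S h1 * x) z)); last by rewrite /F; tlin.
  transitivity (\tsum_(x, z <- Δ h) (ε x : k) *: F 1 z).
    rewrite counit_lE; last by rewrite /F; linr.
    by rewrite /F (Si1 SK SiK) act1.
  by apply: eq_tsum => x z; rewrite (antipode_lE (G := F^~ z))//; rewrite /F; linr.
pose K (g c h : H) (z0 : E) f0 x0 : (H ⊗ E)%type :=
  (ev f0 x0 : k) *: ((g * c * h) ⊗ z0).
transitivity (\tsum_(x, z <- ndl y) \tsum_(h, z0 <- ncoact z) \tsum_(c, x0 <- coact (x i))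
  \tsum_(g, f0 <- coact f) K g c h z0 f0 x0).
  rewrite -[LHS]/(ncoact (nd _ y)) /nd (tsum_comp _ _ (@ncoact_linear _ _ V)).
  apply: eq_tsum => x z; rewrite (linZ (@ncoact_linear _ _ V)) -[in LHS](tsum_id (ncoact z)).
  rewrite -tsumZ; apply: eq_tsum => h z0.
  pose L q v0 : (H ⊗ E)%type := (ev f v0 : k) *: ((q * h) ⊗ z0).
  transitivity (\tsum_(c, v1 <- coact (x i)) \tsum_(g, v0 <- coact v1) L (Si g * c) v0).
    rewrite -(coactA (F := fun c g v0 => L (Si g * c) v0)); last by rewrite /L; tlin.
    transitivity (\tsum_(q, v0 <- coact (x i)) (ε q : k) *: L 1 v0).
      by rewrite coact_counitE; rewrite /L ?mul1r//; linr.
    by apply: eq_tsum => q v0; rewrite (Si_lE SK SiK (G := L^~ v0))//; rewrite /L; linr.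
  apply: eq_tsum => c v1; rewrite /L /K.
  by rewrite (ev_coactE SK SiK ev_coact (G := fun g => (g * c * h) ⊗ z0))//; linr.
transitivity (\tsum_(g, f0 <- coact f) \tsum_(x, z <- ndl y) \tsum_(c, x0 <- coact x)
   \tsum_(h, z0 <- ncoact z) K g c h z0 f0 (x0 i)).
  rewrite [RHS]tsum_exch; apply: eq_tsum => x z.
  transitivity (\tsum_(c, x0 <- coact x) \tsum_(h, z0 <- ncoact z)
      \tsum_(g, f0 <- coact f) K g c h z0 f0 (x0 i)).
    rewrite [RHS]tsum_exch; apply: eq_tsum => h z0.
    rewrite -(ydsum_coact_comp (i := i) (b := fun c x0 =>
      \tsum_(g, f0 <- coact f) K g c h z0 f0 x0))//.
    by rewrite /K; blin.
  under eq_tsum => c x0 do rewrite tsum_exch.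
  by rewrite tsum_exch.
apply: eq_tsum => g f0.
pose b (h : H) (z : (V ⊗ nichols V)%type) : (H ⊗ nichols V)%type :=
  (g * h) ⊗ (\tsum_(x, b <- z) (ev f0 (x i) : k) *: b).
have bb : bilin b by rewrite /b; blin.
rewrite -[RHS]/(\tsum_(h, y0 <- ncoact y) b h (ndl y0)) ndl_coactE//.
do 3!apply: eq_tsum => ? ?; rewrite /b /K tsum_ten; last by blin.
by rewrite (linZ ((ten_bilin _ _).2 _)) mulrA.
Qed.

Lemma nder_ngen f j (w : V_ j) : j != i -> nder ev f (ngen w) = 0.
Proof.
move=> ji; rewrite /nder /ngen nd_nin// ydinj_out// (linear_at0 (be.2 f)).
exact: scale0r.
Qed.

(** As psi vanishes on V_i, only the last sum in [nd_ad] survives; its derivatives are multiples of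
    1 by induction, and ad_c kills 1. *)
Lemma nd_other (psi : V -> k^o) j n y : linear psi -> (forall x, psi (inj i x) = 0) ->
  adseq (@nad i) (range (@ngen j)) n y ->
  range (fun c : k^o => (c : k) *: n1 V) (nd psi y) /\ ((0 < n)%N -> nd psi y = 0).
Proof.
have yi := ydinj_yd_lin V_ i; have [li lh lc] := yi.
have L0 : range (fun c : k^o => (c : k) *: n1 V) 0 by exists 0 => //; rewrite scale0r.
elim: n psi y => [|n ih] psi y lp psi0.
  by move=> [w _ <-]; split=> //; rewrite /ngen nd_nin//; exists (psi (inj j w)).
suff : adseq (@nad i) (range (@ngen j)) n.+1 `<=` nd psi @^-1` [set 0].
  by move=> h /h -> //; split.
apply: bispan_sub => [|x {}y Xy].
  by apply: submod_preimage (submod0 _); apply: nd_linear.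
rewrite /preimage /= /nad nd_ad// psi0 scale0r sub0r.
have psih h v : psi (act h (inj i v)) = 0 by rewrite -lh psi0.
rewrite !(yd_lin_coactE _ yi); [|by rewrite /nd; blin|by blin].
rewrite tsum_eq0 => [|g v0]; last first.
  by rewrite tsum_eq0// => h y0; rewrite psih scale0r.
rewrite oppr0 add0r tsum_eq0// => g v0.
have lpg : linear (fun u => psi (act g u)) by linr.
have [[c _ <-] _] := ih _ y lpg (psih g) Xy.
by rewrite (linZ ((ad_c_bilin V).2 _)) ad_c_n1 scaler0.
Qed.

(** A form on V is some [ev f] on the i-th summand plus a form [psi'] vanishing there. The second
    part is covered by [nd_other], so [nd_sep] applies. *)
Lemma nder_sep j : d_sep (@nad i) (nder ev) (range (@ngen j)).
Proof.
move=> n U _ UX dU y Uy; have Xy := UX _ Uy.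
have [li lh lc] := ydinj_yd_lin V_ i.
apply: nd_sep.
  suff : adseq (@nad i) (range (@ngen j)) n.+1 `<=` @ncounit _ _ V @^-1` [set 0] by apply.
  apply: bispan_sub => [|x z _]; last exact: ncounit_ad.
  exact: (submod_preimage (@ncounit_linear _ _ V) (submod0 _)).
move=> psi lp.
have [f fE] := pairing_ex perfect (lin_comp lp li).
pose psi' u := psi u - ev f (u i).
have lp' : linear psi' by apply: (lin_add lp (lin_opp (lev f))).
have [_ /(_ isT) n0] : range (fun c : k^o => (c : k) *: n1 V) (nd psi' y) /\
    ((0 < n.+1)%N -> nd psi' y = 0).
  by apply: (nd_other lp' _ Xy) => x; rewrite /psi' ydinj_in fE subrr.
transitivity (nd psi' y + nder ev f y); last by rewrite n0 dU// addr0.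
rewrite /nder /nd -tsumD; apply: eq_tsum => u z.
by rewrite -scalerDl /psi' subrK.
Qed.

End Der.

Lemma ad_set_bispan i (Y : set E) : ad_set (range (inj i)) Y = bispan (@nad i) Y.
Proof.
rewrite /ad_set /bispan; congr lspan; apply/seteqP; split.
  by move=> _ [_ [x _ <-] [y Yy <-]]; exists x => //; exists y.
move=> _ [x _ [y Yy <-]]; exists (inj i x); first by exists x.
by exists y.
Qed.

(* The hypothesis says that the double braiding of V_ i ⊗ V_ j is the         *)
(* identity, a condition which is symmetric in i and j.                       *)
Lemma nad_sym i j : (forall (x : V_ i) (y : V_ j), nad x (ngen y) = 0) -> i != j ->
  (exists D, yd_left_dual (V_ i) D) ->
  forall (y : V_ j) (x : V_ i), nad y (ngen x) = 0.
Proof.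
move=> ad0 ij [D [ev [be perf ea ec]]].
have [lgi _ _] := ngen_yd_lin i; have [lgj ghj _] := ngen_yd_lin j.
(* In the relation of [adsys] at f, x and [ngen y], the derivatives of [ngen y] vanish since j
   differs from i. What remains is the contraction with f of the claim. *)
have c2 (x : V_ i) (y : V_ j) : x ⊗ y = \tsum_(g, x0 <- coact x)
    \tsum_(h, y0 <- coact (act g y)) act h x0 ⊗ y0.
  apply: tensor_ext => phi lphi; have [f fE] := pairing_ex perf lphi.
  have b : bilin (fun (x : V_ i) (y : V_ j) => (phi x : k) *: y) by blin.
  rewrite tsum_ten// tsum_tsum//; under eq_tsum => g x0 do rewrite tsum_tsum//.
  apply: (@ngen_inj j); rewrite (linZ lgj) (tsum_comp _ _ lgj).
  have [_ _ _ R] := nichols_adsys be ea.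
  have := R f x (ngen y); rewrite ad0.
  have bd := nder_bilin be; rewrite (linear_at0 (bd.2 f)).
  rewrite [X in _ + X]tsum_eq0 => [|g x0]; last first.
    rewrite (nder_ngen be) 1?eq_sym// (linear_at0 _)//.
    by have [bn _ _] := nad_yd_bimap i; exact: bn.2.
  rewrite addr0 => /esym/eqP; rewrite subr_eq0 fE => /eqP ->.
  apply: eq_tsum => g x0; rewrite -ghj (yd_lin_coactE _ (ngen_yd_lin j)); last by blin.
  rewrite (tsum_comp _ _ lgj); apply: eq_tsum => h y0.
  by rewrite tsum_ten// (linZ lgj) fE.
pose μ a b (u : V_ a) (v : V_ b) : E := nmul (ngen u) (ngen v).
have adE a b (u : V_ a) (v : V_ b) : nad u (ngen v) =
    μ _ _ u v - \tsum_(g, u0 <- coact u) μ _ _ (act g v) u0.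
  rewrite /nad /ad_c /μ; congr (_ - _).
  rewrite (yd_lin_coactE _ (ydinj_yd_lin V_ a)); last by blin.
  apply: eq_tsum => g u0; congr nmul.
  by have [_ gh _] := ngen_yd_lin b; rewrite gh.
have bμ : bilin (μ i j) by rewrite /μ; blin.
(* The opposite adjoint action composed with c. By ad0 its first product is xy; the second is the
   product of c^2(x ⊗ y), which is xy by [c2]. *)
have claim (x : V_ i) (y : V_ j) :
    \tsum_(g, x0 <- coact x) nad (act g y) (ngen x0) = 0.
  under eq_tsum => g x0 do rewrite adE.
  rewrite tsumD tsumN.
  have -> : \tsum_(g, x0 <- coact x) μ j i (act g y) x0 = μ i j x y.
    by apply/esym/eqP; rewrite -subr_eq0 -adE ad0.
  apply/eqP; rewrite subr_eq0; apply/eqP.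
  transitivity (\tsum_(u, v <- x ⊗ y) μ i j u v); first by rewrite tsum_ten.
  rewrite c2 tsum_tsum//; apply: eq_tsum => g x0; rewrite tsum_tsum//.
  by apply: eq_tsum => h y0; rewrite tsum_ten.
(* The braiding is onto: y ⊗ x is the image under c of the sum of the x_(0) ⊗ S^-1(x_(-1)) y. *)
move=> y x; pose F z (x1 : V_ i) := nad (act z y) (ngen x1).
have [bn _ _] := nad_yd_bimap j.
have bF : bilin F by rewrite /F; blin.
transitivity (\tsum_(g, x0 <- coact x) \tsum_(g', x1 <- coact x0) F (g' * Si g) x1).
  rewrite -(coactA (F := fun g g' x1 => F (g' * Si g) x1)); last by tlin.
  transitivity (\tsum_(q, x1 <- coact x) (ε q : k) *: F 1 x1).
    by rewrite coact_counitE; rewrite /F ?act1//; linr.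
  by apply: eq_tsum => q x1; rewrite (Si_rE SK SiK (G := F^~ x1))//; linr.
rewrite tsum_eq0// => g x0; rewrite -[RHS](claim x0 (act (Si g) y)).
by apply: eq_tsum => g' x1; rewrite /F actM.
Qed.

End NicholsSystem.

Section DoubleReflection.
Variables (k : fieldType) (H : hopfAlgebra k).
Local Notation S := (@antipode k H).
Variable Si : H -> H.
Hypotheses (SK : cancel S Si) (SiK : cancel Si S).

(* By dual_adsys and dual_seq_sep, d and dual_d form a system for (D, V)     *)
(* whose sequence starting at the top is the first sequence read backwards;  *)
(* by uniqueness it agrees with the sequence of the second system.           *)
Lemma double_reflection (V D E E' W W0 : ydModule H) (ev : D -> V -> k^o)
    (a : V -> E -> E) (d : D -> E -> E) (a' : D -> E' -> E') (d' : V -> E' -> E')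
    (g0 : W0 -> E) (g : W -> E) (g' : W -> E') m :
  adsys Si ev a d -> yd_bimap d ->
  (forall h f v, ev (act h f) v = ev f (act (S h) v)) ->
  (forall f v, \tsum_(g, f0 <- coact f) (ev f0 v : k) *: S g =
               \tsum_(g, v0 <- coact v) (ev f v0 : k) *: g) ->
  yd_lin g0 -> injective g0 -> yd_irreducible W0 ->
  (forall f w, d f (g0 w) = 0) -> d_sep a d (range g0) ->
  ~ adseq a (range g0) m `<=` [set 0] -> adseq a (range g0) m.+1 `<=` [set 0] ->
  yd_lin g -> injective g -> range g = adseq a (range g0) m ->
  adsys Si (dual_ev Si ev) a' d' -> yd_lin g' -> injective g' ->
  (forall u w, d' u (g' w) = 0) -> d_sep a' d' (range g') ->
  [/\ ~ adseq a' (range g') m `<=` [set 0], adseq a' (range g') m.+1 `<=` [set 0] &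
    exists psi : W0 -> E',
      [/\ yd_lin psi, injective psi & range psi = adseq a' (range g') m]].
Proof.
move=> sys yd ea ec yg0 g0I W0irr dg0 sep0 Xm XSm yg gI gX sys' yg' g'I dg' sep'.
have [be ya bd _] := sys.
have yX : yd_submod (range g0).
  have [l0 h0 c0] := yg0; split; first exact: (submod_image l0 (submodT W0)).
    by move=> h _ [w _ <-]; exists (act h w).
  move=> _ [w _ <-]; rewrite c0; apply: (tsum_in_sub _ (tens_in_submod _ _)) => h x.
  by apply: tens_in_ten; exists x.
have dX f y : range g0 y -> d f y = 0 by move=> [w _ <-]; apply: dg0.
have Xirr := range_irr yg0 W0irr.
(* The index [true] stands for the given second system, [false] for the exchanged first one. *)
pose E_ (b : bool) := if b then E' else E.
pose a_ (b : bool) : D -> E_ b -> E_ b :=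
  match b return D -> E_ b -> E_ b with true => a' | false => d end.
pose d_ (b : bool) : V -> E_ b -> E_ b :=
  match b return V -> E_ b -> E_ b with true => d' | false => dual_d Si a end.
pose g_ (b : bool) : W -> E_ b :=
  match b return W -> E_ b with true => g' | false => g end.
have sysF := dual_adsys SK SiK sys yd ea ec.
have sys_ b : adsys Si (dual_ev Si ev) (a_ b) (d_ b) by case: b.
have yg_ b : yd_lin (g_ b) by case: b.
have gI_ b : injective (g_ b) by case: b.
have dg_ b u w : d_ b u (g_ b w) = 0.
  case: b => /=; first exact: dg'.
  by apply: (top_dual0 SK SiK sys yX XSm); rewrite -gX; exists w.
have sep_ b : d_sep (a_ b) (d_ b) (range (g_ b)).
  case: b => //=; rewrite gX.
  exact: (dual_seq_sep SK SiK sys yd ea ec yX Xirr dX sep0 Xm XSm).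
have bev := dual_ev_bilin SK SiK be.
have un0 := adseq_unique0 bev sys_ yg_ gI_ dg_ sep_.
(* After m steps down from the top the exchanged sequence is back at X_0, which is nonzero and is
   the image of W0. *)
have Y0 : adseq d (range g) m = range g0.
  rewrite gX (dual_seqE SK SiK sys yd ea ec yX Xirr dX sep0 Xm XSm)//.
  by rewrite subnn.
split.
- move=> Xm0; have := un0 m true false Xm0; rewrite /= Y0.
  have [[w w0] _] := W0irr; have [l0 _ _] := yg0.
  move=> /(_ (g0 w)) g00; move/eqP: w0; apply; apply: g0I.
  by rewrite (linear_at0 l0) g00//; exists w.
- apply: (un0 m.+1 false true); rewrite /= gX.
  exact: (dual_seq_endE sys yX dX).
- exact: (@adseq_unique _ _ _ _ _ _ _ _ _ bev sys_ _ _ yg_ gI_ dg_ sep_ m false true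
    _ g0 yg0 g0I (esym Y0)).
Qed.

End DoubleReflection.

(** * Reflections of tuples *)

Section Reflections.
Variables (k : fieldType) (H : hopfAlgebra k) (theta : nat).
Local Notation S := (@antipode k H).
Variable Si : H -> H.
Hypotheses (SK : cancel S Si) (SiK : cancel Si S).
Implicit Types (M N : irrtuple H theta) (i j : 'I_theta).

Local Notation ad N i := (@nad k H _ (fun l => rep (N l)) i).
Local Notation gen N j := (@ngen k H _ (fun l => rep (N l)) j).

Lemma ad_iterE N i j h : @ad_iter k H theta N i j h = adseq (ad N i) (range (gen N j)) h.
Proof.
elim: h => [|h ih].
  apply/seteqP; split=> [_ [_ [x _ <-] <-]|_ [x _ <-]]; first by exists x.
  by exists (ydinj x) => //; exists x.
by rewrite /ad_iter iterS -/(@ad_iter k H theta N i j h) ih ad_set_bispan.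
Qed.

Local Notation X N i j h := (adseq (ad N i) (range (gen N j)) h).

Lemma adX_yd N i j h : yd_submod (X N i j h).
Proof.
have [l0 h0 c0] := @ngen_yd_lin k H _ (fun l => rep (N l)) j.
apply: adseq_yd_submod; first exact: nad_yd_bimap.
split; first exact: (submod_image l0 (submodT _)).
  by move=> g _ [w _ <-]; exists (act g w).
move=> _ [w _ <-]; rewrite c0; apply: (tsum_in_sub _ (tens_in_submod _ _)) => g x.
by apply: tens_in_ten; exists x.
Qed.

Lemma ad_iter0 N i j h :
  @ad_iter k H theta N i j h = [set 0] <-> X N i j h `<=` [set 0].
Proof.
rewrite ad_iterE; split=> [->//|X0]; apply/seteqP; split=> // _ ->.
by case: (adX_yd N i j h) => -[].
Qed.

Lemma adX0 N i j : ~ X N i j 0 `<=` [set 0].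
Proof.
have [[w w0] _] := rep_irr (N j); have [l0 _ _] := @ngen_yd_lin k H _ (fun l => rep (N l)) j.
move=> /(_ (gen N j w)) g0; move/eqP: w0; apply; apply: (@ngen_inj k H _ (fun l => rep (N l)) j).
by rewrite (linear_at0 l0) g0//; exists w.
Qed.

Lemma adX_le N i j m n : X N i j m `<=` [set 0] -> (m <= n)%N -> X N i j n `<=` [set 0].
Proof.
by apply: adseq0_le; have [] := @nad_yd_bimap k H _ (fun l => rep (N l)) i.
Qed.

Lemma ad_supE N i j m :
  ~ X N i j m `<=` [set 0] -> X N i j m.+1 `<=` [set 0] -> ad_sup N i j = m.
Proof.
move=> Xm XSm; rewrite /ad_sup; set A := [set h | _].
have Am : A m by move=> /ad_iter0.
have Ale h : A h -> (h <= m)%N.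
  move=> Ah; rewrite leqNgt; apply/negP => mh; apply: Ah.
  by apply/ad_iter0; apply: adX_le XSm mh.
have sA : supremums A = [set m].
  have sm : supremums A m.
    by split=> [h /Ale|y]; [|apply].
  apply/seteqP; split=> [y sy|_ -> //].
  exact: (is_subset1_supremums sy sm).
rewrite /supremum ifF; last by apply/negbTE/set0P; exists m.
by rewrite sA; case: xgetP => [x _ ->//|/(_ m) h]; case: h.
Qed.

Lemma ad_supP N i j : i_finite N i -> j != i ->
  ~ X N i j (ad_sup N i j) `<=` [set 0] /\ X N i j (ad_sup N i j).+1 `<=` [set 0].
Proof.
move=> Nfin ji; have [h [_ /ad_iter0 Xh]] := Nfin j ji.
have ex : exists n, `[< X N i j n `<=` [set 0] >] by exists h; apply/asboolP.
have [n0 /asboolP Xn0 nmin] := ex_minnP ex.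
(* The least vanishing index is positive because X_0 is a copy of N_j; its predecessor is the
   supremum. *)
case: n0 Xn0 nmin => [/adX0 //|m Xm nmin].
have Xm' : ~ X N i j m `<=` [set 0].
  by move=> /asboolP /nmin; rewrite ltnn.
by rewrite (ad_supE Xm' Xm).
Qed.

Lemma reflection_facts N i (D : ydModule H) j : yd_left_dual (rep (N i)) D -> j != i ->
  exists ev : D -> rep (N i) -> k^o,
  [/\ bilin ev, forall phi : {linear rep (N i) -> k^o}, exists! f, ev f = phi,
      forall h f v, ev (act h f) v = ev f (act (S h) v) &
      forall f v, \tsum_(g, f0 <- coact f) (ev f0 v : k) *: S g =
                  \tsum_(g, v0 <- coact v) (ev f v0 : k) *: g] /\
  [/\ adsys Si ev (ad N i) (@nder k H _ (fun l => rep (N l)) D i ev),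
      yd_bimap (@nder k H _ (fun l => rep (N l)) D i ev),
      forall f w, @nder k H _ (fun l => rep (N l)) D i ev f (gen N j w) = 0 &
      d_sep (ad N i) (@nder k H _ (fun l => rep (N l)) D i ev) (range (gen N j))].
Proof.
move=> [ev [be perf ea ec]] ji; exists ev; split=> //; split.
- exact: (nichols_adsys SK SiK be ea).
- exact: (nder_yd_bimap SK SiK be ea ec).
- by move=> f w; exact: (nder_ngen be).
- exact: (nder_sep be perf).
Qed.

(** [double_reflection] for each j, with [dual_ev] as the pairing on the side of N'. Its
    nonvanishing and vanishing parts give the equality of the suprema, its embedding identifies N_j
    with the last term for N'. *)
Lemma reflection_sym N N' i : i_finite N i -> is_reflection i N N' ->
  [/\ i_finite N' i, is_reflection i N' N &
      forall j, j != i -> ad_sup N' i j = ad_sup N i j].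
Proof.
move=> Nfin [[ev [be perf ea ec]] topN].
have [be' perf' ea' ec'] :=
  dual_ev_left_dual SK SiK be perf ea ec (rep_fin_dim (N i)).
have main j : j != i ->
  [/\ ~ X N' i j (ad_sup N i j) `<=` [set 0], X N' i j (ad_sup N i j).+1 `<=` [set 0] &
    exists psi : rep (N j) -> nyd (vsum N'),
      [/\ yd_lin psi, injective psi & range psi = X N' i j (ad_sup N i j)]].
  move=> ji; have [f [lf fI fX fh fc]] := topN j ji.
  have [Xm XSm] := ad_supP Nfin ji.
  apply: (@double_reflection k H Si SK SiK (rep (N i)) (rep (N' i)) (nyd (vsum N))
    (nyd (vsum N')) (rep (N' j)) (rep (N j)) ev (ad N i)
    (@nder k H _ (fun l => rep (N l)) _ i ev) (ad N' i)
    (@nder k H _ (fun l => rep (N' l)) _ i (dual_ev Si ev)) (gen N j) f (gen N' j)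
    (ad_sup N i j)) => //.
  - exact: (nichols_adsys SK SiK be ea).
  - exact: (nder_yd_bimap SK SiK be ea ec).
  - exact: ngen_yd_lin.
  - exact: ngen_inj.
  - exact: rep_irr.
  - by move=> g w; apply: (nder_ngen be).
  - exact: (nder_sep be perf).
  - by rewrite fX ad_iterE.
  - exact: (nichols_adsys SK SiK be' ea').
  - exact: ngen_yd_lin.
  - exact: ngen_inj.
  - by move=> u w; apply: (nder_ngen be').
  - exact: (nder_sep be' perf').
have sup j : j != i -> ad_sup N' i j = ad_sup N i j.
  by move=> ji; have [? ? _] := main j ji; apply: ad_supE.
split=> // [j ji|].
  by have [_ ? _] := main j ji; exists (ad_sup N i j).+1; split=> //; apply/ad_iter0.
split; first by exists (dual_ev Si ev).
move=> j ji; have [_ _ [psi [[lp hp cp] pI pX]]] := main j ji.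
by exists psi; split=> //; rewrite ad_iterE sup.
Qed.

(** The function [reflection] picks some N' by choice; this makes the result independent of the
    pick. *)
Lemma reflection_unique N M M' i :
  is_reflection i N M -> is_reflection i N M' -> M = M'.
Proof.
move=> [dM tM] [dM' tM']; apply/funext => j; apply: isoclass_eq.
have [->|ji] := eqVneq j i; first exact: (left_dual_unique SK (rep_fin_dim (N i)) dM dM').
have [f [lf fI fX fh fc]] := tM j ji; have [f' [lf' fI' fX' fh' fc']] := tM' j ji.
by apply: (@same_range_iso _ _ _ _ (nyd (vsum N)) f f') => //; rewrite fX fX'.
Qed.

End Reflections.

(** * Finite dimension of the terms of the sequence *)

Section FiniteSpan.
Variable k : fieldType.

Definition fin_span (V : lmodType k) (A : set V) := exists s : seq V, lspan [set` s] = A.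

Lemma fin_span_range (V W : lmodType k) (g : V -> W) :
  linear g -> fin_span [set: V] -> fin_span (range g).
Proof.
move=> lg [s sV]; exists [seq g x | x <- s]; apply/seteqP; split.
  apply: lspan_sub => [|y /mapP[x _ ->]]; last by exists x.
  exact: (submod_image lg (submodT V)).
move=> _ [x _ <-]; have : lspan [set` s] x by rewrite sV.
apply: (lspan_sub (B := g @^-1` lspan [set` [seq g x | x <- s]])).
  exact: (submod_preimage lg (submod_lspan _)).
by move=> y ys; apply: lspan_gen; rewrite /= map_f.
Qed.

Lemma fin_span_inj (V W : lmodType k) (g : V -> W) :
  linear g -> injective g -> fin_span (range g) -> fin_span [set: V].
Proof.
move=> lg gI [s sg]; have [r [lr rg]] := lin_retract lg gI.
exists [seq r y | y <- s]; apply/seteqP; split=> // v _; rewrite -[v]rg.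
have : lspan [set` s] (g v) by rewrite sg; exists v.
apply: (lspan_sub (B := r @^-1` lspan [set` [seq r y | y <- s]])).
  exact: (submod_preimage lr (submod_lspan _)).
by move=> y ys; apply: lspan_gen; rewrite /= map_f.
Qed.

Lemma fin_span_bispan (H : hopfAlgebra k) (V E W : ydModule H) (a : V -> E -> W) (A : set E) :
  bilin a -> fin_span [set: V] -> fin_span A -> fin_span (bispan a A).
Proof.
move=> ba [t tV] [s sA]; exists [seq a x y | x <- t, y <- s].
apply/seteqP; split.
  apply: lspan_sub => [|z /allpairsP[[x y] [xt ys ->]]]; first exact: bispan_submod.
  by apply: bispan_in; rewrite -sA; apply: lspan_gen.
apply: bispan_sub => [|x y]; first exact: submod_lspan.
set L := lspan _; have sL : submod L by exact: submod_lspan.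
have : lspan [set` t] x by rewrite tV.
rewrite -sA => tx sy; move: x tx; apply: (lspan_sub (B := (a^~ y) @^-1` L)).
  exact: (submod_preimage (ba.1 y) sL).
move=> x xt; move: y sy; apply: (lspan_sub (B := a x @^-1` L)).
  exact: (submod_preimage (ba.2 x) sL).
by move=> y ys; apply: lspan_gen; apply/allpairsP; exists (x, y).
Qed.

End FiniteSpan.

(** * Existence of reflections and the axioms of a Cartan scheme *)

Section CartanScheme.
Variables (k : fieldType) (H : hopfAlgebra k) (theta : nat).
Local Notation S := (@antipode k H).
Variable Si : H -> H.
Hypotheses (SK : cancel S Si) (SiK : cancel Si S).
Implicit Types (M N : irrtuple H theta) (i j : 'I_theta).

Local Notation ad N i := (@nad k H _ (fun l => rep (N l)) i).
Local Notation gen N j := (@ngen k H _ (fun l => rep (N l)) j).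
Local Notation X N i j h := (adseq (ad N i) (range (gen N j)) h).

Lemma adX_fin_span N i j h : fin_span (X N i j h).
Proof.
have [lg _ _] := @ngen_yd_lin k H _ (fun l => rep (N l)) j.
elim: h => [|h ih]; first exact: (fin_span_range lg (rep_fin_dim (N j))).
have [ba _ _] := @nad_yd_bimap k H _ (fun l => rep (N l)) i.
exact: (fin_span_bispan ba (rep_fin_dim (N i)) ih).
Qed.

Lemma reflection_exists N i : i_finite N i -> exists N', is_reflection i N N'.
Proof.
move=> Nfin; have [D dD] := dual_exists SK SiK (rep_fin_dim (N i)).
(* The two guarded clauses put the index i and the other indices into one statement, so that choice
   yields a whole tuple. *)
have ex j : exists C : isoclass H,
    (j = i -> yd_left_dual (rep (N i)) (rep C)) /\
    (j != i -> nichols_sub_iso (rep C) (@ad_iter k H theta N i j (ad_sup N i j))).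
  have [->|ji] := eqVneq j i.
    have [ev [be perf ea ec]] := dD.
    have [C DC] := isoclass_exists (dual_fin_dim be perf (rep_fin_dim (N i)))
      (dual_irreducible SiK be perf ea ec (rep_fin_dim (N i)) (rep_irr (N i))).
    by exists C; split=> // _; apply: left_dual_iso DC.
  have [Xm XSm] := ad_supP Nfin ji; set m := ad_sup N i j in Xm XSm *.
  have yX := adX_yd N i j m.
  have [W [f [yf fI fX]]] := sub_yd_exists yX; have [lf _ _] := yf.
  have Wfin : fin_dim W.
    by apply: (fin_span_inj lf fI); rewrite fX; apply: adX_fin_span.
  have Wirr : yd_irreducible W.
    apply: (irr_range yf fI fX Xm).
    have [ev [[be perf ea ec] [sys yd dX sep]]] := reflection_facts SK SiK dD ji.
    apply: (top_irr SK SiK sys yd ea ec (adX_yd N i j 0) _ _ sep XSm).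
      exact: (range_irr (ngen_yd_lin _ j) (rep_irr (N j))).
    by move=> g y [w _ <-]; apply: dX.
  have [C /yd_iso_sym/yd_isoP[g [yg bg]]] := isoclass_exists Wfin Wirr.
  exists C; split=> [ji0|_]; first by rewrite ji0 eqxx in ji.
  have [lfg hfg cfg] := yd_lin_comp yf yg.
  exists (fun w => f (g w)); split=> //.
    by apply: inj_comp => //; apply: bij_inj.
  rewrite ad_iterE -fX; apply/seteqP; split=> [_ [w _ <-]|_ [w _ <-]].
    by exists (g w).
  by case: bg => g' _ gK; exists (g' w) => //; rewrite gK.
have [N' N'P] := choice ex.
exists N'; split; first exact: (N'P i).1.
by move=> j; exact: (N'P j).2.
Qed.

Lemma reflectionP N i : i_finite N i -> is_reflection i N (reflection i N).
Proof.
move=> Nfin; rewrite /reflection; case: pselect => [p|[]]; first by case: cid.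
by split=> //; apply: reflection_exists.
Qed.

Lemma reflectionK N i : i_finite N i -> reflection i (reflection i N) = N.
Proof.
move=> Nfin; have [rfin rN _] := reflection_sym SK SiK Nfin (reflectionP Nfin).
exact: (reflection_unique SK (reflectionP rfin) rN).
Qed.

Lemma ad_sup_reflection N i j : i_finite N i -> j != i ->
  ad_sup (reflection i N) i j = ad_sup N i j.
Proof.
by move=> Nfin ji; have [_ _] := reflection_sym SK SiK Nfin (reflectionP Nfin); apply.
Qed.

(** The value 0 says that X_1 = 0, that is, all ad_c(x)(y) with x in N_i and y in N_j vanish;
    [nad_sym] exchanges i and j. *)
Lemma ad_sup_sym0 N i j : i_finite N i -> i != j -> ad_sup N i j = 0%N -> ad_sup N j i = 0%N.
Proof.
move=> Nfin ij N0; have ji : j != i by rewrite eq_sym.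
have [_ X1] := ad_supP Nfin ji; rewrite N0 in X1.
apply: ad_supE; first exact: adX0.
apply: bispan_sub => [|y _ [x _ <-]]; first exact: submod0.
apply: (nad_sym SK SiK _ ij (dual_exists SK SiK (rep_fin_dim (N i)))).
move=> {y} {}x y; by apply: X1; apply: bispan_in; exists y.
Qed.

Lemma cartan_entry_gcm N : all_finite N -> gen_cartan_matrix (cartan_entry N).
Proof.
move=> Nfin; rewrite /cartan_entry; split=> [i|i j ij|i j].
- by rewrite eqxx.
- by rewrite (negPf ij) Num.Theory.oppr_le0.
- case: eqVneq => // ij /eqP; rewrite oppr_eq0 => /eqP [s0].
  by rewrite (ad_sup_sym0 (Nfin i) ij s0) oppr0.
Qed.

End CartanScheme.

Local Close Scope ring_scope.
Local Close Scope classical_set_scope.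

Theorem theorem6p10 (k : fieldType) (H : hopfAlgebra k)
  (S_bij : bijective (@antipode k H)) (theta : nat) (theta_gt0 : 0 < theta)
  (M : irrtuple H theta)
  (M_finite : forall N : irrtuple H theta, refl_orbit M N -> all_finite N) :
  cartan_scheme (orbit_reflection M)
    (fun N : orbit_tuple M => cartan_entry (sval N)).
Proof.
case: S_bij => Si SK SiK; split.
- exact: (inhabits (Ordinal theta_gt0)).
- by apply: inhabits; exists M, [::].
- by move=> [N MN]; apply: (cartan_entry_gcm SK SiK); apply: M_finite.
(* Points of the orbit carry a proof of membership; proof irrelevance reduces the claim to the
   tuples. *)
- move=> i [N MN]; apply: eq_sig_hprop => [P|]; first exact: Prop_irrelevance.
  by rewrite /=; apply: (reflectionK SK SiK); apply: M_finite.
- move=> [N MN] i j; rewrite /cartan_entry /=; have [//|ij] := eqVneq i j.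
  rewrite (ad_sup_reflection SK SiK) 1?eq_sym//.
  exact: M_finite.
Qed.
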